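(* Let $W$ be a Gaussian free field on the unit disk $\mathbb{D}$, and let $W^{\mathbf h}_{\rho}(z)$ denote its hyperbolic average over the hyperbolic circle of centre $z$ and radius $\rho$. The centred Gaussian process $(W^{\mathbf h}_\rho(z))_{(z,\rho)\in\mathbb{D}\times(0,+\infty)}$ admits a continuous version. Moreover, for any such continuous version and for every $z_0\in\mathbb{D}$, the process $(B_t(z_0))_{t\in[0,+\infty)}$ defined by $$B_t(z_0)=\begin{cases}W^{\mathbf h}_{\rho(t)}(z_0)&\text{if }t>0,\\ 0&\text{if }t=0,\end{cases}\qquad\text{where }\rho(t)=\operatorname{artanh}(e^{-t}),$$ is a standard real Brownian motion.
   Context: $\mathbb{D}=\{z\in\mathbb{C}: |z|<1\}$; all vector spaces and functions are real. The hyperbolic metric on $\mathbb{D}$ is $g^{\mathbf h}_z(u,v)=(1-|z|^2)^{-2}\,g_z(u,v)$, where $g$ is the Euclidean metric. $d^{\mathbf h}$ is the associated distance (infimum of $g^{\mathbf h}$-lengths of smooth paths), so that $|z|=\tanh(d^{\mathbf h}(0,z))$. An isometry of the Poincaré disk is a $C^\infty$-diffeomorphism of $\mathbb{D}$ preserving $g^{\mathbf h}$. For each $z\in\mathbb{D}$, $\Phi_z$ denotes an isometry of the Poincaré disk with $\Phi_z(z)=0$ (the functions below do not depend on the choice). $H_0^1(\mathbb{D})$ is the closure of $C_c^\infty(\mathbb{D})$ in the Sobolev space $H^1(\mathbb{D})$ (Euclidean Lebesgue measure), regarded as a Hilbert space with the inner product $\langle u,v\rangle=\frac{1}{2\pi}\int_{\mathbb{D}}\nabla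 u\cdot\nabla v\,dx\,dy$. A Gaussian free field on $\mathbb{D}$ is a linear isometry $W:H_0^1(\mathbb{D})\to L^2(\Omega,\mathcal{F},\mathbb{P})$, for some probability space, such that for every $u\in H_0^1(\mathbb{D})$ the random variable $W(u)$, also written $\langle u,W\rangle$, is a centred real Gaussian (necessarily of variance $\|u\|^2=\langle u,u\rangle$). For $r\in(0,1)$ set $G_0^r(z)=-\ln(\max(r,|z|))$, $z\in\mathbb{D}$; one has $G_0^r\circ\Phi_z\in H_0^1(\mathbb{D})$. For $z\in\mathbb{D}$ and $\rho>0$, the hyperbolic average of $W$ over the hyperbolic circle of centre $z$ and radius $\rho$ is defined as $W^{\mathbf h}_\rho(z):=\langle G_0^r\circ\Phi_z,W\rangle$ with $r=\tanh(\rho)$. A version of a process is a process on the same probability space and with the same index set which, at each index, is almost surely equal to the original one; it is continuous if its sample paths are continuous. A standard real Brownian motion is a centred real Gaussian process indexed by $[0,+\infty)$ with covariance $(s,t)\mapsto\min(s,t)$ and almost surely continuous paths. *)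

(* Defs.v *)
From HB Require Import structures.
From mathcomp Require Import all_boot all_order all_algebra.
From mathcomp Require Import all_classical all_reals all_analysis.
Import Order.TTheory GRing.Theory Num.Theory.
Import numFieldNormedType.Exports.
Set Implicit Arguments.
Unset Strict Implicit.
Unset Printing Implicit Defensive.
Local Open Scope classical_set_scope.
Local Open Scope ring_scope.

(* The complex plane is R * R.  A function on the unit disk is represented by a
   function on the whole plane whose values off the disk are irrelevant. *)

Section Calculus.
Context {R : realType} {V W : normedModType R}.

(* f is C^(k+1) iff it is differentiable and all its directional derivatives
   are C^k; meant for open U and finite-dimensional V. *)
Fixpoint Ck (k : nat) (U : set V) (f : V -> W) : Prop :=
  if k is k'.+1 then
    (forall z, U z -> differentiable f z) /\
    (forall v, Ck k' U (fun z => 'D_v f z))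
  else forall z, U z -> {for z, continuous f}.

Definition smooth (U : set V) (f : V -> W) : Prop := forall k, Ck k U f.

End Calculus.

Section Disk.
Context {R : realType}.
Implicit Types (z a b : R * R) (F : R * R -> R * R).

Definition modulus z : R := Num.sqrt (z.1 ^+ 2 + z.2 ^+ 2).

Definition disk : set (R * R) := [set z | modulus z < 1].

Definition euclidean_metric a b : R := a.1 * b.1 + a.2 * b.2.

Definition hyperbolic_metric z a b : R :=
  (1 - modulus z ^+ 2) ^- 2 * euclidean_metric a b.

Definition diffeomorphism F : Prop :=
  exists G : R * R -> R * R,
    [/\ smooth disk F /\ smooth disk G,
        (forall z, disk z -> disk (F z)) /\ (forall z, disk z -> disk (G z)),
        (forall z, disk z -> G (F z) = z) &
        (forall z, disk z -> F (G z) = z)].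

Definition poincare_isometry F : Prop :=
  diffeomorphism F /\
  forall z a b, disk z ->
    hyperbolic_metric (F z) ('d F z a) ('d F z b) = hyperbolic_metric z a b.

Definition tanh (x : R) : R := (expR x - expR (- x)) / (expR x + expR (- x)).

Definition artanh (x : R) : R := 2^-1 * ln ((1 + x) / (1 - x)).

(* The truncated Green function with pole at 0, for 0 < r < 1. *)
Definition G0 (r : R) z : R := - ln (Num.max r (modulus z)).

End Disk.

Section Sobolev.
Context {R : realType}.
Implicit Types (u v p phi : R * R -> R).

Definition leb2 :
    {measure set (measurableTypeR R * measurableTypeR R) -> \bar R} :=
  (@lebesgue_measure R \x @lebesgue_measure R)%E.

Definition square_integrable u : Prop :=
  measurable_fun (@disk R : set (measurableTypeR R * measurableTypeR R)) u /\
  (\int[leb2]_(z in disk) (u z ^+ 2)%:E < +oo)%E.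

Definition test_function phi : Prop :=
  smooth disk phi /\
  exists K : set (R * R),
    [/\ compact K, K `<=` disk & forall z, disk z -> ~ K z -> phi z = 0].

Definition weak_derivative (e : R * R) u p : Prop :=
  square_integrable p /\
  forall phi, test_function phi ->
    \int[leb2]_(z in disk) (u z * 'D_e phi z) =
    - \int[leb2]_(z in disk) (p z * phi z).

Definition dir_x : R * R := (1, 0).
Definition dir_y : R * R := (0, 1).

Definition sobolev_H1 u : Prop :=
  [/\ square_integrable u,
      exists p, weak_derivative dir_x u p &
      exists p, weak_derivative dir_y u p].

(* Representatives of the weak partial derivatives, which are unique up to
   equality almost everywhere on the disk; junk (zero) if there is none. *)
Definition weak_dx u : R * R -> R := xget (cst 0) (weak_derivative dir_x u).
Definition weak_dy u : R * R -> R := xget (cst 0) (weak_derivative dir_y u).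

Definition H1_norm u : R :=
  Num.sqrt (\int[leb2]_(z in disk)
    (u z ^+ 2 + weak_dx u z ^+ 2 + weak_dy u z ^+ 2)).

Definition sobolev_H10 u : Prop :=
  sobolev_H1 u /\
  forall eps : R, 0 < eps ->
    exists phi, test_function phi /\ H1_norm (u \- phi) < eps.

Definition dirichlet u v : R :=
  (2 * pi)^-1 *
  \int[leb2]_(z in disk)
    (weak_dx u z * weak_dx v z + weak_dy u z * weak_dy v z).

Definition dirichlet_norm u : R := Num.sqrt (dirichlet u u).

End Sobolev.

Section Processes.
Context {R : realType} {d : measure_display} {Omega : measurableType d}.
Variable P : probability Omega R.

(* The case s = 0 is separate because normal_prob m 0 is not the Dirac mass. *)
Definition centred_gaussian (X : Omega -> R) : Prop :=
  measurable_fun [set: Omega] X /\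
  exists s : R, 0 <= s /\
    forall A : set (measurableTypeR R), measurable A ->
      P (X @^-1` A) = if s == 0 then \d_(0 : R) A else normal_prob 0 s A.

(* A process with index set A is only considered at the indices in A. *)
Definition centred_gaussian_process (I : Type) (A : set I)
    (X : I -> Omega -> R) : Prop :=
  forall (n : nat) (i : 'I_n -> I) (c : 'I_n -> R), (forall k, A (i k)) ->
    centred_gaussian (fun w => \sum_(k < n) c k * X (i k) w).

Definition version (I : Type) (A : set I) (X Y : I -> Omega -> R) : Prop :=
  forall i, A i ->
    measurable_fun [set: Omega] (Y i) /\ {ae P, forall w, Y i w = X i w}.

Definition continuous_version (I : topologicalType) (A : set I)
    (X Y : I -> Omega -> R) : Prop :=
  version A X Y /\ forall w, {within A, continuous (fun i => Y i w)}.

Definition standard_brownian_motion (B : R -> Omega -> R) : Prop :=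
  [/\ centred_gaussian_process `[0, +oo[ B,
      (forall s t, 0 <= s -> 0 <= t ->
         covariance P (B s) (B t) = (Num.min s t)%:E) &
      {ae P, forall w, {within `[0, +oo[, continuous (fun t => B t w)}}].

(* A linear isometry from H^1_0 into L^2(P), both sides being given by
   representatives: linearity and the isometry make W u and W v almost surely
   equal whenever u and v are almost everywhere equal on the disk. *)
Definition gaussian_free_field (W : (R * R -> R) -> Omega -> R) : Prop :=
  [/\ (forall u, sobolev_H10 u -> W u \in Lfun P 2%:E),
      (forall (a : R) u v, sobolev_H10 u -> sobolev_H10 v ->
         {ae P, forall w, W (fun z => a * u z + v z) w = a * W u w + W v w}),
      (forall u, sobolev_H10 u ->
         'N[P]_(2%:E)[EFin \o W u]%E = (dirichlet_norm u)%:E) &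
      (forall u, sobolev_H10 u -> centred_gaussian (W u))].

(* To be used when Phi z is an isometry of the Poincare disk mapping z to 0. *)
Definition hyperbolic_average (W : (R * R -> R) -> Omega -> R)
    (Phi : R * R -> R * R -> R * R) (rho : R) (z : R * R) : Omega -> R :=
  W (G0 (tanh rho) \o Phi z).

End Processes.

(* Main.v *)
Require Import Defs.
From HB Require Import structures.
From mathcomp Require Import all_boot all_order all_algebra.
From mathcomp Require Import all_classical all_reals all_analysis.
From mathcomp Require Import measurable_realfun ring lra.
Import Order.TTheory GRing.Theory Num.Theory.
Import numFieldNormedType.Exports.
Set Implicit Arguments.
Unset Strict Implicit.
Unset Printing Implicit Defensive.
Local Open Scope classical_set_scope.
Local Open Scope ring_scope.

(** With q_z(w) = |w - z|^2 / |1 - conj(z) w|^2, the Schwarz-Pick lemma applied to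
    an isometry and to its inverse gives |Phi_z(w)|^2 = q_z(w), so that the
    hyperbolic average at (z, rho) is W applied to
    g_(k,z) = -1/2 ln max(k, q_z), where k = tanh(rho)^2.

    This function is a bounded pointwise limit of test functions whose gradients
    converge boundedly, hence lies in H^1_0; integrating by parts a regularization
    of the gradient of the Green function yields <g_(k,z), g_(m,z)> = -1/2 ln max(k, m),
    which is min(s, t) when k = e^(-2s) and m = e^(-2t).  Moreover
    |g_(k,z) - g_(k',z')|^2 is locally O(|z - z'| + |k - k'|): where neither function
    is truncated the gradients are Lipschitz in z, and the rest of the energy is
    carried by thin level annuli of q_z and q_z'.

    A Gaussian process on an open set of R^3 whose increments have variance at most
    linear in the distance has a continuous version: by the Gaussian tail and
    Borel-Cantelli, almost surely all increments between neighbouring dyadic points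
    of level n are at most (3/4)^n for n large.  Continuity of the Brownian motion
    at 0 comes from the same theorem applied to t |-> B_|t|. *)

(** * Differential calculus *)

(** [Phi z] is an arbitrary isometry, so no formula for it is at hand; comparing it with an explicit
    Moebius map avoids any classification of isometries and covers the orientation-reversing ones.
    The function g_(k,z) has a corner along q_z = k and its support reaches the unit circle, whereas
    test functions are smooth with compact support: the smooth positive part [ramp] is applied once
    against each of these two defects. An increment at dyadic level n has standard deviation of
    order 2^(-n/2). The ratio 3/4 lies strictly between 1/sqrt 2 and 1: the bounds (3/4)^n are
    summable, and exceeding them is so unlikely that the number of pairs of grid points, of order
    64^n in dimension 3, does no harm. Continuity of B at 0 cannot be read off the continuous
    version, because t -> 0 means rho -> +oo, which leaves the index set. A continuous version of
    B_|t| agrees with B at all nonnegative rationals almost surely, and continuity of B at every t >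
    0 extends the agreement to all t. *)

Lemma is_derive_comp1 (R : realType) (V : normedModType R) (f : R -> R) (g : V -> R)
    (z v : V) (df dg : R) :
  is_derive (g z) 1 f df -> is_derive z v g dg ->
  is_derive z v (f \o g) (df * dg).
Proof.
(* The derivative of k at z along v is that of h |-> k (h v + z) at 0, which reduces the claim to
   the one-variable chain rule. *)
have aux (k : V -> R) : 'D_v k z = 'D_1 (fun h : R => k (h *: v + z)) 0.
  rewrite /derive; 
  apply: (f_equal (fun F => lim (F @ 0^'))); apply/funext => h /=.
  by rewrite addr0 scale0r add0r (_ : h *: 1 = h) //; exact: mulr1.
move=> Df Dg.
have Dg0 : is_derive (0 : R) 1 (fun h : R => g (h *: v + z)) dg.
  case: Dg => dg0 dgE; split; first exact: (iffLR (derivable1P g z v) dg0).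
  by rewrite -aux.
have Dfg : is_derive (0 : R) 1 (f \o (fun h : R => g (h *: v + z))) (df * dg).
  by apply: is_derive1_comp; rewrite scale0r add0r.
split; first by apply/derivable1P; case: Dfg.
by rewrite aux; case: Dfg.
Qed.

(** The first-order expansion at z depends only on the germ there, so the differential of f serves
    for g. *)
Lemma near_eq_differentiable (R : realType) (V W : normedModType R) (f g : V -> W) (z : V) :
  (\near z, f z = g z) -> differentiable f z -> differentiable g z.
Proof.
move=> fg df; have fgz : f z = g z by exact: nbhs_singleton fg.
have dE : g \o shift z = cst (g z) + 'd f z +o_ 0 id.
  have /eqaddoP fE := diff_locally df.
  apply/eqaddoP => e e0; near=> h.
  have <- : (f \o shift z - (cst (f z) + 'd f z)) h =
      (g \o shift z - (cst (g z) + 'd f z)) h.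
    rewrite /GRing.add /GRing.opp/= fgz.
    suff -> : f (h + z) = g (h + z) by [].
    by near: h; move: fg; rewrite (near_shift 0 z) subr0.
  by near: h; exact: fE.
have cdf : continuous ('d f z) by exact: diff_continuous.
by apply/diff_locallyP; rewrite (diff_unique cdf dE).
Unshelve. all: by end_near. Qed.

Lemma Ck_continuous (R : realType) (V W : normedModType R) k (U : set V)
    (f : V -> W) z : Ck k U f -> U z -> {for z, continuous f}.
Proof.
case: k => [|k] /=; first by move=> /[apply].
by move=> [+ _] Uz => /(_ z Uz) df; exact: differentiable_continuous.
Qed.

Lemma Ck_ext (R : realType) (V W : normedModType R) k (U : set V)
    (f g : V -> W) :
  open U -> (forall z, U z -> f z = g z) -> Ck k U f -> Ck k U g.
Proof.
move=> oU; elim: k f g => [|k IH] f g fg.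
  move=> /= cf z Uz; have fgz := fg z Uz.
  rewrite /prop_for /continuous_at -fgz.
  apply: cvg_trans (cf z Uz); apply: near_eq_cvg.
  by near=> w; apply: fg; near: w; exact: open_nbhs_nbhs.
move=> [df Df]; have fgn z : U z -> \near z, f z = g z.
  by move=> Uz; near=> w; apply/fg; near: w; exact: open_nbhs_nbhs.
split=> [z Uz|v]; first by apply: near_eq_differentiable (df z Uz); exact: fgn.
by apply: IH (Df v) => z Uz; apply: near_eq_derive; exact: fgn.
Unshelve. all: by end_near. Qed.

Lemma Ck_cst (R : realType) (V W : normedModType R) k (U : set V) (c : W) :
  Ck k U (fun _ : V => c).
Proof.
elim: k c => [|k IH] c /=; first by move=> z _; exact: cst_continuous.
split=> [z _|v]; first exact: differentiable_cst.
suff -> : (fun z => 'D_v (fun=> c) z) = (fun=> 0) by exact: IH.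
by apply/funext => z; exact: derive_cst.
Qed.

Lemma Ck_add (R : realType) (V W : normedModType R) k (U : set V)
    (f g : V -> W) :
  open U -> Ck k U f -> Ck k U g -> Ck k U (fun z => f z + g z).
Proof.
move=> oU; elim: k f g => [|k IH] f g.
  by move=> /= cf cg z Uz; apply: cvgD; [exact: cf|exact: cg].
move=> [df Df] [dg Dg]; split=> [z Uz|v].
  by apply: differentiableD; [exact: df|exact: dg].
apply: (@Ck_ext _ _ _ _ _ (fun z => 'D_v f z + 'D_v g z)) => //; last exact: IH (Df v) (Dg v).
move=> z Uz; rewrite -deriveD//; apply: diff_derivable; [exact: df|exact: dg].
Qed.

Lemma Ck_pred (R : realType) (V W : normedModType R) k (U : set V)
    (f : V -> W) : Ck k.+1 U f -> Ck k U f.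
Proof.
elim: k f => [|k IH] f [df Df]; first by move=> z Uz; exact/differentiable_continuous/df.
by split=> // v; exact: IH.
Qed.

Lemma Ck_mul (R : realType) (V : normedModType R) k (U : set V)
    (f g : V -> R) :
  open U -> Ck k U f -> Ck k U g -> Ck k U (fun z => f z * g z).
Proof.
move=> oU; elim: k f g => [|k IH] f g.
  by move=> /= cf cg z Uz; apply: cvgM; [exact: cf|exact: cg].
move=> Cf Cg; have [[df Df] [dg Dg]] := (Cf, Cg); split=> [z Uz|v].
  by apply: differentiableM; [exact: df|exact: dg].
apply: (@Ck_ext _ _ _ _ _ (fun z => f z * 'D_v g z + g z * 'D_v f z)) => //.
  move=> z Uz; rewrite deriveM//; apply: diff_derivable; [exact: df|exact: dg].
by apply: Ck_add => //;
  [exact: IH (Ck_pred Cf) (Dg v)|exact: IH (Ck_pred Cg) (Df v)].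
Qed.

(** Since D_v (f o g) = (f' o g) D_v g, the class of f o g is reduced to that of f' o g one order
    lower. Inverses, logarithms and flat functions follow by induction, as their derivatives are
    built from functions of the same kind or already treated. *)
Lemma Ck_comp_step (R : realType) (V : normedModType R) k (U : set V)
    (g : V -> R) (f f' : R -> R) :
  open U -> (forall z, U z -> is_derive (g z) 1 f (f' (g z))) ->
  Ck k.+1 U g -> Ck k U (f' \o g) -> Ck k.+1 U (f \o g).
Proof.
move=> oU ff' [dg Dg] Cf'; split=> [z Uz|v].
  apply: differentiable_comp; first exact: dg.
  by apply/derivable1_diffP; case: (ff' z Uz).
apply: (@Ck_ext _ _ _ _ _ (fun z => f' (g z) * 'D_v g z)) => //.
  move=> z Uz; apply/esym.
  have dgz : is_derive z v g ('D_v g z).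
    by apply: derivableP; apply: diff_derivable; exact: dg.
  by case: (is_derive_comp1 (ff' z Uz) dgz).
exact: Ck_mul oU Cf' (Dg v).
Qed.

Lemma Ck_linear (R : realType) (V W : normedModType R) k (U : set V)
    (f : {linear V -> W}) : continuous f -> Ck k U f.
Proof.
move=> cf; case: k => [|k] /=; first by move=> z _; exact: cf.
split=> [z _|v]; first exact: linear_differentiable.
suff -> : (fun z => 'D_v f z) = (fun=> f v) by exact: Ck_cst.
by apply/funext => z; rewrite deriveE ?diff_lin//; exact: linear_differentiable.
Qed.

Lemma Ck_inv (R : realType) (V : normedModType R) k (U : set V) (f : V -> R) :
  open U -> (forall z, U z -> f z != 0) -> Ck k U f ->
  Ck k U (fun z => (f z)^-1).
Proof.
move=> oU f0; elim: k => [|k IH] Cf.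
  by move=> z Uz; apply: cvgV; [exact: f0|exact: Cf].
(* The derivative -1/x^2 is written as a product of inverses so that the induction hypothesis
   applies to each factor. *)
apply: (@Ck_comp_step _ _ _ _ f (fun x => x^-1) (fun x => - 1 * (x^-1 * x^-1))) => //.
  move=> z Uz; rewrite mulN1r -invfM -expr2 -[- _]mulr1.
  by apply: is_deriveV; exact: f0.
apply: (@Ck_mul _ _ _ _ (fun=> - 1)) => //; first exact: Ck_cst.
by apply: Ck_mul => //; apply: IH; exact: Ck_pred.
Qed.

Lemma Ck_ln (R : realType) (V : normedModType R) k (U : set V) (f : V -> R) :
  open U -> (forall z, U z -> 0 < f z) -> Ck k U f ->
  Ck k U (fun z => ln (f z)).
Proof.
move=> oU f0; case: k => [|k] Cf.
  move=> z Uz; apply: (@continuous_comp _ _ _ f (@ln R)); first exact: Cf.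
  exact/continuous_ln/f0.
apply: (@Ck_comp_step _ _ _ _ f (@ln R) (fun x => x^-1)) => //.
  by move=> z Uz; exact/is_derive1_ln/f0.
by apply: Ck_inv => //; [move=> z Uz; rewrite gt_eqF// f0|exact: Ck_pred].
Qed.

Lemma Ck_fst (R : realType) k (U : set (R * R)) : Ck k U (@fst R R).
Proof. by apply: (Ck_linear _ _ (f := @fst R R)) => z; exact: cvg_fst. Qed.

Lemma Ck_snd (R : realType) k (U : set (R * R)) : Ck k U (@snd R R).
Proof. by apply: (Ck_linear _ _ (f := @snd R R)) => z; exact: cvg_snd. Qed.

Lemma is_derive_fst (R : realType) (z v : R * R) : is_derive z v fst v.1.
Proof.
have cf : continuous (fst : R * R -> R) by move=> w; exact: cvg_fst.
have d : differentiable (fst : R * R -> R) z by exact: linear_differentiable.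
by split; [exact: diff_derivable|rewrite deriveE// diff_lin].
Qed.

Lemma is_derive_snd (R : realType) (z v : R * R) : is_derive z v snd v.2.
Proof.
have cf : continuous (snd : R * R -> R) by move=> w; exact: cvg_snd.
have d : differentiable (snd : R * R -> R) z by exact: linear_differentiable.
by split; [exact: diff_derivable|rewrite deriveE// diff_lin].
Qed.

(* The family of flat functions is stable under derivation, up to linear
   combinations: this is what makes them smooth at 0. *)
Definition flat (R : realType) (eps : R) n (x : R) : R :=
  if 0 < x then x ^- n * expR (- (eps / x)) else 0.

Lemma flat_ge0 (R : realType) (eps : R) n x : 0 <= flat eps n x.
Proof.
rewrite /flat; case: ifPn => // x0.
by rewrite mulr_ge0 ?expR_ge0// invr_ge0 exprn_ge0// ltW.
Qed.

(** Raise exp (y / (m + 1)) >= y / (m + 1) to the power m + 1 and invert. It yields both the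
    flatness at 0 of [flat] and the geometric decay of Gaussian tails. *)
Lemma expRN_le (R : realType) (y : R) m : 0 < y ->
  expR (- y) <= (m.+1%:R / y) ^+ m.+1.
Proof.
move=> y0; have m0 : 0 < m.+1%:R :> R by rewrite ltr0n.
have H : (y / m.+1%:R) ^+ m.+1 <= expR y.
  rewrite -{2}(@divfK _ m.+1%:R _ y) ?gt_eqF// expRM_natr.
  apply: lerXn2r; rewrite ?nnegrE ?expR_ge0 ?divr_ge0 ?ltW//.
  by apply: lt_le_trans (expR_ge1Dx _); rewrite ltrDr.
rewrite expRN -[leLHS]div1r ler_pdivrMr ?expR_gt0//.
apply: le_trans (ler_wpM2l _ H); last by rewrite exprn_ge0// divr_ge0 ?ltW.
by rewrite -exprMn -(invf_div y) mulVf ?expr1n// gt_eqF ?divr_gt0.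
Qed.

(** A larger m gives a higher power of x on the right: the function vanishes at 0 to every order. *)
Lemma flat_le (R : realType) (eps : R) n m x : 0 < eps -> (n <= m)%N ->
  `|flat eps n x| <= (m.+1%:R / eps) ^+ m.+1 * `|x| ^+ (m.+1 - n).
Proof.
move=> e0 nm; rewrite /flat; case: ifPn => x0; last first.
  by rewrite normr0 mulr_ge0// exprn_ge0// divr_ge0 ?ltW.
rewrite gtr0_norm; last by rewrite mulr_gt0 ?expR_gt0// invr_gt0 exprn_gt0.
have y0 : 0 < eps / x by rewrite divr_gt0.
rewrite (gtr0_norm x0).
apply: le_trans (ler_wpM2l _ (expRN_le m y0)) _.
  by rewrite invr_ge0 exprn_ge0// ltW.
rewrite invf_div mulrA mulrAC exprMn mulrCA ler_wpM2l//.
  by rewrite exprn_ge0// divr_ge0 ?ltW.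
by rewrite mulrC expfB// ltnS.
Qed.

Lemma is_derive0_quadratic (R : realType) (f : R -> R) (C : R) :
  (forall x, `|f x| <= C * `|x| ^+ 2) -> is_derive (0 : R) 1 f 0.
Proof.
move=> fC; have f0 : f 0 = 0.
  by apply/eqP; rewrite -normr_le0 (le_trans (fC 0))// normr0 expr0n/= mulr0.
have C0 : 0 <= C by rewrite -[C]mulr1 -(expr1n _ 2) -(@normr1 R) (le_trans _ (fC 1)).
suff H : (fun h : R => h^-1 *: ((f \o shift 0) (h *: (1 : R)) - f 0)) @ 0^' --> (0 : R).
  by split; [apply/cvg_ex; exists 0|exact: cvg_lim].
apply/cvgr0Pnorm_le => e e0; near=> h.
have h0 : h != 0 by near: h; exact: nbhs_dnbhs_neq.
rewrite /= f0 subr0 addr0 (_ : h *: (1 : R) = h); last exact: mulr1.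
rewrite normrZ normfV ler_pdivrMl ?normr_gt0//.
apply: le_trans (fC h) _; rewrite expr2 mulrA mulrC ler_wpM2l//.
have hC : `|h| <= e / (C + 1).
  near: h; apply: dnbhs0_le; apply: divr_gt0 => //; lra.
apply: (le_trans (ler_wpM2l C0 hC)).
rewrite mulrA ler_pdivrMr; last lra.
by rewrite [leLHS]mulrC ler_wpM2l; lra.
Unshelve. all: by end_near. Qed.

Lemma is_derive_flat (R : realType) (eps : R) n (x : R) : 0 < eps ->
  is_derive x 1 (flat eps n)
    (- n%:R * flat eps n.+1 x + eps * flat eps n.+2 x).
Proof.
move=> e0; have [x0|x0|->] := ltgtP x 0.
- apply: (@near_eq_is_derive _ _ _ (fun=> 0)).
    near=> y; rewrite /flat ifN// -leNgt ltW//; near: y.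
    exact: lt_nbhsl.
  by rewrite /flat !ifN -?leNgt ?ltW// !mulr0 addr0; exact: is_derive_cst.
- apply: (@near_eq_is_derive _ _ _ (fun y : R => y ^- n * expR (- (eps / y)))).
    near=> y; rewrite /flat ifT//; near: y.
    exact: lt_nbhsr.
  rewrite /flat !x0.
  have xn0 : x != 0 by rewrite gt_eqF.
  have D1 : is_derive x 1 (fun y : R => (y ^+ n)^-1) (- (x ^+ n) ^- 2 *: (n%:R * x ^+ n.-1)).
    apply: is_deriveV; first by rewrite expf_neq0.
    by split; [exact: exprn_derivable|rewrite exp_derive; exact: mulr1].
  have D2 : is_derive x 1 (fun y : R => - (eps / y)) (eps / x ^+ 2).
    rewrite (_ : eps / _ = - (eps *: (- x ^- 2 *: 1))).
      by apply: is_deriveN; apply: is_deriveZ; apply: is_deriveV.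
    by rewrite /GRing.scale/= mulr1 mulrN opprK.
  have D3 := is_derive1_comp (is_derive_expR _) D2.
  apply: (is_derive_eq (is_deriveM D1 D3)).
  rewrite /GRing.scale/=; case: n {D1} => [|n].
    by rewrite !expr0 /=; field.
  rewrite /= !exprS !expr0 mulr1; move: (expf_neq0 n xn0) (n.+1%:R : R).
  by move: (x ^+ n) => X X0 m; field; rewrite xn0 X0.
- rewrite {2 3}/flat ltxx !mulr0 addr0.
  apply: is_derive0_quadratic => y.
  (* Here m = n + 1, so the exponent m + 1 - n equals 2. *)
  by apply: le_trans (flat_le _ e0 (leqnSn n)) _; rewrite -addn2 addKn.
Unshelve. all: by end_near. Qed.

Lemma Ck_flat (R : realType) (eps : R) (V : normedModType R) k n (U : set V)
    (f : V -> R) :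
  0 < eps -> open U -> Ck k U f -> Ck k U (flat eps n \o f).
Proof.
move=> e0 oU; elim: k n => [|k IH] n Cf.
  move=> z Uz; apply: continuous_comp; first exact: Cf.
  apply: differentiable_continuous; apply/derivable1_diffP.
  by case: (is_derive_flat n (f z) e0).
apply: (@Ck_comp_step _ _ _ _ _ (flat eps n)
  (fun x => - n%:R * flat eps n.+1 x + eps * flat eps n.+2 x)) => //.
  by move=> z _; exact: is_derive_flat.
by apply: Ck_add => //; apply: Ck_mul => //;
  [exact: Ck_cst|exact: IH (Ck_pred Cf)|exact: Ck_cst|exact: IH (Ck_pred Cf)].
Qed.

(* A smooth approximation, from below, of the positive part. *)
Definition ramp (R : realType) (eps x : R) : R := x * flat eps 0 x.

(** The derivative of [ramp], after simplifying x * [flat eps 2 x] to [flat eps 1 x]. *)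
Definition dramp (R : realType) (eps x : R) : R :=
  flat eps 0 x + eps * flat eps 1 x.

Lemma Ck_ramp (R : realType) (eps : R) (V : normedModType R) k (U : set V)
    (f : V -> R) :
  0 < eps -> open U -> Ck k U f -> Ck k U (fun z => ramp eps (f z)).
Proof. by move=> e0 oU Cf; apply: Ck_mul => //; exact: Ck_flat. Qed.

Lemma is_derive_ramp (R : realType) (eps x : R) : 0 < eps ->
  is_derive x 1 (ramp eps) (dramp eps x).
Proof.
move=> e0; apply: (is_derive_eq (is_deriveM (is_derive_id x 1) (is_derive_flat 0 x e0))).
rewrite /GRing.scale/= mulr1 oppr0 mul0r add0r /dramp addrC; congr (_ + _).
rewrite mulrCA; congr (_ * _); rewrite /flat; case: ifPn => x0; last by rewrite mulr0.
by field; rewrite gt_eqF.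
Qed.

Lemma flat00 (R : realType) (eps x : R) n : x <= 0 -> flat eps n x = 0.
Proof. by move=> x0; rewrite /flat ltNge x0. Qed.

Lemma ramp0 (R : realType) (eps x : R) : x <= 0 -> ramp eps x = 0.
Proof. by move=> x0; rewrite /ramp flat00// mulr0. Qed.

Lemma dramp0 (R : realType) (eps x : R) : x <= 0 -> dramp eps x = 0.
Proof. by move=> x0; rewrite /dramp !flat00// mulr0 addr0. Qed.

Lemma flat_bounds (R : realType) (eps x : R) : 0 < eps -> 0 < x ->
  1 - eps / x <= flat eps 0 x <= 1.
Proof.
move=> e0 x0; rewrite /flat x0 expr0 invr1 mul1r expR_ge1Dx/=.
by rewrite -expR0 ler_expR oppr_le0 divr_ge0// ltW.
Qed.

Lemma ramp_ge0 (R : realType) (eps x : R) : 0 <= ramp eps x.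
Proof.
have [x0|x0] := leP x 0; first by rewrite ramp0.
by rewrite mulr_ge0 ?flat_ge0// ltW.
Qed.

Lemma ramp_le (R : realType) (eps x : R) : 0 < eps -> ramp eps x <= Num.max 0 x.
Proof.
move=> e0; have [x0|x0] := leP x 0; first by rewrite ramp0.
by have /andP[_ f1] := flat_bounds e0 x0; rewrite ler_piMr// ltW.
Qed.

Lemma ramp_ge (R : realType) (eps x : R) : 0 < eps -> x - eps <= ramp eps x.
Proof.
move=> e0; have [x0|x0] := leP x 0; first by rewrite ramp0//; lra.
have /andP[f1 _] := flat_bounds e0 x0; rewrite /ramp.
apply: le_trans (ler_wpM2l (ltW x0) f1).
by rewrite mulrBr mulr1 mulrCA mulfV ?gt_eqF// mulr1.
Qed.

Lemma ramp_near (R : realType) (eps x : R) : 0 < eps ->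
  `|ramp eps x - Num.max 0 x| <= eps.
Proof.
move=> e0; have := ramp_le x e0; have := ramp_ge x e0; have := ramp_ge0 eps x.
by have [x0|x0] := leP x 0; rewrite ler_norml; lra.
Qed.

Lemma dramp_ge0 (R : realType) (eps x : R) : 0 < eps -> 0 <= dramp eps x.
Proof. by move=> e0; rewrite addr_ge0 ?mulr_ge0 ?flat_ge0// ltW. Qed.

(** For x > 0 this is (1 + y) exp (- y) <= 1 at y = eps / x. *)
Lemma dramp_le1 (R : realType) (eps x : R) : 0 < eps -> dramp eps x <= 1.
Proof.
move=> e0; have [x0|x0] := leP x 0; first by rewrite dramp0.
have -> : dramp eps x = (1 + eps / x) * expR (- (eps / x)).
  by rewrite /dramp /flat x0 expr0 expr1 invr1; ring.
rewrite expRN ler_pdivrMr ?expR_gt0// mul1r; exact: expR_ge1Dx.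
Qed.

Lemma dramp_ge (R : realType) (eps x : R) : 0 < eps -> 0 < x ->
  1 - eps / x <= dramp eps x.
Proof.
move=> e0 x0; have /andP[f1 _] := flat_bounds e0 x0.
by apply: (le_trans f1); rewrite lerDl mulr_ge0 ?flat_ge0// ltW.
Qed.

(** Both the smoothing parameter and the argument move; [ramp_near], uniform in the argument,
    squeezes the values. *)
Lemma cvg_ramp (R : realType) (e x : nat -> R) (l : R) :
  (forall n, 0 < e n) -> e @ \oo --> 0 -> x @ \oo --> l ->
  ramp (e n) (x n) @[n --> \oo] --> Num.max 0 l.
Proof.
move=> e0 ce cx.
have cm : Num.max 0 (x n) @[n --> \oo] --> Num.max 0 l.
  apply: (@continuous_cvg _ _ _ _ _ x (fun y => Num.max 0 y) l) cx.
  by apply: continuous_max; [exact: cst_continuous|exact: id].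
apply: (@squeeze_cvgr _ _ _ _ (fun n => Num.max 0 (x n) - e n)
  (fun n => Num.max 0 (x n) + e n)).
- apply: nearW => n; have := ramp_near (x n) (e0 n).
  by rewrite ler_distl => /andP[-> ->].
- by rewrite -[Num.max 0 l]subr0; apply: cvgB.
- by rewrite -[Num.max 0 l]addr0; apply: cvgD.
Qed.

Lemma cvg_dramp (R : realType) (e x : nat -> R) (l : R) :
  (forall n, 0 < e n) -> e @ \oo --> 0 -> x @ \oo --> l -> 0 < l ->
  dramp (e n) (x n) @[n --> \oo] --> (1 : R).
Proof.
move=> e0 ce cx l0.
apply: (@squeeze_cvgr _ _ _ _ (fun n => 1 - e n / x n) (fun=> 1)).
- near=> n; rewrite dramp_le1// andbT dramp_ge//.
  by near: n; move/cvgr_gt : cx; apply.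
- rewrite -[X in _ --> X](_ : 1 - 0 / l = 1); last by rewrite mul0r subr0.
  by apply: cvgB; [exact: cvg_cst|apply: cvgM => //; apply: cvgV => //; rewrite gt_eqF].
- exact: cvg_cst.
Unshelve. all: by end_near. Qed.

(** The limit at x = 0 is 0, whence the strict inequalities in [dgreen] and in the limit of the
    divergence of [green_field]. *)
Lemma cvg_dramp_cst (R : realType) (e : nat -> R) (x : R) :
  (forall n, 0 < e n) -> e @ \oo --> 0 ->
  dramp (e n) x @[n --> \oo] --> (if 0 < x then 1 else 0 : R).
Proof.
move=> e0 ce; have [x0|x0] := ltP 0 x.
  by apply: (@cvg_dramp _ e (fun=> x) x) => //; exact: cvg_cst.
by under eq_fun do rewrite dramp0//; exact: cvg_cst.
Qed.

(* The same rules as in the library, for functions in eta-expanded form. *)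
Lemma is_derive_addf (R : realType) (V : normedModType R) (f g : V -> R)
    (z v : V) (df dg : R) :
  is_derive z v f df -> is_derive z v g dg ->
  is_derive z v (fun w => f w + g w) (df + dg).
Proof. exact: is_deriveD. Qed.

Lemma is_derive_subf (R : realType) (V : normedModType R) (f g : V -> R)
    (z v : V) (df dg : R) :
  is_derive z v f df -> is_derive z v g dg ->
  is_derive z v (fun w => f w - g w) (df - dg).
Proof. exact: is_deriveB. Qed.

Lemma is_derive_mulf (R : realType) (V : normedModType R) (f g : V -> R)
    (z v : V) (df dg : R) :
  is_derive z v f df -> is_derive z v g dg ->
  is_derive z v (fun w => f w * g w) (df * g z + f z * dg).
Proof.
move=> Df Dg; apply: (is_derive_eq (is_deriveM Df Dg)).
by rewrite /GRing.scale/= addrC mulrC.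
Qed.

Lemma is_derive_scalef (R : realType) (V : normedModType R) (c : R) (f : V -> R)
    (z v : V) (df : R) :
  is_derive z v f df -> is_derive z v (fun w => c * f w) (c * df).
Proof. exact: is_deriveZ. Qed.

Lemma is_derive_invf (R : realType) (V : normedModType R) (f : V -> R)
    (z v : V) (df : R) : f z != 0 ->
  is_derive z v f df -> is_derive z v (fun w => (f w)^-1) (- df / f z ^+ 2).
Proof.
move=> f0 Df; have D := is_deriveV (f := id) f0 (is_derive_id (f z) (1 : R)).
apply: (is_derive_eq (is_derive_comp1 D Df)).
by rewrite /GRing.scale/= mulr1 mulrC mulNr mulrN.
Qed.

Lemma is_derive_lnf (R : realType) (V : normedModType R) (f : V -> R)
    (z v : V) (df : R) : 0 < f z ->
  is_derive z v f df -> is_derive z v (fun w => ln (f w)) (df / f z).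
Proof.
move=> f0 Df; apply: (is_derive_eq (is_derive_comp1 (is_derive1_ln f0) Df)).
exact: mulrC.
Qed.

Lemma is_derive_cstf (R : realType) (V : normedModType R) (c : R) (z v : V) :
  is_derive z v (fun _ : V => c) 0.
Proof. exact: is_derive_cst. Qed.

Lemma is_derive_rampf (R : realType) (eps : R) (V : normedModType R) (f : V -> R)
    (z v : V) (df : R) : 0 < eps ->
  is_derive z v f df ->
  is_derive z v (fun w => ramp eps (f w)) (dramp eps (f z) * df).
Proof. by move=> e0; exact/is_derive_comp1/is_derive_ramp. Qed.

(** * Lebesgue measure on the disk *)

Notation plane R := (measurableTypeR R * measurableTypeR R)%type.

(** The sigma-algebra of [plane R] is the product one, so U is exhibited as a countable union of
    boxes with rational centres and radii 1 / (n + 1). *)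
Lemma open_measurable_plane (R : realType) (U : set (R * R)) :
  open U -> measurable (U : set (plane R)).
Proof.
move=> oU.
pose B (i : rat * rat * nat) : set (plane R) :=
  ball (ratr i.1.1 : R) i.2.+1%:R^-1 `*` ball (ratr i.1.2 : R) i.2.+1%:R^-1.
pose C i := if `[< B i `<=` U >] then B i else set0.
have mC i : measurable (C i).
  rewrite /C; case: ifPn => // _; rewrite /B; apply: measurableX; by apply: open_measurable; apply: ball_open; rewrite invr_gt0.
suff -> : U = \bigcup_i C i.
  by apply: countable_bigcupT_measurable => //; exact: countableP.
apply/seteqP; split=> [z Uz|z [i _]]; last first.
  by rewrite /C; case: ifPn => // /asboolP; exact.
have /nbhs_ballP[e /= e0 zU] : nbhs z U by exact: open_nbhs_nbhs.
have [n [d [dE d0 de]]] : exists n (d : R), [/\ n.+1%:R^-1 = d, 0 < d & d < e / 2].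
  have e2 : 0 < e / 2 by lra.
  have [n] := ltr_add_invr e2; rewrite add0r => ne; exists n, n.+1%:R^-1.
  by rewrite invr_gt0.
have /rat_in_itvoo[p /[!in_itv]/= /andP[p1 p2]] : z.1 - d < z.1 + d by lra.
have /rat_in_itvoo[q /[!in_itv]/= /andP[q1 q2]] : z.2 - d < z.2 + d by lra.
exists (p, q, n) => //; rewrite /C ifT; last first.
  apply/asboolP => w [/=]; rewrite dE => w1 w2; apply: zU.
  by split; move: w1 w2; rewrite /ball/= !ltr_distl; lra.
by rewrite /B dE; split; rewrite /ball/= !ltr_distl; apply/andP; split; lra.
Qed.

Lemma continuous_measurable_plane (R : realType) (D : set (R * R)) (f : R * R -> R) :
  open D -> (forall z, D z -> {for z, continuous f}) ->
  measurable_fun (D : set (plane R)) f.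
Proof.
move=> oD cf; apply: (measurability _ (RGenOpens.measurableE R)).
move=> _ [_ [a [b ->] <-]]; apply: open_measurable_plane.
rewrite openE => z [Dz /= fz]; rewrite /interior.
apply: filterI; first exact: open_nbhs_nbhs.
apply: (cf _ Dz); apply: open_nbhs_nbhs; split => //; exact: interval_open.
Qed.

Lemma modulus_sqr (R : realType) (z : R * R) : modulus z ^+ 2 = z.1 ^+ 2 + z.2 ^+ 2.
Proof. by rewrite sqr_sqrtr// addr_ge0 ?sqr_ge0. Qed.

Lemma modulus_ge0 (R : realType) (z : R * R) : 0 <= modulus z.
Proof. exact: sqrtr_ge0. Qed.

Lemma diskE (R : realType) (z : R * R) : disk z <-> z.1 ^+ 2 + z.2 ^+ 2 < 1.
Proof. by rewrite /disk/= -modulus_sqr expr_lt1// modulus_ge0. Qed.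

Lemma continuous_modulus (R : realType) : continuous (@modulus R).
Proof.
move=> z; apply: (@continuous_comp (R * R)%type R R (fun z => z.1 ^+ 2 + z.2 ^+ 2) (@Num.sqrt R)); last exact: sqrt_continuous.
have oT := @openT (R * R)%type.
have C := Ck_add oT (Ck_mul oT (@Ck_fst R 0 setT) (@Ck_fst R 0 setT))
  (Ck_mul oT (@Ck_snd R 0 setT) (@Ck_snd R 0 setT)).
exact: (Ck_continuous C (z := z) I).
Qed.

Lemma open_disk (R : realType) : open (@disk R).
Proof.
rewrite (_ : disk = @modulus R @^-1` [set x | x < 1]); last by [].
by apply: open_comp; [move=> z _; exact: continuous_modulus|exact: open_lt].
Qed.

Lemma measurable_disk (R : realType) : measurable (@disk R : set (plane R)).
Proof. by apply: open_measurable_plane; exact: open_disk. Qed.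

Lemma disk_coord (R : realType) (z : R * R) : disk z -> `|z.1| < 1 /\ `|z.2| < 1.
Proof.
move/diskE => z1; have := sqr_ge0 z.1; have := sqr_ge0 z.2.
by split; rewrite -(@expr_lt1 _ 2%N)// real_normK ?num_real//; lra.
Qed.

Lemma leb2_rect (R : realType) (a b c d : R) : a <= b -> c <= d ->
  leb2 (`[a, b] `*` `[c, d] : set (plane R)) = ((b - a) * (d - c))%:E.
Proof.
move=> ab cd.
transitivity (lebesgue_measure `[a, b]%classic * lebesgue_measure `[c, d]%classic)%E.
  exact: (@product_measure1E _ _ (measurableTypeR R) (measurableTypeR R) R
  lebesgue_measure lebesgue_measure `[a, b]%classic `[c, d]%classic
  (measurable_itv _) (measurable_itv _)).
rewrite !lebesgue_measure_itv/= !lte_fin.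
have aux (x y : R) : x <= y -> (if x < y then (y%:E - x%:E)%E else 0%E) = (y - x)%:E.
  by rewrite le_eqVlt => /predU1P[->|->//]; rewrite ltxx subrr.
by rewrite !aux.
Qed.

Lemma leb2_disk_fin (R : realType) : (@leb2 R disk < +oo)%E.
Proof.
apply: (@le_lt_trans _ _ (leb2 (`[-1, 1] `*` `[-1, 1] : set (plane R)))).
  apply: le_measure; rewrite ?inE; [exact: measurable_disk| |].
    by apply: measurableX.
  by move=> z /disk_coord[] /ltW + /ltW; rewrite !ler_norml /= !in_itv/=.
by rewrite leb2_rect ?ltry//; lra.
Qed.

Lemma bounded_integrable_disk (R : realType) (f : plane R -> R) (M : R) :
  measurable_fun (disk : set (plane R)) f ->
  (forall z, disk z -> `|f z| <= M) -> leb2.-integrable disk (EFin \o f).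
Proof.
move=> mf fM; apply: measurable_bounded_integrable => //.
- exact: measurable_disk.
- exact: leb2_disk_fin.
- exists M; split; [exact: num_real|move=> x Mx z Dz].
  exact: le_trans (fM _ Dz) (ltW Mx).
Qed.

Lemma Rintegral_dct d (T : measurableType d) (R : realType)
    (mu : {measure set T -> \bar R}) (D : set T) (f_ : nat -> T -> R) (f g : T -> R) :
  measurable D -> (forall n, measurable_fun D (f_ n)) ->
  mu.-integrable D (EFin \o g) ->
  (forall n z, D z -> `|f_ n z| <= g z) ->
  (forall z, D z -> f_ n z @[n --> \oo] --> f z) ->
  [/\ measurable_fun D f, mu.-integrable D (EFin \o f) &
      \int[mu]_(z in D) f_ n z @[n --> \oo] --> \int[mu]_(z in D) f z].
Proof.
move=> mD mf_ ig fg cf.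
have mf : measurable_fun D f by exact: (measurable_fun_cvg mf_).
have mf_E n : measurable_fun D (EFin \o f_ n) by exact/measurable_EFinP.
have mfE : measurable_fun D (EFin \o f) by exact/measurable_EFinP.
have cfE : {ae mu, forall z, D z -> (EFin \o f_ n) z @[n --> \oo] --> (EFin \o f) z}.
  by apply: aeW => z Dz; apply: cvg_EFin; [exact: nearW|exact: cf].
have fgE : {ae mu, forall z n, D z -> (`|(EFin \o f_ n) z| <= (EFin \o g) z)%E}.
  by apply: aeW => z n Dz; rewrite lee_fin; exact: fg.
have [if_ _ H] := dominated_convergence mD mf_E mfE cfE ig fgE.
by split => //; apply: fine_cvg; rewrite fineK//; exact: integrable_fin_num.
Qed.

Lemma Rintegral_dct_disk (R : realType) (f_ : nat -> plane R -> R) (f : plane R -> R) (M : R) :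
  (forall n, measurable_fun (disk : set (plane R)) (f_ n)) ->
  (forall n z, disk z -> `|f_ n z| <= M) ->
  (forall z, disk z -> f_ n z @[n --> \oo] --> f z) ->
  [/\ measurable_fun (disk : set (plane R)) f,
      (forall z, disk z -> `|f z| <= M) &
      \int[leb2]_(z in disk) f_ n z @[n --> \oo] --> \int[leb2]_(z in disk) f z].
Proof.
move=> mf_ fM cf.
have iM : leb2.-integrable disk (EFin \o (fun _ : plane R => M)).
  by apply: (@bounded_integrable_disk _ _ `|M|).
have [mf _ H] := Rintegral_dct (@measurable_disk R) mf_ iM fM cf.
split => // z Dz.
have N : `|f_ n z| @[n --> \oo] --> `|f z| by apply: cvg_norm; exact: cf.
rewrite -(cvg_lim _ N)//; apply: limr_le; [exact: cvgP N|].
by apply: nearW => n; exact: fM.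
Qed.

Lemma is_derive_continuous (R : realType) (F : R -> R) (x d : R) :
  is_derive x 1 F d -> {for x, continuous F}.
Proof. by case=> /derivable1_diffP dF _; exact: differentiable_continuous. Qed.

Lemma is_derive_LRcontinuous (R : realType) (F f : R -> R) (a b : R) :
  (forall x : R, is_derive x 1 F (f x)) -> derivable_oo_LRcontinuous F a b.
Proof.
move=> Ff; have cF x : {for x, continuous F} by exact: is_derive_continuous (Ff x).
split.
- by move=> x _; case: (Ff x).
- by apply: cvg_at_right_filter; exact: cF.
- by apply: cvg_at_left_filter; exact: cF.
Qed.

Lemma integral_is_derive (R : realType) (F f : R -> R) (a b : R) : a < b ->
  (forall x : R, is_derive x 1 F (f x)) -> continuous f ->
  (\int[lebesgue_measure]_(x in `[a, b]) (f x)%:E = (F b - F a)%:E)%E.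
Proof.
move=> ab Ff cf; rewrite EFinB; apply: continuous_FTC2 => //.
- exact: continuous_subspaceT.
- exact: is_derive_LRcontinuous Ff.
- by move=> x _; rewrite derive1E; case: (Ff x).
Qed.

(** The substitution x = a + r sin t turns the integrand into 2 (r cos t)^2, whose primitive is r^2
    (t + sin t cos t). *)
Lemma integral_half_disk (R : realType) (a r : R) : 0 < r ->
  (\int[lebesgue_measure]_(x in `[(a - r)%R, (a + r)%R])
     (2 * Num.sqrt (r ^+ 2 - (x - a) ^+ 2))%:E = (pi * r ^+ 2)%:E)%E.
Proof.
move=> r0; have p0 : - (pi / 2) < pi / 2 :> R by have := pi_gt0 R; lra.
pose F (t : R) := a + r * sin t.
have DF (t : R) : is_derive t 1 F (r * cos t).
  rewrite -[r * _]add0r.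
  exact: is_derive_addf (is_derive_cstf a t 1) (is_derive_scalef r (is_derive_sin t)).
have dF : derive1 F = fun t => r * cos t.
  by apply/funext => t; rewrite derive1E; case: (DF t).
have cdF : continuous (fun t : R => r * cos t).
  by move=> t; apply: cvgM; [exact: cvg_cst|exact: continuous_cos].
have Fa : F (- (pi / 2)) = a - r by rewrite /F sinN sin_pihalf mulrN1.
have Fb : F (pi / 2) = a + r by rewrite /F sin_pihalf mulr1.
rewrite -Fa -Fb integration_by_substitution_increasing.
- pose H (t : R) := r ^+ 2 * (t + sin t * cos t).
  have DH (t : R) : is_derive t 1 H (2 * (r * cos t) ^+ 2).
    apply: (is_derive_eq (is_derive_scalef (r ^+ 2) (is_derive_addf (is_derive_id t 1)
      (is_derive_mulf (is_derive_sin t) (is_derive_cos t))))).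
    have E := cos2Dsin2 t.
    by transitivity (r ^+ 2 * ((cos t ^+ 2 + sin t ^+ 2) + (cos t * cos t + sin t * - sin t)));
      [rewrite E|ring].
  have key (t : R) : 0 <= cos t ->
      2 * Num.sqrt (r ^+ 2 - (a + r * sin t - a) ^+ 2) * (r * cos t) = 2 * (r * cos t) ^+ 2.
    move=> c0; have -> : r ^+ 2 - (a + r * sin t - a) ^+ 2 = (r * cos t) ^+ 2.
      by have := cos2Dsin2 t; rewrite !exprMn => E; rewrite -[X in X - _]mulr1 -E; ring.
    by rewrite sqrtr_sqr ger0_norm; [ring|rewrite mulr_ge0// ltW].
  transitivity (H (pi / 2) - H (- (pi / 2)))%:E.
    rewrite -(integral_is_derive p0 DH).
      apply: eq_integral => t; rewrite inE/= in_itv/= => tp.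
      have c0 : 0 <= cos t by exact: cos_ge0_pihalf.
      rewrite dF; congr (_ %:E); rewrite /F.
      exact: key.
    by move=> t; apply: cvgM; [exact: cvg_cst|apply: (@cvgM _ _ _ _ _ (fun t => r * cos t)); exact: cdF].
  by congr (_%:E); rewrite /H sinN cosN cos_pihalf; field.
- exact: ltW.
- by move=> x y xp yp xy; rewrite /F ltrD2l ltr_pM2l// ltr_sin.
- by move=> x _; rewrite dF; exact: cdF.
- by rewrite dF; apply/cvg_ex; eexists; apply: cvg_at_right_filter; exact: cdF.
- by rewrite dF; apply/cvg_ex; eexists; apply: cvg_at_left_filter; exact: cdF.
- exact: is_derive_LRcontinuous DF.
- apply: continuous_subspaceT => x.
  apply: cvgM; first exact: cvg_cst.
  apply: (@continuous_comp R R R (fun x => r ^+ 2 - (x - a) ^+ 2) (@Num.sqrt R)); last exact: sqrt_continuous.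
  apply: cvgB; first exact: cvg_cst.
  by apply: (@cvgM _ _ _ _ (fun x => x - a) (fun x => x - a)); apply: cvgB => //; exact: cvg_cst.
Qed.

(** By Fubini: vertical sections are intervals of length [2 * s x]. Beyond distance r from a, the
    square root of a negative number is 0, which agrees with the section being empty. *)
Lemma leb2_ball (R : realType) (a b r : R) : 0 < r ->
  leb2 ([set w | (w.1 - a) ^+ 2 + (w.2 - b) ^+ 2 < r ^+ 2] : set (plane R)) =
  (pi * r ^+ 2)%:E.
Proof.
move=> r0; set A := [set w | _].
pose s x := Num.sqrt (r ^+ 2 - (x - a) ^+ 2).
have secA x : xsection A x = `]b - s x, b + s x[%classic.
  apply/seteqP; split=> y; rewrite /xsection/= inE /A/= in_itv/= -ltr_distl -sqrtr_sqr;
    (have [p|p] := ltP 0 (r ^+ 2 - (x - a) ^+ 2); first by rewrite ltr_sqrt //; lra).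
  - by have := sqr_ge0 (y - b); lra.
  - by rewrite /s (ler0_sqrtr p) ltNge sqrtr_ge0.
rewrite -(integral_half_disk a r0).
transitivity (\int[lebesgue_measure]_x (2 * s x)%:E)%E.
  apply: eq_integral => x _ /=; rewrite secA lebesgue_measure_itv/= lte_fin.
  case: ifPn => [_|]; first by rewrite -EFinB; congr (_%:E); ring.
  by rewrite -leNgt lerD2l; have := sqrtr_ge0 (r ^+ 2 - (x - a) ^+ 2); rewrite -/(s x) => ??; congr (_%:E); lra.
rewrite [RHS]integral_mkcond; apply: eq_integral => x _; rewrite /patch.
case: ifPn => //; rewrite notin_setE/= in_itv/= => xr; congr (_%:E).
rewrite /s ler0_sqrtr ?mulr0// subr_le0.
have : r < `|x - a|.
  by rewrite ltNge ler_distl; apply/negP.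
by move=> /ltW H; rewrite -(real_normK (num_real (x - a))) lerXn2r// nnegrE ltW.
Qed.

(** * Weak derivatives and the space H^1_0 *)

Lemma is_derive_row (R : realType) (g : R * R -> R) (x y d : R) :
  is_derive (x, y) dir_x g d -> is_derive x 1 (fun t => g (t, y)) d.
Proof.
have E : (fun h : R => h^-1 *: ((g \o shift (x, y)) (h *: dir_x) - g (x, y))) =
    (fun h : R => h^-1 *: (((fun t => g (t, y)) \o shift x) (h *: (1 : R)) - g (x, y))).
  apply/funext => h /=; congr (_ *: (g _ - _)).
  by rewrite /dir_x; congr pair => /=; rewrite [_ *: _]mulr0 add0r.
by case=> D <-; split; [move: D; rewrite /derivable E|rewrite /derive E].
Qed.

Lemma is_derive_col (R : realType) (g : R * R -> R) (x y d : R) :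
  is_derive (x, y) dir_y g d -> is_derive y 1 (fun t => g (x, t)) d.
Proof.
have E : (fun h : R => h^-1 *: ((g \o shift (x, y)) (h *: dir_y) - g (x, y))) =
    (fun h : R => h^-1 *: (((fun t => g (x, t)) \o shift y) (h *: (1 : R)) - g (x, y))).
  apply/funext => h /=; congr (_ *: (g _ - _)).
  by rewrite /dir_y; congr pair => /=; rewrite [_ *: _]mulr0 add0r.
by case=> D <-; split; [move: D; rewrite /derivable E|rewrite /derive E].
Qed.

(** * Integration by parts for functions with compact support in the disk *)

Lemma compact_support_bounded (R : realType) (f : R * R -> R) (K : set (R * R)) :
  compact K -> K `<=` disk -> (forall z, disk z -> {for z, continuous f}) ->
  (forall z, disk z -> ~ K z -> f z = 0) ->
  exists M, forall z, disk z -> `|f z| <= M.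
Proof.
move=> cK Kd cf f0.
have cfK : {within K, continuous f}.
  by apply: continuous_in_subspaceT => z /set_mem Kz; exact/cf/Kd.
have /compact_bounded[M [_ HM]] := continuous_compact cfK cK.
exists (`|M| + 1) => z dz.
have M1 : M < `|M| + 1 by rewrite (le_lt_trans (ler_norm _))// ltrDl.
have [Kz|nKz] := pselect (K z); first by apply: (HM _ M1); exists z.
by rewrite f0// normr0 addr_ge0.
Qed.

Section compact_support.
Context (R : realType) (g dg : R * R -> R) (e : R * R) (K : set (R * R)).
Hypothesis cK : compact K.
Hypothesis Kd : K `<=` disk.
Hypothesis g0 : forall z, disk z -> ~ K z -> g z = 0.
Hypothesis Dg : forall z, disk z -> is_derive z e g (dg z).
Hypothesis cdg : forall z, disk z -> {for z, continuous dg}.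

Lemma open_setC_compact : open (~` K).
Proof. by apply: closed_openC; exact: compact_closed. Qed.

Lemma derive_off_support z : disk z -> ~ K z -> dg z = 0.
Proof.
move=> dz nKz; have [_ <-] := Dg dz.
suff -> : 'D_e g z = 'D_e (fun=> 0) z by exact: derive_cst.
apply: near_eq_derive; near=> w; apply: g0; near: w.
  by apply: open_nbhs_nbhs; split => //; exact: open_disk.
by apply: open_nbhs_nbhs; split => //; exact: open_setC_compact.
Unshelve. all: by end_near. Qed.

(** A point off the disk lies in the open complement of K, near which the extension by zero vanishes
    identically. Extending to the plane allows integration along whole lines. *)
Lemma is_derive_patch_disk z : is_derive z e (g \_ disk) ((dg \_ disk) z).
Proof.
have [dz|ndz] := pselect (disk z).
  rewrite /patch mem_set//; apply: (near_eq_is_derive _ (Dg dz)).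
  near=> w; rewrite mem_set//; near: w.
  by apply: open_nbhs_nbhs; split => //; exact: open_disk.
rewrite {2}/patch memNset//; apply: (near_eq_is_derive _ (is_derive_cst 0 z e)).
near=> w; rewrite /patch; case: ifPn => // /set_mem dw; rewrite g0//.
near: w; apply: open_nbhs_nbhs; split; [exact: open_setC_compact|move=> Kz; exact/ndz/Kd].
Unshelve. all: by end_near. Qed.

Lemma continuous_patch_disk : continuous (dg \_ disk).
Proof.
move=> z; have [dz|ndz] := pselect (disk z).
  have Nd : nbhs z disk by apply: open_nbhs_nbhs; split => //; exact: open_disk.
  rewrite /continuous_at {2}/patch mem_set//; apply: cvg_trans (cdg dz).
  by apply: near_eq_cvg; apply: filterS Nd => w dw; rewrite /patch mem_set.
have NK : nbhs z (~` K).
  by apply: open_nbhs_nbhs; split; [exact: open_setC_compact|move=> Kz; exact/ndz/Kd].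
rewrite /continuous_at {2}/patch memNset//; apply: cvg_near_cst.
apply: filterS NK => w nKw; rewrite /patch; case: ifPn => // /set_mem dw.
by rewrite derive_off_support.
Qed.

Lemma integrable_patch_disk : leb2.-integrable setT (EFin \o (dg \_ disk : plane R -> R)).
Proof.
have [M HM] := compact_support_bounded cK Kd cdg derive_off_support.
rewrite (_ : EFin \o _ = (EFin \o dg) \_ disk); last by rewrite restrict_EFin.
apply/(integrable_mkcond _ (@measurable_disk R)).
apply: bounded_integrable_disk HM.
by apply: continuous_measurable_plane; [exact: open_disk|exact: cdg].
Qed.

End compact_support.

Lemma integral_bump_derive (R : realType) (G dG : R -> R) :
  (forall x : R, is_derive x 1 G (dG x)) -> continuous dG ->
  (forall x, 1 <= `|x| -> G x = 0 /\ dG x = 0) ->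
  (\int[lebesgue_measure]_x (dG x)%:E = 0)%E.
Proof.
move=> DG cdG G0.
transitivity (\int[lebesgue_measure]_(x in `[(-1)%R, 1%R]) (dG x)%:E)%E.
  rewrite [RHS]integral_mkcond; apply: eq_integral => x _; rewrite /patch.
  case: ifPn => //; rewrite notin_setE/= in_itv/= => H; congr EFin.
  have /G0[] // : 1 <= `|x|.
  by rewrite leNgt; apply/negP => /ltW; rewrite ler_norml => /H.
rewrite (integral_is_derive _ DG cdG); last by lra.
by rewrite (G0 1 _).1 ?(G0 (- 1) _).1 ?normrN1 ?normr1// subrr.
Qed.

Lemma continuous_pairl (S T : topologicalType) (y : T) : continuous (fun x : S => (x, y)).
Proof.
move=> x A [[B C] /= [Bx Cy] BCA]; apply: filterS Bx => t Bt; apply: BCA; split => //=.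
exact: nbhs_singleton Cy.
Qed.
Lemma continuous_pairr (S T : topologicalType) (x : S) : continuous (fun y : T => (x, y)).
Proof.
move=> y A [[B C] /= [Bx Cy] BCA]; apply: filterS Cy => t Bt; apply: BCA; split => //=.
exact: nbhs_singleton Bx.
Qed.

(** By Fubini, with the inner integral taken along e: on each line the fundamental theorem of
    calculus gives 0, because the extended function vanishes at -1 and 1. *)
Lemma integral_disk_derive_dir (R : realType) (g dg : R * R -> R) (e : R * R)
    (K : set (R * R)) :
  e = dir_x \/ e = dir_y ->
  compact K -> K `<=` disk -> (forall z, disk z -> ~ K z -> g z = 0) ->
  (forall z, disk z -> is_derive z e g (dg z)) ->
  (forall z, disk z -> {for z, continuous dg}) ->
  \int[leb2]_(z in disk) dg z = 0.
Proof.
move=> ee cK Kd g0 Dg cdg.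
have iG := integrable_patch_disk cK Kd g0 Dg cdg.
have DG := is_derive_patch_disk cK Kd g0 Dg.
have cdG := continuous_patch_disk cK Kd g0 Dg cdg.
rewrite Rintegral_mkcond /Rintegral.
have off (f : R * R -> R) x y : 1 <= `|x| \/ 1 <= `|y| -> (f \_ disk) (x, y) = 0.
  move=> xy; rewrite /patch memNset// => /disk_coord/= [].
  by case: xy => xy1; rewrite !ltNge ?xy1 // => _; rewrite xy1.
case: ee => ?; subst e.
  rewrite -(integral21_prod_meas1 iG) /fubini_G integral0_eq// => y _.
  apply: (@integral_bump_derive _ (fun x => (g \_ disk) (x, y)) (fun x => (dg \_ disk) (x, y))).
  - by move=> x; apply: is_derive_row; exact: DG.
  - move=> x; apply: (@continuous_comp _ _ _ (fun x => (x, y)) (dg \_ disk)); [exact: continuous_pairl|exact: cdG].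
  - by move=> x x1; split; apply: off; left.
rewrite -(integral12_prod_meas1 iG) /fubini_F integral0_eq// => x _.
apply: (@integral_bump_derive _ (fun y => (g \_ disk) (x, y)) (fun y => (dg \_ disk) (x, y))).
- by move=> y; apply: is_derive_col; exact: DG.
- move=> y; apply: (@continuous_comp _ _ _ (fun y => (x, y)) (dg \_ disk)); [exact: continuous_pairr|exact: cdG].
- by move=> y y1; split; apply: off; right.
Qed.

Lemma test_function_derive (R : realType) (phi : R * R -> R) (e : R * R) :
  test_function phi ->
  exists K, [/\ compact K, K `<=` disk &
    [/\ (forall z, disk z -> {for z, continuous phi}),
      (forall z, disk z -> is_derive z e phi ('D_e phi z)),
      (forall z, disk z -> {for z, continuous ('D_e phi)}),
      (forall z, disk z -> ~ K z -> phi z = 0) &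
      (forall z, disk z -> ~ K z -> 'D_e phi z = 0)]].
Proof.
move=> [sphi [K [cK Kd phi0]]]; exists K; split=> //.
have [dphi cdphi] := sphi 1%N.
have Dphi z : disk z -> is_derive z e phi ('D_e phi z).
  by move=> dz; apply: derivableP; exact/diff_derivable/dphi.
split => //; [exact: sphi 0%N|exact: cdphi|].
exact: (derive_off_support cK phi0 Dphi).
Qed.

Lemma test_function_bounded (R : realType) (phi : R * R -> R) (e : R * R) :
  test_function phi ->
  exists M, forall z, disk z -> `|phi z| <= M /\ `|'D_e phi z| <= M.
Proof.
move=> /(test_function_derive e)[K [cK Kd [cphi Dphi cdphi phi0 dphi0]]].
have [M1 H1] := compact_support_bounded cK Kd cphi phi0.
have [M2 H2] := compact_support_bounded cK Kd cdphi dphi0.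
exists (Num.max M1 M2) => z dz.
by rewrite !le_max H1// H2// orbT.
Qed.

Lemma measurable_test_function (R : realType) (phi : R * R -> R) :
  test_function phi -> measurable_fun (disk : set (plane R)) phi.
Proof.
move=> [sphi _]; apply: continuous_measurable_plane; first exact: open_disk.
exact: sphi 0%N.
Qed.

Lemma measurable_derive_test_function (R : realType) (phi : R * R -> R) (e : R * R) :
  test_function phi -> measurable_fun (disk : set (plane R)) ('D_e phi).
Proof.
move=> /(test_function_derive e)[K [_ _ [_ _ cdphi _ _]]].
by apply: continuous_measurable_plane; [exact: open_disk|exact: cdphi].
Qed.

(** The function f phi has compact support, so its derivative integrates to 0; f may behave badly
    near the unit circle, where phi vanishes. *)
Lemma integral_by_parts_disk (R : realType) (f df phi : R * R -> R) (e : R * R) :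
  e = dir_x \/ e = dir_y -> test_function phi ->
  (forall z, disk z -> is_derive z e f (df z)) ->
  (forall z, disk z -> {for z, continuous f}) ->
  (forall z, disk z -> {for z, continuous df}) ->
  \int[leb2]_(z in disk) (f z * 'D_e phi z) = - \int[leb2]_(z in disk) (df z * phi z).
Proof.
move=> ee tphi Df cf cdf.
have [K [cK Kd [cphi Dphi cdphi phi0 dphi0]]] := test_function_derive e tphi.
have c1 z : disk z -> {for z, continuous (fun w => f w * 'D_e phi w)}.
  by move=> dz; apply: cvgM; [exact: cf|exact: cdphi].
have c2 z : disk z -> {for z, continuous (fun w => df w * phi w)}.
  by move=> dz; apply: cvgM; [exact: cdf|exact: cphi].
have z1 z : disk z -> ~ K z -> f z * 'D_e phi z = 0.
  by move=> dz nKz; rewrite dphi0// mulr0.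
have z2 z : disk z -> ~ K z -> df z * phi z = 0.
  by move=> dz nKz; rewrite phi0// mulr0.
have [M1 H1] := compact_support_bounded cK Kd c1 z1.
have [M2 H2] := compact_support_bounded cK Kd c2 z2.
have m1 := continuous_measurable_plane (@open_disk R) c1.
have m2 := continuous_measurable_plane (@open_disk R) c2.
apply/eqP; rewrite -addr_eq0 addrC -RintegralD.
- apply/eqP; apply: (@integral_disk_derive_dir _ (fun z => f z * phi z) _ e K) => //.
  + by move=> z dz nKz; rewrite phi0// mulr0.
  + by move=> z dz; apply: is_derive_mulf; [exact: Df|exact: Dphi].
  + by move=> z dz; apply: cvgD; [exact: c2|exact: c1].
- exact: measurable_disk.
- exact: bounded_integrable_disk m2 H2.
- exact: bounded_integrable_disk m1 H1.
Qed.

Lemma square_integrableP (R : realType) (u : R * R -> R) :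
  square_integrable u <->
  measurable_fun (disk : set (plane R)) u /\
  leb2.-integrable disk (EFin \o (fun z : plane R => u z ^+ 2)).
Proof.
have E : (\int[leb2]_(z in disk) `|(u z ^+ 2)%:E| = \int[leb2]_(z in disk) (u z ^+ 2)%:E)%E.
  by apply: eq_integral => z _; rewrite gee0_abs// lee_fin sqr_ge0.
split=> [[mu ui]|[mu /integrableP[_]]]; last by rewrite E; split.
split => //; apply/integrableP; split; last by rewrite E.
by apply/measurable_EFinP; exact: measurable_funX.
Qed.

Lemma square_integrable_bounded (R : realType) (u : R * R -> R) (M : R) :
  measurable_fun (disk : set (plane R)) u -> (forall z, disk z -> `|u z| <= M) ->
  square_integrable u.
Proof.
move=> mu uM; apply/square_integrableP; split => //.
apply: (@bounded_integrable_disk _ _ (M ^+ 2)); first exact: measurable_funX.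
move=> z dz; rewrite normrX lerXn2r// ?nnegrE ?uM//.
exact: le_trans (uM _ dz).
Qed.

Lemma square_integrable_mul (R : realType) (u v : R * R -> R) :
  square_integrable u -> square_integrable v ->
  leb2.-integrable disk (EFin \o (fun z : plane R => u z * v z)).
Proof.
move=> /square_integrableP[mu iu] /square_integrableP[mv iv].
apply: (le_integrable (@measurable_disk R) _ _ (integrableD (@measurable_disk R) iu iv)).
  by apply/measurable_EFinP; exact: measurable_funM.
move=> z _; rewrite /= lee_fin (@ger0_norm _ (_ + _)) ?addr_ge0 ?sqr_ge0//.
have := sqr_ge0 (u z - v z); have := sqr_ge0 (u z + v z).
by rewrite ler_norml; nra.
Qed.

Lemma square_integrable_lin (R : realType) (a : R) (u v : R * R -> R) :
  square_integrable u -> square_integrable v ->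
  square_integrable (fun z => a * u z + v z).
Proof.
move=> su sv; have iuv := square_integrable_mul su sv.
move: su sv => /square_integrableP[mu iu] /square_integrableP[mv iv].
apply/square_integrableP; split.
  by apply: measurable_funD => //; exact: measurable_funM.
rewrite (_ : EFin \o _ = (fun z : plane R => (a ^+ 2)%:E * (EFin \o (fun z => (u z) ^+ 2)%R) z +
    ((2 * a)%:E * (EFin \o (fun z => u z * v z)%R) z + (EFin \o (fun z => (v z) ^+ 2)%R) z)))%E.
  have mD := @measurable_disk R.
  by apply: integrableD => //; [exact: integrableZl|apply: integrableD => //; exact: integrableZl].
by apply/funext => z /=; rewrite -!EFinM -!EFinD; congr EFin; ring.
Qed.

Lemma square_integrable_integrable (R : realType) (u : R * R -> R) :
  square_integrable u -> leb2.-integrable disk (EFin \o (u : plane R -> R)).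
Proof.
move=> su; have s1 : square_integrable (fun _ : R * R => (1 : R)).
  by apply: (@square_integrable_bounded _ _ 1) => // z _; rewrite normr1.
have := square_integrable_mul su s1; congr (leb2.-integrable _ _).
by apply/funext => z /=; rewrite mulr1.
Qed.

Lemma square_integrable_test (R : realType) (phi : R * R -> R) :
  test_function phi -> square_integrable phi.
Proof.
move=> tphi; have [M HM] := test_function_bounded 0 tphi.
apply: (@square_integrable_bounded _ _ M); first exact: measurable_test_function.
by move=> z /HM[].
Qed.

Lemma square_integrable_derive_test (R : realType) (phi : R * R -> R) (e : R * R) :
  test_function phi -> square_integrable ('D_e phi).
Proof.
move=> tphi; have [M HM] := test_function_bounded e tphi.
apply: (@square_integrable_bounded _ _ M); first exact: measurable_derive_test_function.
by move=> z /HM[].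
Qed.

Lemma weak_derivative_test (R : realType) (phi : R * R -> R) (e : R * R) :
  e = dir_x \/ e = dir_y -> test_function phi -> weak_derivative e phi ('D_e phi).
Proof.
move=> ee tphi; split; first exact: square_integrable_derive_test.
move=> psi tpsi.
have [K [_ _ [cphi Dphi cdphi _ _]]] := test_function_derive e tphi.
exact: integral_by_parts_disk.
Qed.

Lemma weak_derivative_lin (R : realType) (e : R * R) (a : R) (u v p q : R * R -> R) :
  square_integrable u -> square_integrable v ->
  weak_derivative e u p -> weak_derivative e v q ->
  weak_derivative e (fun z => a * u z + v z) (fun z => a * p z + q z).
Proof.
move=> su sv [sp up] [sq vq]; split; first exact: square_integrable_lin.
move=> phi tphi.
have sphi := square_integrable_test tphi.
have sdphi := square_integrable_derive_test e tphi.
have mD := @measurable_disk R.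
have lin (f g h : R * R -> R) : square_integrable f -> square_integrable g ->
    square_integrable h ->
    \int[leb2]_(z in disk) ((a * f z + g z) * h z) =
    a * \int[leb2]_(z in disk) (f z * h z) + \int[leb2]_(z in disk) (g z * h z).
  move=> sf sg sh.
  have ifh := square_integrable_mul sf sh; have igh := square_integrable_mul sg sh.
  rewrite -RintegralZl// -RintegralD//; last first.
    rewrite (_ : EFin \o _ = (fun z : plane R => a%:E * (EFin \o (fun z => f z * h z)%R) z))%E//.
    exact: integrableZl.
  by apply: eq_Rintegral => z _; ring.
by rewrite !lin// up// vq// opprD mulrN.
Qed.

Lemma weak_derivative_eq (R : realType) (e : R * R) (u v p q : R * R -> R) :
  (forall z, disk z -> u z = v z) -> (forall z, disk z -> p z = q z) ->
  weak_derivative e u p -> weak_derivative e v q.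
Proof.
move=> uv pq [[mp ip] up]; split.
  split; first by apply: eq_measurable_fun mp => z /set_mem /pq.
  suff <- : (\int[leb2]_(z in disk) (p z ^+ 2)%:E = \int[leb2]_(z in disk) (q z ^+ 2)%:E)%E by [].
  by apply: eq_integral => z /set_mem dz; rewrite pq.
move=> phi tphi; have E := up phi tphi.
have -> : \int[leb2]_(z in disk) (v z * 'D_e phi z) = \int[leb2]_(z in disk) (u z * 'D_e phi z).
  by apply: eq_Rintegral => z /set_mem dz; rewrite uv.
by rewrite E; congr (- _); apply: eq_Rintegral => z /set_mem dz; rewrite pq.
Qed.

(** The square of [modulus] as a polynomial, free of square roots and written with products so that
    [Ck_mul] and [is_derive_mulf] apply directly. *)
Definition sqnorm (R : realType) (z : R * R) : R := z.1 * z.1 + z.2 * z.2.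

Lemma Ck_sqnorm (R : realType) k (U : set (R * R)) : open U -> Ck k U (@sqnorm R).
Proof.
move=> oU; exact: (Ck_add oU (Ck_mul oU (@Ck_fst R k U) (@Ck_fst R k U))
  (Ck_mul oU (@Ck_snd R k U) (@Ck_snd R k U))).
Qed.

Lemma disk_sqnorm (R : realType) (z : R * R) : disk z <-> sqnorm z < 1.
Proof. by rewrite diskE /sqnorm !expr2. Qed.

Lemma compact_sqnorm (R : realType) (c : R) : c <= 1 -> compact [set z : R * R | sqnorm z <= c].
Proof.
move=> c1; apply: (@subclosed_compact _ _ (`[-1, 1] `*` `[-1, 1] : set (R * R))).
- apply: (@closed_comp _ _ (@sqnorm R) [set x | x <= c]); last exact: closed_le.
  by move=> z _; exact: (Ck_continuous (Ck_sqnorm 0 openT) (z := z) I).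
- by apply: compact_setX; exact: segment_compact.
- move=> z /=; rewrite /sqnorm !in_itv/= => zc; split; apply/andP.
    by have := sqr_ge0 z.2; split; nra.
  by have := sqr_ge0 z.1; split; nra.
Qed.

Lemma test_functionI (R : realType) (phi : R * R -> R) (c : R) : c < 1 ->
  smooth disk phi -> (forall z, disk z -> c < sqnorm z -> phi z = 0) ->
  test_function phi.
Proof.
move=> c1 sphi phi0; split => //; exists [set z | sqnorm z <= c]; split.
- exact/compact_sqnorm/ltW.
- by move=> z /= zc; apply/disk_sqnorm; exact: le_lt_trans c1.
- by move=> z dz /negP; rewrite -ltNge; exact: phi0.
Qed.

(** * Uniqueness of weak derivatives *)

Definition quadrant (R : realType) (a b : R) : set (plane R) :=
  `]a, +oo[%classic `*` `]b, +oo[%classic.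

(* As eps tends to 0 these test functions tend to the indicator function of the
   intersection of the disk and a quadrant; such sets determine a measure. *)
Definition quadrant_bump (R : realType) (eps a b : R) (z : R * R) : R :=
  flat eps 0 (z.1 - a) * flat eps 0 (z.2 - b) * flat eps 0 (1 - eps - sqnorm z).

Lemma test_quadrant_bump (R : realType) (eps a b : R) : 0 < eps ->
  test_function (quadrant_bump eps a b).
Proof.
move=> e0; apply: (@test_functionI _ _ (1 - eps)); first by lra.
  move=> k; have oD := @open_disk R.
  have C1 := Ck_add oD (@Ck_fst R k disk) (@Ck_cst _ _ _ k disk (- a)).
  have C2 := Ck_add oD (@Ck_snd R k disk) (@Ck_cst _ _ _ k disk (- b)).
  have C3 := Ck_add oD (@Ck_cst _ _ _ k disk (1 - eps))
    (Ck_mul oD (@Ck_cst _ _ _ k disk (-1 : R)) (Ck_sqnorm k oD)).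
  have := Ck_mul oD (Ck_mul oD (Ck_flat 0 e0 oD C1) (Ck_flat 0 e0 oD C2)) (Ck_flat 0 e0 oD C3).
  apply: Ck_ext => // z _; rewrite /quadrant_bump/=; congr (_ * _ * flat _ _ _).
  by rewrite mulN1r.
move=> z _ zc; rewrite /quadrant_bump [X in _ * X]flat00 ?mulr0//; lra.
Qed.

Lemma cvg_flat (R : realType) (e x : nat -> R) (l : R) :
  (forall n, 0 < e n) -> e @ \oo --> 0 -> x @ \oo --> l -> 0 < l ->
  flat (e n) 0 (x n) @[n --> \oo] --> (1 : R).
Proof.
move=> e0 ce cx l0.
apply: (@squeeze_cvgr _ _ _ _ (fun n => 1 - e n / x n) (fun=> 1)).
- near=> n; apply: flat_bounds => //.
  by near: n; move/cvgr_gt : cx; apply.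
- rewrite -[X in _ --> X](_ : 1 - 0 / l = 1); last by rewrite mul0r subr0.
  by apply: cvgB; [exact: cvg_cst|apply: cvgM => //; apply: cvgV => //; rewrite gt_eqF].
- exact: cvg_cst.
Unshelve. all: by end_near. Qed.

Lemma cvg_flat_cst (R : realType) (e : nat -> R) (x : R) :
  (forall n, 0 < e n) -> e @ \oo --> 0 ->
  flat (e n) 0 x @[n --> \oo] --> (if 0 < x then 1 else 0 : R).
Proof.
move=> e0 ce; have [x0|x0] := ltP 0 x.
  by apply: (@cvg_flat _ e (fun=> x) x) => //; exact: cvg_cst.
by under eq_fun do rewrite flat00//; exact: cvg_cst.
Qed.

Lemma flat01 (R : realType) (eps x : R) : 0 < eps -> `|flat eps 0 x| <= 1.
Proof.
move=> e0; rewrite ger0_norm ?flat_ge0//.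
have [x0|x0] := ltP 0 x; last by rewrite flat00.
by have /andP[] := flat_bounds e0 x0.
Qed.

Lemma cvg_harmonic0 (R : realType) : (fun n => n.+1%:R^-1 : R) @ \oo --> (0 : R).
Proof. exact: cvg_harmonic. Qed.

Lemma cvg_quadrant_bump (R : realType) (a b : R) (z : R * R) : disk z ->
  quadrant_bump n.+1%:R^-1 a b z @[n --> \oo] --> (\1_(quadrant a b) z : R).
Proof.
move=> dz; have e0 n : 0 < n.+1%:R^-1 :> R by rewrite invr_gt0.
have ce := @cvg_harmonic0 R.
rewrite (_ : \1__ z = (if 0 < z.1 - a then 1 else 0) * (if 0 < z.2 - b then 1 else 0) * 1); last first.
  rewrite indicE mulr1 !subr_gt0; case: ifPn => za; case: ifPn => zb; rewrite ?mulr1 ?mulr0.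
  - by rewrite mem_set//; split; rewrite /= in_itv/= andbT.
  - by rewrite memNset// => -[_]; rewrite /= in_itv/= andbT; exact/negP.
  - by rewrite memNset// => -[+ _]; rewrite /= in_itv/= andbT; exact/negP.
  - by rewrite memNset// => -[+ _]; rewrite /= in_itv/= andbT; exact/negP.
apply: cvgM; first by apply: cvgM; exact: cvg_flat_cst.
apply: (@cvg_flat _ _ _ (1 - sqnorm z)) => //; last by move/disk_sqnorm : dz; lra.
rewrite -[X in _ --> X - _]subr0; apply: cvgB; last exact: cvg_cst.
by apply: cvgB => //; exact: cvg_cst.
Qed.

Lemma quadrant_full (R : realType) (z : R * R) : disk z -> quadrant (-1) (-1) z.
Proof.
move=> /disk_coord[]; rewrite !ltr_norml => /andP[z1 _] /andP[z2 _].
by split; rewrite /= in_itv/= andbT.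
Qed.

Lemma measurable_quadrant (R : realType) (a b : R) : measurable (quadrant a b).
Proof. exact: measurableX. Qed.

Definition quadrants (R : realType) : set (set (plane R)) :=
  [set A | exists a b, A = quadrant a b].

(** A half-plane x > a is the union over n of the quadrants with corner (a, -n), and likewise for y
    > b; hence both coordinates are measurable for the generated sigma-algebra. *)
Lemma measurable_quadrants (R : realType) :
  @measurable _ (plane R) = <<s @quadrants R >>.
Proof.
apply/seteqP; split; last first.
  apply: smallest_sub; first exact: sigma_algebra_measurable.
  by move=> _ [a [b ->]]; exact: measurable_quadrant.
have m1 : measurable_fun setT (fst : g_sigma_algebraType (@quadrants R) -> measurableTypeR R).
  apply: (measurability _ (RGenOInfty.measurableE R)) => _ [_ [a ->] <-].
  rewrite (_ : _ `&` _ = \bigcup_n quadrant a (- n%:R)).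
    by apply: bigcupT_measurable => n; apply: sub_sigma_algebra; exists a, (- n%:R).
  rewrite setTI; apply/seteqP; split=> [[x y] /= xa|[x y] [n _ []]//].
  have [n yn] : exists n : nat, - n%:R < y.
    exists (Num.bound `|y|); rewrite ltrNl; apply: le_lt_trans (archi_boundP (normr_ge0 y)).
    by rewrite -normrN ler_norm.
  by exists n => //; split => //; rewrite /= in_itv/= andbT.
have m2 : measurable_fun setT (snd : g_sigma_algebraType (@quadrants R) -> measurableTypeR R).
  apply: (measurability _ (RGenOInfty.measurableE R)) => _ [_ [b ->] <-].
  rewrite (_ : _ `&` _ = \bigcup_n quadrant (- n%:R) b).
    by apply: bigcupT_measurable => n; apply: sub_sigma_algebra; exists (- n%:R), b.
  rewrite setTI; apply/seteqP; split=> [[x y] /= yb|[x y] [n _ []]//].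
  have [n xn] : exists n : nat, - n%:R < x.
    exists (Num.bound `|x|); rewrite ltrNl; apply: le_lt_trans (archi_boundP (normr_ge0 x)).
    by rewrite -normrN ler_norm.
  by exists n => //; split => //; rewrite /= in_itv/= andbT.
have := measurable_fun_pair m1 m2.
move=> m A mA; have := m measurableT A mA; rewrite setTI.
by congr (_ _); apply/seteqP; split=> -[x y].
Qed.

Lemma setI_closed_quadrants (R : realType) : setI_closed (@quadrants R).
Proof.
move=> _ _ [a [b ->]] [c [d ->]]; exists (Num.max a c), (Num.max b d).
apply/seteqP; split=> -[x y] /=; rewrite /quadrant /= !in_itv/= !andbT !gt_max.
  by move=> [[-> ->] [-> ->]].
by move=> [/andP[-> ->] /andP[-> ->]].
Qed.

Lemma indicR01 (R : realType) (T : Type) (A : set T) (z : T) : `|\1_A z : R| <= 1.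
Proof. by rewrite indicE; case: (_ \in _); rewrite ?normr1 ?normr0. Qed.

Lemma integrable_mul_indic (R : realType) (p : plane R -> R) (A : set (plane R)) :
  leb2.-integrable disk (EFin \o p) -> measurable A ->
  leb2.-integrable disk (EFin \o (fun z => p z * \1_A z)).
Proof.
move=> ip mA; apply: (le_integrable (@measurable_disk R) _ _ ip).
  apply/measurable_EFinP; apply: measurable_funM; last exact: measurable_indic.
  by apply/measurable_EFinP; exact: measurable_int ip.
by move=> z _ /=; rewrite lee_fin normrM ler_piMr// indicR01.
Qed.

(** The sets A in question form a Dynkin system: the whole plane is replaced by a quadrant
    containing the disk, complements follow by subtraction and disjoint unions by dominated
    convergence. Quadrants are stable under intersection and generate. *)
Lemma Rintegral_indic0 (R : realType) (p : plane R -> R) :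
  leb2.-integrable disk (EFin \o p) ->
  (forall a b, \int[leb2]_(z in disk) (p z * \1_(quadrant a b) z) = 0) ->
  forall A, measurable A -> \int[leb2]_(z in disk) (p z * \1_A z) = 0.
Proof.
move=> ip p0; have mD := @measurable_disk R.
pose P := [set A : set (plane R) | \int[leb2]_(z in disk) (p z * \1_A z) = 0].
suff H : forall A, <<s @quadrants R >> A -> P A.
  by move=> A mA; apply: H; rewrite -measurable_quadrants.
apply: (@dynkin_induction _ (plane R) (@quadrants R) P (@measurable_quadrants R) (@setI_closed_quadrants R)); rewrite /P /=.
- rewrite -(p0 (-1) (-1)); apply: eq_Rintegral => z /set_mem dz.
  by rewrite !indicE !mem_set//; exact: quadrant_full.
- by move=> _ [a [b ->]].
- move=> S mS /= S0.
  have pT : \int[leb2]_(z in disk) p z = 0.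
    rewrite -(p0 (-1) (-1)); apply: eq_Rintegral => z /set_mem dz.
    by rewrite !indicE !mem_set ?mulr1//; exact: quadrant_full.
  transitivity (\int[leb2]_(z in disk) (p z - p z * \1_S z)).
    apply: eq_Rintegral => z _; rewrite !indicE in_setC.
    by case: (_ \in _); rewrite /= ?mulr0 ?mulr1 ?subrr ?subr0.
  by rewrite RintegralB//; [rewrite pT S0 subrr|exact: integrable_mul_indic].
move=> F mF tF F0 /=.
pose U n := \big[setU/set0]_(i < n) F i.
have mU n : measurable (U n) by apply: bigsetU_measurable.
have U0 n : \int[leb2]_(z in disk) (p z * \1_(U n) z) = 0.
  elim: n => [|n IH].
    rewrite /Rintegral integral0_eq// => z _.
    by rewrite /U big_ord0 indic0 mulr0.
  transitivity (\int[leb2]_(z in disk) (p z * \1_(U n) z + p z * \1_(F n) z)).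
    apply: eq_Rintegral => z _; rewrite -mulrDr; congr (_ * _).
    rewrite /U big_ord_recr/= -/(U n) !indicE in_setU.
    have [zn|] := boolP (z \in F n); have [zu|] := boolP (z \in U n); rewrite ?addr0 ?add0r//.
    exfalso; move: zn zu; rewrite !inE => zn.
    by rewrite /U -bigcup_mkord => -[k /= kn Fk]; have := tF k n I I (ex_intro _ z (conj Fk zn)) => kE; rewrite kE ltnn in kn.
  by rewrite RintegralD ?IH ?F0 ?addr0//; exact: integrable_mul_indic.
have mfU n : measurable_fun (disk : set (plane R)) (fun z => p z * \1_(U n) z).
  by have /measurable_EFinP := measurable_int _ (integrable_mul_indic ip (mU n)).
have iabs : leb2.-integrable disk (EFin \o (fun z => `|p z|)).
  by have := integrable_abse ip; congr (leb2.-integrable _ _).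
have bnd n z : disk z -> `|p z * \1_(U n) z| <= `|p z|.
  by move=> _; rewrite normrM ler_piMr// indicR01.
have cU z : disk z -> p z * \1_(U n) z @[n --> \oo] --> p z * \1_(\bigcup_k F k) z.
  move=> _; apply: cvgM; first exact: cvg_cst.
  apply: cvg_near_cst.
  have [[k _ Fk]|nF] := pselect ((\bigcup_k F k) z); last first.
    apply: nearW => n; rewrite !indicE !memNset//.
    by rewrite /U -bigcup_mkord => -[k _ Fk]; apply: nF; exists k.
  near=> n; rewrite !indicE !mem_set//; first by exists k.
  rewrite /U -bigcup_mkord; exists k => //=; near: n; exact: nbhs_infty_gt.
have [_ _ H] := Rintegral_dct mD mfU iabs bnd cU.
by rewrite -(cvg_lim _ H)//; under eq_fun do rewrite U0; rewrite lim_cst.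
Unshelve. all: by end_near. Qed.

(** The fundamental lemma of the calculus of variations: the bumps give zero integrals over
    quadrants, hence over all measurable subsets of the disk. *)
Lemma ae_eq0_of_test_functions (R : realType) (p : R * R -> R) :
  square_integrable p ->
  (forall phi, test_function phi -> \int[leb2]_(z in disk) (p z * phi z) = 0) ->
  ae_eq leb2 disk (EFin \o (p : plane R -> R)) (cst 0%E).
Proof.
move=> sp p0; have ip := square_integrable_integrable sp.
have mD := @measurable_disk R.
have iabs : leb2.-integrable disk (EFin \o (fun z => `|p z|)).
  by have := integrable_abse ip; congr (leb2.-integrable _ _).
have mp : measurable_fun (disk : set (plane R)) p.
  by apply/measurable_EFinP; exact: measurable_int ip.
have e0 n : 0 < n.+1%:R^-1 :> R by rewrite invr_gt0.
have q0 a b : \int[leb2]_(z in disk) (p z * \1_(quadrant a b) z) = 0.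
  have mb n : measurable_fun (disk : set (plane R)) (fun z => p z * quadrant_bump n.+1%:R^-1 a b z).
    by apply: measurable_funM => //; apply: measurable_test_function; exact: test_quadrant_bump.
  have bnd n z : disk z -> `|p z * quadrant_bump n.+1%:R^-1 a b z| <= `|p z|.
    move=> _; rewrite normrM ler_piMr// /quadrant_bump !normrM.
    by rewrite !mulr_ile1 ?mulr_ge0 ?flat01.
  have cb z : disk z -> p z * quadrant_bump n.+1%:R^-1 a b z @[n --> \oo] -->
      p z * \1_(quadrant a b) z.
    by move=> dz; apply: cvgM; [exact: cvg_cst|exact: cvg_quadrant_bump].
  have [_ _ H] := Rintegral_dct mD mb iabs bnd cb.
  have E n : \int[leb2]_(z in disk) (p z * quadrant_bump n.+1%:R^-1 a b z) = 0.
    by apply: p0; exact: test_quadrant_bump.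
  by rewrite -(cvg_lim _ H)//; under eq_fun do rewrite E; rewrite lim_cst.
apply: integral_ae_eq => // E Ed mE.
rewrite integral0.
have <- : (E `&` disk)%classic = E by apply/setIidl.
transitivity (\int[leb2]_(z in disk) (p z * \1_E z)%:E)%E.
  rewrite integral_mkcondl; apply: eq_integral => z _; rewrite /patch indicE.
  by case: ifPn => _ /=; rewrite ?mulr1 ?mulr0.
have iE := integrable_mul_indic ip mE.
rewrite -[LHS]fineK; last by apply: integrable_fin_num => //.
by congr EFin; have := Rintegral_indic0 ip q0 mE.
Qed.

Lemma weak_derivative_unique (R : realType) (e : R * R) (u p q : R * R -> R) :
  weak_derivative e u p -> weak_derivative e u q ->
  ae_eq leb2 disk (EFin \o (p : plane R -> R)) (EFin \o (q : plane R -> R)).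
Proof.
move=> [sp up] [sq uq].
have spq : square_integrable (fun z => -1 * q z + p z) by exact: square_integrable_lin.
have /(ae_eq0_of_test_functions spq) : forall phi, test_function phi ->
    \int[leb2]_(z in disk) ((-1 * q z + p z) * phi z) = 0.
  move=> phi tphi; have sphi := square_integrable_test tphi.
  transitivity (\int[leb2]_(z in disk) (p z * phi z - q z * phi z)).
    by apply: eq_Rintegral => z _; ring.
  rewrite RintegralB; [|exact: measurable_disk|exact: square_integrable_mul|exact: square_integrable_mul].
  by have := up _ tphi; rewrite uq// => /oppr_inj ->; rewrite subrr.
apply: filterS => z /= H dz; have [] := H dz.
by rewrite mulN1r addrC => /subr0_eq ->.
Qed.

(** * Weak gradients, the Dirichlet form and approximation in H^1 *)

Lemma ae_impl (R : realType) (P Q : plane R -> Prop) :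
  {ae leb2, forall z, P z} -> (forall z, P z -> Q z) -> {ae leb2, forall z, Q z}.
Proof. by move=> HP PQ; apply: filterS HP. Qed.

Lemma ae_impl2 (R : realType) (P1 P2 Q : plane R -> Prop) :
  {ae leb2, forall z, P1 z} -> {ae leb2, forall z, P2 z} ->
  (forall z, P1 z -> P2 z -> Q z) -> {ae leb2, forall z, Q z}.
Proof. by move=> H1 H2 PQ; apply: filterS2 H1 H2. Qed.

(** A relation rather than a choice, so that explicit gradients can stand for the chosen [weak_dx]
    and [weak_dy]. *)
Definition weak_gradient (R : realType) (u p q : R * R -> R) : Prop :=
  [/\ square_integrable u, weak_derivative dir_x u p & weak_derivative dir_y u q].

Lemma ae_eq_Rintegral_disk (R : realType) (f g : plane R -> R) :
  measurable_fun (disk : set (plane R)) f -> measurable_fun (disk : set (plane R)) g ->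
  {ae leb2, forall z, disk z -> f z = g z} ->
  \int[leb2]_(z in disk) f z = \int[leb2]_(z in disk) g z.
Proof.
move=> mf mg fg; congr fine; apply: ae_eq_integral.
- exact: measurable_disk.
- exact/measurable_EFinP.
- exact/measurable_EFinP.
- by apply: (ae_impl fg) => z /= H /H ->.
Qed.

Lemma weak_derivative_ae (R : realType) (e : R * R) (u p q : R * R -> R) :
  weak_derivative e u p -> weak_derivative e u q ->
  {ae leb2, forall z : plane R, disk z -> p z = q z}.
Proof.
move=> up uq; apply: (ae_impl (weak_derivative_unique up uq)).
by move=> z /= H /H[].
Qed.

Lemma weak_dxP (R : realType) (u p : R * R -> R) :
  weak_derivative dir_x u p -> weak_derivative dir_x u (weak_dx u).
Proof. by move=> up; apply: (@xgetPex _ _ (weak_derivative dir_x u)); exists p. Qed.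

Lemma weak_dyP (R : realType) (u p : R * R -> R) :
  weak_derivative dir_y u p -> weak_derivative dir_y u (weak_dy u).
Proof. by move=> up; apply: (@xgetPex _ _ (weak_derivative dir_y u)); exists p. Qed.

Lemma weak_derivative_measurable (R : realType) (e : R * R) (u p : R * R -> R) :
  weak_derivative e u p -> measurable_fun (disk : set (plane R)) p.
Proof. by case=> -[]. Qed.

(** Weak derivatives being unique almost everywhere, any representatives give the same integral as
    the chosen ones. *)
Lemma dirichletE (R : realType) (u p q v p' q' : R * R -> R) :
  weak_gradient u p q -> weak_gradient v p' q' ->
  dirichlet u v = (2 * pi)^-1 * \int[leb2]_(z in disk) (p z * p' z + q z * q' z).
Proof.
move=> [_ up uq] [_ vp vq]; congr (_ * _).
have up' := weak_dxP up; have uq' := weak_dyP uq.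
have vp' := weak_dxP vp; have vq' := weak_dyP vq.
have m := @weak_derivative_measurable R.
apply: ae_eq_Rintegral_disk.
- by apply: measurable_funD; apply: measurable_funM; [exact: m up'|exact: m vp'|exact: m uq'|exact: m vq'].
- by apply: measurable_funD; apply: measurable_funM; [exact: m up|exact: m vp|exact: m uq|exact: m vq].
- have hu := ae_impl2 (weak_derivative_ae up' up) (weak_derivative_ae uq' uq)
    (fun z h1 h2 => conj h1 h2).
  have hv := ae_impl2 (weak_derivative_ae vp' vp) (weak_derivative_ae vq' vq)
    (fun z h1 h2 => conj h1 h2).
  apply: (ae_impl2 hu hv) => z [h1 h2] [h3 h4] dz.
  by rewrite h1// h2// h3// h4.
Qed.

Lemma H1_norm_sqr (R : realType) (u p q : R * R -> R) : weak_gradient u p q ->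
  H1_norm u ^+ 2 = \int[leb2]_(z in disk) (u z ^+ 2 + p z ^+ 2 + q z ^+ 2).
Proof.
move=> [su up uq]; rewrite sqr_sqrtr; last first.
  by apply: Rintegral_ge0 => z _; rewrite !addr_ge0 ?sqr_ge0.
have up' := weak_dxP up; have uq' := weak_dyP uq.
have m := @weak_derivative_measurable R.
apply: ae_eq_Rintegral_disk.
- apply: measurable_funD; [apply: measurable_funD|]; apply: measurable_funX; [by case: su|exact: m up'|exact: m uq'].
- apply: measurable_funD; [apply: measurable_funD|]; apply: measurable_funX; [by case: su|exact: m up|exact: m uq].
- apply: (ae_impl2 (weak_derivative_ae up' up) (weak_derivative_ae uq' uq)) => z h1 h2 dz.
  by rewrite h1// h2.
Qed.

Lemma H1_norm_ge0 (R : realType) (u : R * R -> R) : 0 <= H1_norm u.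
Proof. exact: sqrtr_ge0. Qed.

Lemma weak_gradient_lin (R : realType) (a : R) (u p q v p' q' : R * R -> R) :
  weak_gradient u p q -> weak_gradient v p' q' ->
  weak_gradient (fun z => a * u z + v z) (fun z => a * p z + p' z) (fun z => a * q z + q' z).
Proof.
move=> [su up uq] [sv vp vq]; split; first exact: square_integrable_lin.
  exact: weak_derivative_lin.
exact: weak_derivative_lin.
Qed.

Lemma weak_gradient_test (R : realType) (phi : R * R -> R) :
  test_function phi -> weak_gradient phi ('D_dir_x phi) ('D_dir_y phi).
Proof.
move=> tphi; split; first exact: square_integrable_test.
  by apply: weak_derivative_test => //; left.
by apply: weak_derivative_test => //; right.
Qed.

Lemma weak_gradient_eq (R : realType) (u v p q : R * R -> R) :
  (forall z, disk z -> u z = v z) -> weak_gradient u p q -> weak_gradient v p q.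
Proof.
move=> uv [su up uq]; split.
- case: su => mu iu; split; first by apply: eq_measurable_fun mu => z /set_mem /uv.
  suff <- : (\int[leb2]_(z in disk) (u z ^+ 2)%:E = \int[leb2]_(z in disk) (v z ^+ 2)%:E)%E by [].
  by apply: eq_integral => z /set_mem dz; rewrite uv.
- exact: weak_derivative_eq up.
- exact: weak_derivative_eq uq.
Qed.

Lemma sobolev_H1_gradient (R : realType) (u : R * R -> R) :
  sobolev_H1 u <-> exists p q, weak_gradient u p q.
Proof.
split=> [[su [p up] [q uq]]|[p [q [su up uq]]]]; first by exists p, q.
by split => //; [exists p|exists q].
Qed.

Lemma weak_gradient_sub (R : realType) (u p q v p' q' : R * R -> R) :
  weak_gradient u p q -> weak_gradient v p' q' ->
  weak_gradient (u \- v) (p \- p') (q \- q').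
Proof.
move=> gu gv; have := weak_gradient_lin (-1) gv gu.
by congr (weak_gradient _ _ _); apply/funext => z; rewrite mulN1r addrC.
Qed.

Lemma test_function_lin (R : realType) (a : R) (phi psi : R * R -> R) :
  test_function phi -> test_function psi -> test_function (fun z => a * phi z + psi z).
Proof.
move=> [sphi [K [cK Kd phi0]]] [spsi [L [cL Ld psi0]]]; split.
  have oD := @open_disk R.
  by move=> k; exact: (Ck_add oD (Ck_mul oD (@Ck_cst _ _ _ k disk a) (sphi k)) (spsi k)).
exists (K `|` L); split.
- exact: compactU.
- by move=> z [/Kd|/Ld].
- by move=> z dz /not_orP[nK nL]; rewrite phi0// psi0// mulr0 addr0.
Qed.

(** Functions live on the whole plane, but the kernels of the averages are known to equal [green] on
    the disk only. *)
Lemma sobolev_H10_eq (R : realType) (u v : R * R -> R) :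
  (forall z, disk z -> u z = v z) -> sobolev_H10 u -> sobolev_H10 v.
Proof.
move=> uv [/sobolev_H1_gradient[p [q gu]] H]; have gv := weak_gradient_eq uv gu.
split; first by apply/sobolev_H1_gradient; exists p, q.
move=> eps e0; have [phi [tphi phie]] := H _ e0; exists phi; split; first exact: tphi.
have gphi := weak_gradient_test tphi.
rewrite -(@ltr_sqr _ (H1_norm _) eps) ?nnegrE ?H1_norm_ge0 ?ltW//.
rewrite (H1_norm_sqr (weak_gradient_sub gv gphi)).
suff -> : \int[leb2]_(z in disk) ((v \- phi) z ^+ 2 + (p \- 'D_dir_x phi) z ^+ 2 + (q \- 'D_dir_y phi) z ^+ 2)
  = H1_norm (u \- phi) ^+ 2 by rewrite ltr_sqr ?nnegrE ?H1_norm_ge0 ?ltW.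
rewrite (H1_norm_sqr (weak_gradient_sub gu gphi)).
by apply: eq_Rintegral => z /set_mem dz /=; rewrite uv.
Qed.

Local Opaque H1_norm dirichlet Ck.

Lemma integrable_energy_density (R : realType) (u p q : R * R -> R) : weak_gradient u p q ->
  leb2.-integrable disk (EFin \o (fun z : plane R => u z ^+ 2 + p z ^+ 2 + q z ^+ 2)).
Proof.
move=> [/square_integrableP[_ iu] [/square_integrableP[_ ip] _] [/square_integrableP[_ iq] _]].
have mD := @measurable_disk R.
exact: (integrableD mD (integrableD mD iu ip) iq).
Qed.

(** Integrates (a x + y)^2 <= 2 a^2 x^2 + 2 y^2; it stands in for the triangle inequality. *)
Lemma H1_norm_lin (R : realType) (a : R) (u p q v p' q' : R * R -> R) :
  weak_gradient u p q -> weak_gradient v p' q' ->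
  H1_norm (fun z => a * u z + v z) ^+ 2 <= 2 * a ^+ 2 * H1_norm u ^+ 2 + 2 * H1_norm v ^+ 2.
Proof.
move=> gu gv; have guv := weak_gradient_lin a gu gv.
have subst (c x x' y y' w w' : R) : x = x' -> y = y' -> w = w' ->
  w' <= c * x' + 2 * y' -> w <= c * x + 2 * y by move=> -> -> ->.
apply: (subst _ _ _ _ _ _ _ (H1_norm_sqr gu) (H1_norm_sqr gv) (H1_norm_sqr guv)).
have mD := @measurable_disk R.
have iu := integrable_energy_density gu; have iv := integrable_energy_density gv.
have iu' : leb2.-integrable disk (EFin \o (fun z : plane R => 2 * a ^+ 2 * (u z ^+ 2 + p z ^+ 2 + q z ^+ 2))).
  by have := integrableZl mD (2 * a ^+ 2) iu; congr (leb2.-integrable _ _).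
have iv' : leb2.-integrable disk (EFin \o (fun z : plane R => 2 * (v z ^+ 2 + p' z ^+ 2 + q' z ^+ 2))).
  by have := integrableZl mD 2 iv; congr (leb2.-integrable _ _).
rewrite -!RintegralZl// -RintegralD//.
apply: le_Rintegral => //.
- exact: integrable_energy_density guv.
- by have := integrableD mD iu' iv'; congr (leb2.-integrable _ _).
move=> z _; have s (x y : R) : (a * x + y) ^+ 2 <= 2 * a ^+ 2 * x ^+ 2 + 2 * y ^+ 2.
  by have := sqr_ge0 (a * x - y); nra.
by have := s (u z) (v z); have := s (p z) (p' z); have := s (q z) (q' z); lra.
Qed.

Lemma sobolev_H10_lin (R : realType) (a : R) (u v : R * R -> R) :
  sobolev_H10 u -> sobolev_H10 v -> sobolev_H10 (fun z => a * u z + v z).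
Proof.
move=> [/sobolev_H1_gradient[p [q gu]] Hu] [/sobolev_H1_gradient[p' [q' gv]] Hv].
have guv := weak_gradient_lin a gu gv.
split; first by apply/sobolev_H1_gradient; eexists; eexists; exact: guv.
(* With d = eps / (2 m), the bound 2 a^2 d^2 + 2 d^2 coming from [H1_norm_lin] stays below 4 m^2 d^2
   = eps^2. *)
move=> eps e0; pose m := `|a| + 1.
have m0 : 0 < m by rewrite ltr_wpDl.
have d0 : 0 < eps / (2 * m) by rewrite divr_gt0// mulr_gt0.
have [phi [tphi phie]] := Hu _ d0; have [psi [tpsi psie]] := Hv _ d0.
exists (fun z => a * phi z + psi z); split; first exact: test_function_lin.
have -> : (fun z => a * u z + v z) \- (fun z => a * phi z + psi z) =
    fun z => a * (u \- phi) z + (v \- psi) z by apply/funext => z /=; ring.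
rewrite -ltr_sqr ?nnegrE ?H1_norm_ge0 ?ltW//.
apply: le_lt_trans (H1_norm_lin a (weak_gradient_sub gu (weak_gradient_test tphi))
  (weak_gradient_sub gv (weak_gradient_test tpsi))) _.
move: (H1_norm (u \- phi)) (H1_norm (v \- psi)) (H1_norm_ge0 (u \- phi))
  (H1_norm_ge0 (v \- psi)) phie psie => A B A0 B0 phie psie.
set d := eps / (2 * m) in d0 phie psie *.
have h1 : A ^+ 2 <= d ^+ 2 by apply: lerXn2r; rewrite ?nnegrE//; exact: ltW.
have h2 : B ^+ 2 <= d ^+ 2 by apply: lerXn2r; rewrite ?nnegrE//; exact: ltW.
have ed : eps = d * (2 * m) by rewrite /d divfK// gt_eqF ?mulr_gt0.
have a2 : a ^+ 2 = `|a| ^+ 2 by rewrite real_normK ?num_real.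
have na := normr_ge0 a.
apply: (@le_lt_trans _ _ (2 * a ^+ 2 * d ^+ 2 + 2 * d ^+ 2)).
  by rewrite lerD// ler_wpM2l// mulr_ge0 ?sqr_ge0.
have d2 : 0 < d ^+ 2 by rewrite exprn_gt0.
rewrite ed /m a2 -subr_gt0; move: (`|a|) na => t t0.
rewrite (_ : _ - _ = d ^+ 2 * (2 * t ^+ 2 + 8 * t + 2)); last by ring.
by rewrite mulr_gt0//; nra.
Qed.

(** The disk has finite measure, so constants dominate. Dominated convergence is used twice: in the
    weak formulation, to identify p and q as the weak derivatives of u, and for the squared
    differences, to obtain convergence in H^1. *)
Lemma bounded_limit_sobolev_H10 (R : realType) (M : R) (phi : nat -> R * R -> R)
    (u p q : R * R -> R) :
  (forall n, test_function (phi n)) ->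
  (forall n z, disk z -> [/\ `|phi n z| <= M, `|'D_dir_x (phi n) z| <= M &
                          `|'D_dir_y (phi n) z| <= M]) ->
  (forall z, disk z -> [/\ phi n z @[n --> \oo] --> u z,
    'D_dir_x (phi n) z @[n --> \oo] --> p z & 'D_dir_y (phi n) z @[n --> \oo] --> q z]) ->
  weak_gradient u p q /\ sobolev_H10 u.
Proof.
move=> tphi phiM cphi.
have mphi n := measurable_test_function (tphi n).
have mdphi e n := measurable_derive_test_function e (tphi n).
have [mu uM _] := Rintegral_dct_disk mphi (fun n z dz => let: And3 h _ _ := phiM n z dz in h)
  (fun z dz => let: And3 h _ _ := cphi z dz in h).
have wd e p' : e = dir_x \/ e = dir_y ->
    (forall n z, disk z -> `|'D_e (phi n) z| <= M) ->
    (forall z, disk z -> 'D_e (phi n) z @[n --> \oo] --> p' z) -> weak_derivative e u p'.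
  move=> ee dM cd; have [mp pM _] := Rintegral_dct_disk (mdphi e) dM cd.
  split; first exact: square_integrable_bounded pM.
  move=> psi tpsi; have [L HL] := test_function_bounded e tpsi.
  have mpsi := measurable_test_function tpsi.
  have mdpsi := measurable_derive_test_function e tpsi.
  have [|||_ _ H1] := @Rintegral_dct_disk R (fun n z => phi n z * 'D_e psi z) (fun z => u z * 'D_e psi z) (M * L).
  - by move=> n; exact: measurable_funM.
  - move=> n z dz; have [h _ _] := phiM n z dz; have [_ h'] := HL z dz.
    by rewrite normrM ler_pM.
  - by move=> z dz; have [h _ _] := cphi z dz; apply: cvgM => //; exact: cvg_cst.
  have [|||_ _ H2] := @Rintegral_dct_disk R (fun n z => 'D_e (phi n) z * psi z) (fun z => p' z * psi z) (M * L).
  - by move=> n; exact: measurable_funM.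
  - move=> n z dz; have h := dM n z dz; have [h' _] := HL z dz.
    by rewrite normrM ler_pM.
  - by move=> z dz; apply: cvgM; [exact: cd|exact: cvg_cst].
  have E n : \int[leb2]_(z in disk) (phi n z * 'D_e psi z) =
      - \int[leb2]_(z in disk) ('D_e (phi n) z * psi z).
    have [_] := weak_derivative_test ee (tphi n); exact.
  move: H1; under eq_fun do rewrite E.
  by move=> H1; rewrite -(cvg_lim _ H1)//; apply: cvg_lim => //; exact: cvgN.
have gu : weak_gradient u p q.
  split; first exact: square_integrable_bounded uM.
    apply: wd; [by left|by move=> n z dz; case: (phiM n z dz)|by move=> z dz; case: (cphi z dz)].
  apply: wd; [by right|by move=> n z dz; case: (phiM n z dz)|by move=> z dz; case: (cphi z dz)].
split => //; split; first by apply/sobolev_H1_gradient; exists p, q.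
move=> eps e0.
have gn n := weak_gradient_sub gu (weak_gradient_test (tphi n)).
have [[mp _] _] : square_integrable p /\ True by case: gu => _ [].
have [[mq _] _] : square_integrable q /\ True by case: gu => _ _ [].
have lim2 (f : nat -> R) (l : R) : f n @[n --> \oo] --> l -> (l - f n) ^+ 2 @[n --> \oo] --> 0.
  move=> fl; rewrite -[X in _ --> X](expr0n _ 2) -(subrr l).
  by rewrite !expr2; apply: cvgM; apply: cvgB => //; exact: cvg_cst.
have [_ pM _] := Rintegral_dct_disk (mdphi dir_x) (fun n z dz => let: And3 _ h _ := phiM n z dz in h)
  (fun z dz => let: And3 _ h _ := cphi z dz in h).
have [_ qM _] := Rintegral_dct_disk (mdphi dir_y) (fun n z dz => let: And3 _ _ h := phiM n z dz in h)
  (fun z dz => let: And3 _ _ h := cphi z dz in h).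
have sq2 (x y : R) : `|x| <= M -> `|y| <= M -> (x - y) ^+ 2 <= (2 * M) ^+ 2.
  by rewrite !ler_norml => /andP[? ?] /andP[? ?]; nra.
have [|||_ _ H] := @Rintegral_dct_disk R
  (fun n z => (u \- phi n) z ^+ 2 + (p \- 'D_dir_x (phi n)) z ^+ 2 + (q \- 'D_dir_y (phi n)) z ^+ 2)
  (fun=> 0) (3 * (2 * M) ^+ 2).
- move=> n; apply: measurable_funD; [apply: measurable_funD|]; apply: measurable_funX;
    apply: measurable_funB => //; exact: mdphi.
- move=> n z dz; have [h1 h2 h3] := phiM n z dz.
  rewrite ger0_norm ?addr_ge0 ?sqr_ge0//=.
  have := sq2 _ _ (uM z dz) h1; have := sq2 _ _ (pM z dz) h2; have := sq2 _ _ (qM z dz) h3; lra.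
- move=> z dz; have [h1 h2 h3] := cphi z dz.
  by rewrite -[X in _ --> X]addr0 -[X in _ --> X + _]addr0; apply: cvgD; [apply: cvgD|]; exact: lim2.
have I0 : \int[leb2]_(z in disk) 0 = 0 :> R by rewrite /Rintegral integral0_eq.
rewrite I0 in H.
have e2 : 0 < eps ^+ 2 by rewrite exprn_gt0.
have /cvgr_lt/(_ _ e2) [N _ HN] := H.
exists (phi N); split; first exact: tphi.
rewrite -ltr_sqr ?nnegrE ?H1_norm_ge0 ?ltW// (H1_norm_sqr (gn N)).
by apply: HN => /=.
Qed.

(** * Truncated Green functions *)

(* The square of the pseudo-hyperbolic distance |w - z| / |1 - conj(z) w| is
   mobius_num z w / mobius_den z w. *)
Definition mobius_num (R : realType) (z w : R * R) : R :=
  (w.1 - z.1) * (w.1 - z.1) + (w.2 - z.2) * (w.2 - z.2).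

Definition mobius_den (R : realType) (z w : R * R) : R :=
  1 - 2 * (z.1 * w.1 + z.2 * w.2) + sqnorm z * sqnorm w.

Definition phdist2 (R : realType) (z w : R * R) : R := mobius_num z w / mobius_den z w.

Definition dmobius_num (R : realType) (e z w : R * R) : R :=
  2 * (w.1 - z.1) * e.1 + 2 * (w.2 - z.2) * e.2.

Definition dmobius_den (R : realType) (e z w : R * R) : R :=
  2 * (sqnorm z * w.1 - z.1) * e.1 + 2 * (sqnorm z * w.2 - z.2) * e.2.

Definition dphdist2 (R : realType) (e z w : R * R) : R :=
  (dmobius_num e z w * mobius_den z w - mobius_num z w * dmobius_den e z w) /
  mobius_den z w ^+ 2.

Lemma mobius_denE (R : realType) (z w : R * R) :
  mobius_den z w = (1 - (z.1 * w.1 + z.2 * w.2)) ^+ 2 + (z.1 * w.2 - z.2 * w.1) ^+ 2.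
Proof. by rewrite /mobius_den /sqnorm; ring. Qed.

Lemma mobius_denB (R : realType) (z w : R * R) :
  mobius_den z w - mobius_num z w = (1 - sqnorm z) * (1 - sqnorm w).
Proof. by rewrite /mobius_den /mobius_num /sqnorm; ring. Qed.

Lemma mobius_num_ge0 (R : realType) (z w : R * R) : 0 <= mobius_num z w.
Proof. by rewrite /mobius_num addr_ge0// -expr2 sqr_ge0. Qed.

Lemma sqnorm_ge0 (R : realType) (z : R * R) : 0 <= sqnorm z.
Proof. by rewrite /sqnorm addr_ge0// -expr2 sqr_ge0. Qed.

(** A lower bound of [mobius_den z w] uniform in w. It comes from 2 z.w <= |z|^2 + |w|^2 <= 1 +
    |z|^2, which gives 1 - z.w >= (1 - |z|^2) / 2. *)
Definition den_min (R : realType) (z : R * R) : R := (1 - sqnorm z) ^+ 2 / 4.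

Lemma den_min_gt0 (R : realType) (z : R * R) : disk z -> 0 < den_min z.
Proof. by move/disk_sqnorm => z1; rewrite divr_gt0// exprn_gt0// subr_gt0. Qed.

Lemma mobius_den_ge (R : realType) (z w : R * R) : disk z -> disk w ->
  den_min z <= mobius_den z w.
Proof.
move=> /disk_sqnorm z1 /disk_sqnorm w1; rewrite mobius_denE /den_min.
set s := z.1 * w.1 + z.2 * w.2.
have hs : 2 * s <= 1 + sqnorm z.
  have := sqr_ge0 (z.1 - w.1); have := sqr_ge0 (z.2 - w.2).
  by move: w1; rewrite /sqnorm /s; nra.
have h := sqr_ge0 (z.1 * w.2 - z.2 * w.1).
have : ((1 - sqnorm z) / 2) ^+ 2 <= (1 - s) ^+ 2.
  by rewrite lerXn2r ?nnegrE; lra.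
by rewrite expr_div_n; lra.
Qed.

Lemma mobius_den_gt0 (R : realType) (z w : R * R) : disk z -> disk w ->
  0 < mobius_den z w.
Proof. by move=> dz dw; apply: lt_le_trans (mobius_den_ge dz dw); exact: den_min_gt0. Qed.

Lemma mobius_num_lt (R : realType) (z w : R * R) : disk z -> disk w ->
  mobius_num z w < mobius_den z w.
Proof.
move=> /disk_sqnorm z1 /disk_sqnorm w1.
by rewrite -subr_gt0 mobius_denB mulr_gt0 ?subr_gt0.
Qed.

Lemma phdist2_ge0 (R : realType) (z w : R * R) : disk z -> disk w -> 0 <= phdist2 z w.
Proof. by move=> dz dw; rewrite divr_ge0 ?mobius_num_ge0 ?ltW ?mobius_den_gt0. Qed.

Lemma phdist2_lt1 (R : realType) (z w : R * R) : disk z -> disk w -> phdist2 z w < 1.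
Proof.
by move=> dz dw; rewrite ltr_pdivrMr ?mobius_den_gt0// mul1r mobius_num_lt.
Qed.

(** Quantifies how q_z tends to 1 at the unit circle; this is what makes the supports of the
    approximations compact. *)
Lemma onem_phdist2_le (R : realType) (z w : R * R) : disk z -> disk w ->
  1 - phdist2 z w <= (1 - sqnorm w) / den_min z.
Proof.
move=> dz dw; have D0 := mobius_den_gt0 dz dw.
have /disk_sqnorm z1 := dz; have /disk_sqnorm w1 := dw.
rewrite -[X in X - _](divff (lt0r_neq0 D0)) -mulrBl mobius_denB.
rewrite ler_pM ?invr_ge0 ?mulr_ge0 ?subr_ge0 ?(ltW D0) ?(ltW z1) ?(ltW w1)//.
  by rewrite ler_piMl ?subr_ge0 ?(ltW w1)// gerBl sqnorm_ge0.
by rewrite lef_pV2 ?posrE ?den_min_gt0// mobius_den_ge.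
Qed.

Lemma Ck_mobius_num (R : realType) k (U : set (R * R)) (z : R * R) :
  open U -> Ck k U (mobius_num z).
Proof.
move=> oU; have C1 := Ck_add oU (@Ck_fst R k U) (@Ck_cst _ _ _ k U (- z.1 : R)).
have C2 := Ck_add oU (@Ck_snd R k U) (@Ck_cst _ _ _ k U (- z.2 : R)).
exact: (Ck_add oU (Ck_mul oU C1 C1) (Ck_mul oU C2 C2)).
Qed.

Lemma Ck_mobius_den (R : realType) k (U : set (R * R)) (z : R * R) :
  open U -> Ck k U (mobius_den z).
Proof.
move=> oU; have C1 := Ck_mul oU (@Ck_cst _ _ _ k U (z.1 : R)) (@Ck_fst R k U).
have C2 := Ck_mul oU (@Ck_cst _ _ _ k U (z.2 : R)) (@Ck_snd R k U).
have C3 := Ck_mul oU (@Ck_cst _ _ _ k U (-2 : R)) (Ck_add oU C1 C2).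
have C4 := Ck_mul oU (@Ck_cst _ _ _ k U (sqnorm z : R)) (Ck_sqnorm k oU).
apply: Ck_ext (Ck_add oU (Ck_add oU (@Ck_cst _ _ _ k U (1 : R)) C3) C4) => // w _.
by rewrite mulNr.
Qed.

Lemma Ck_phdist2 (R : realType) k (z : R * R) : disk z -> Ck k disk (phdist2 z).
Proof.
move=> dz; have oD := @open_disk R.
have C := Ck_inv oD (fun w dw => lt0r_neq0 (mobius_den_gt0 dz dw)) (Ck_mobius_den k z oD).
exact: (Ck_mul oD (Ck_mobius_num k z oD) C).
Qed.

Lemma is_derive_mobius_num (R : realType) (e z w : R * R) :
  is_derive w e (mobius_num z) (dmobius_num e z w).
Proof.
have D1 := is_derive_subf (is_derive_fst w e) (is_derive_cstf z.1 w e).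
have D2 := is_derive_subf (is_derive_snd w e) (is_derive_cstf z.2 w e).
apply: (is_derive_eq (is_derive_addf (is_derive_mulf D1 D1) (is_derive_mulf D2 D2))).
by rewrite /dmobius_num; ring.
Qed.

Lemma is_derive_mobius_den (R : realType) (e z w : R * R) :
  is_derive w e (mobius_den z) (dmobius_den e z w).
Proof.
have D1 := is_derive_scalef z.1 (is_derive_fst w e).
have D2 := is_derive_scalef z.2 (is_derive_snd w e).
have D3 := is_derive_subf (is_derive_cstf 1 w e) (is_derive_scalef 2 (is_derive_addf D1 D2)).
have D4 := is_derive_addf (is_derive_mulf (is_derive_fst w e) (is_derive_fst w e))
  (is_derive_mulf (is_derive_snd w e) (is_derive_snd w e)).
apply: (is_derive_eq (is_derive_addf D3 (is_derive_scalef (sqnorm z) D4))).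
by rewrite /dmobius_den; ring.
Qed.

Lemma is_derive_phdist2 (R : realType) (e z w : R * R) : disk z -> disk w ->
  is_derive w e (phdist2 z) (dphdist2 e z w).
Proof.
move=> dz dw; have D0 := lt0r_neq0 (mobius_den_gt0 dz dw).
apply: (is_derive_eq (is_derive_mulf (is_derive_mobius_num e z w)
  (is_derive_invf D0 (is_derive_mobius_den e z w)))).
by rewrite /dphdist2; field.
Qed.

Local Opaque Ck test_function weak_gradient H1_norm dirichlet sobolev_H10.

(* With k = r^2, this is the function G_0^r o Phi_z of the disk. *)
Definition green (R : realType) (k : R) (z w : R * R) : R :=
  - 2^-1 * ln (Num.max k (phdist2 z w)).

Definition dgreen (R : realType) (e : R * R) (k : R) (z w : R * R) : R :=
  if k < phdist2 z w then - 2^-1 * dphdist2 e z w / phdist2 z w else 0.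

(** Writes max(k, q) as k + (q - k)^+ and smooths the positive part by [ramp]. *)
Definition green_core (R : realType) (eps k : R) (z w : R * R) : R :=
  - 2^-1 * ln (k + ramp eps (phdist2 z w - k)) + ln (1 - eps).

(* The shift by ln (1 - eps) makes the support compact. *)
Definition green_approx (R : realType) (eps k : R) (z w : R * R) : R :=
  ramp eps (green_core eps k z w).

Definition dgreen_approx (R : realType) (eps : R) (e : R * R) (k : R) (z w : R * R) : R :=
  dramp eps (green_core eps k z w) *
  (- 2^-1 * (dramp eps (phdist2 z w - k) * dphdist2 e z w / (k + ramp eps (phdist2 z w - k)))).

Lemma green_den_gt0 (R : realType) (eps k x : R) : 0 < k -> 0 < k + ramp eps x.
Proof. by move=> k0; rewrite ltr_pwDl// ramp_ge0. Qed.

Lemma is_derive_green_approx (R : realType) (eps : R) (e : R * R) (k : R) (z w : R * R) :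
  0 < eps -> 0 < k -> disk z -> disk w ->
  is_derive w e (green_approx eps k z) (dgreen_approx eps e k z w).
Proof.
move=> e0 k0 dz dw.
have D1 := is_derive_subf (is_derive_phdist2 e dz dw) (is_derive_cstf k w e).
have D2 := is_derive_addf (is_derive_cstf k w e) (is_derive_rampf e0 D1).
have D3 := is_derive_scalef (- 2^-1) (is_derive_lnf
  (f := fun w => k + ramp eps (phdist2 z w - k)) (green_den_gt0 eps (phdist2 z w - k) k0) D2).
have D4 := is_derive_rampf e0 (is_derive_addf D3 (is_derive_cstf (ln (1 - eps)) w e)).
by apply: (is_derive_eq D4); rewrite subr0 add0r addr0.
Qed.

Lemma test_green_approx (R : realType) (eps k : R) (z : R * R) :
  0 < eps -> eps < 1 -> 0 < k -> disk z -> test_function (green_approx eps k z).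
Proof.
move=> e0 e1 k0 dz; have dm0 := den_min_gt0 dz.
have z1 : sqnorm z < 1 by apply/disk_sqnorm.
(* Chosen so that |w|^2 > c forces 1 - q <= eps (1 - eps). Then k + ramp (q - k) >= q - eps >= (1 -
   eps)^2, so the shift ln (1 - eps) makes [green_core] nonpositive and the outer ramp vanishes. *)
pose c := 1 - eps * (1 - eps) * den_min z.
have c1 : c < 1 by rewrite gtrBl !mulr_gt0// subr_gt0.
have oD := @open_disk R.
apply: (test_functionI c1).
  move=> n; have C1 := Ck_add oD (Ck_phdist2 n dz) (@Ck_cst _ _ _ n disk (- k : R)).
  have C2 := Ck_add oD (@Ck_cst _ _ _ n disk (k : R)) (Ck_ramp e0 oD C1).
  have C3 := Ck_ln oD (fun w _ => green_den_gt0 eps (phdist2 z w - k) k0) C2.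
  have C4 := Ck_mul oD (@Ck_cst _ _ _ n disk (- 2^-1 : R)) C3.
  exact: (Ck_ramp e0 oD (Ck_add oD C4 (@Ck_cst _ _ _ n disk (ln (1 - eps) : R)))).
move=> w dw wc; rewrite /green_approx ramp0// /green_core.
have oe : 0 < 1 - eps by rewrite subr_gt0.
have q1 : 1 - phdist2 z w <= eps * (1 - eps).
  apply: le_trans (onem_phdist2_le dz dw) _.
  by rewrite ler_pdivrMr// /c in wc *; lra.
have le1 : (1 - eps) ^+ 2 <= k + ramp eps (phdist2 z w - k).
  by have := ramp_ge (phdist2 z w - k) e0; nra.
have : ln ((1 - eps) ^+ 2) <= ln (k + ramp eps (phdist2 z w - k)).
  by rewrite ler_ln ?posrE ?exprn_gt0 ?green_den_gt0.
by rewrite lnXn// mulr2n; lra.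
Qed.

(** With N and D the numerator and denominator of q, both derivatives are at most 4 in absolute
    value and 0 <= N < D, so the numerator of the quotient rule is at most 8 D. *)
Lemma dphdist2_bound (R : realType) (e z w : R * R) :
  e = dir_x \/ e = dir_y -> disk z -> disk w -> `|dphdist2 e z w| <= 8 / den_min z.
Proof.
move=> ee dz dw; have D0 := mobius_den_gt0 dz dw.
have [z1 z2] := disk_coord dz; have [w1 w2] := disk_coord dw.
have s1 : sqnorm z < 1 by apply/disk_sqnorm.
have s0 := sqnorm_ge0 z.
have b (s x y : R) : 0 <= s <= 1 -> `|x| < 1 -> `|y| < 1 -> `|2 * (s * x - y)| <= 4.
  rewrite !ltr_norml ler_norml => /andP[? ?] /andP[? ?] /andP[? ?]; nra.
have bN : `|dmobius_num e z w| <= 4.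
  rewrite /dmobius_num; case: ee => -> /=; rewrite ?mulr0 ?addr0 ?add0r mulr1.
    by rewrite -[w.1]mul1r b// ler01 lexx.
  by rewrite -[w.2]mul1r b// ler01 lexx.
have bD : `|dmobius_den e z w| <= 4.
  by rewrite /dmobius_den; case: ee => -> /=; rewrite ?mulr0 ?addr0 ?add0r mulr1 b// s0 ltW.
have N0 := mobius_num_ge0 z w; have ND := mobius_num_lt dz dw.
rewrite /dphdist2 normrM normfV normrX (gtr0_norm D0) ler_pdivrMr ?exprn_gt0//.
apply: (@le_trans _ _ (8 * mobius_den z w)).
  apply: le_trans (ler_normB _ _) _; rewrite !normrM (gtr0_norm D0) (ger0_norm N0).
  by have := normr_ge0 (dmobius_den e z w); nra.
rewrite expr2 -mulrA ler_wpM2l// mulrA -[leLHS]mul1r ler_wpM2r ?(ltW D0)//.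
by rewrite mulrC ler_pdivlMr ?den_min_gt0// mul1r mobius_den_ge.
Qed.

Lemma dgreen_approx_bound (R : realType) (eps : R) (e : R * R) (k : R) (z w : R * R) :
  0 < eps -> 0 < k -> e = dir_x \/ e = dir_y -> disk z -> disk w ->
  `|dgreen_approx eps e k z w| <= 4 / den_min z / k.
Proof.
move=> e0 k0 ee dz dw; have B := dphdist2_bound ee dz dw.
have g0 := green_den_gt0 eps (phdist2 z w - k) k0.
have r0 := ramp_ge0 eps (phdist2 z w - k).
have dm0 := den_min_gt0 dz.
rewrite /dgreen_approx; move: (dphdist2 e z w) B => d B.
rewrite !normrM normrN !normfV (gtr0_norm g0).
rewrite (ger0_norm (dramp_ge0 _ e0)) (ger0_norm (dramp_ge0 _ e0)) (@ger0_norm _ 2)//.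
have -> : 4 / den_min z / k = 1 * (2^-1 * (1 * (8 / den_min z) / k)) by field; rewrite !gt_eqF.
have kinv : (k + ramp eps (phdist2 z w - k))^-1 <= k^-1.
  by rewrite lef_pV2 ?posrE// lerDl.
by rewrite !ler_pM ?mulr_ge0 ?invr_ge0 ?dramp_ge0 ?dramp_le1 ?(ltW g0).
Qed.

Lemma green_approx_bound (R : realType) (eps k : R) (z w : R * R) :
  0 < eps -> eps < 1 -> 0 < k -> k < 1 -> disk z -> disk w ->
  `|green_approx eps k z w| <= - 2^-1 * ln k.
Proof.
move=> e0 e1 k0 k1 dz dw; rewrite ger0_norm ?ramp_ge0//.
apply: le_trans (ramp_le _ e0) _.
have lk : ln k <= 0 by rewrite ln_le0// ltW.
rewrite ge_max; apply/andP; split; first by lra.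
have l1 : ln (1 - eps) <= 0 by rewrite ln_le0// gerBl ltW.
have : ln k <= ln (k + ramp eps (phdist2 z w - k)).
  by rewrite ler_ln ?posrE ?lerDl ?ramp_ge0// green_den_gt0.
by rewrite /green_core; lra.
Qed.

(** The sequence starts at 1/2 so that eps < 1 throughout, as ln (1 - eps) requires. *)
Lemma eps_seq_gt0 (R : realType) n : 0 < n.+2%:R^-1 :> R.
Proof. by rewrite invr_gt0. Qed.

Lemma eps_seq_lt1 (R : realType) n : n.+2%:R^-1 < 1 :> R.
Proof. by rewrite invf_lt1// ltr1n. Qed.

Lemma cvg_eps_seq (R : realType) : (fun n => n.+2%:R^-1 : R) @ \oo --> (0 : R).
Proof. by have := @cvg_harmonic R; rewrite -(cvg_shiftS (@harmonic R)). Qed.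

Lemma cvg_green_core (R : realType) (k : R) (z w : R * R) : 0 < k ->
  green_core n.+2%:R^-1 k z w @[n --> \oo] --> green k z w.
Proof.
move=> k0; have ce := @cvg_eps_seq R; have e0 := @eps_seq_gt0 R.
rewrite /green_core -[green k z w]addr0; apply: cvgD; last first.
  rewrite -ln1; apply: (@continuous_cvg _ _ _ _ _ (fun n => 1 - n.+2%:R^-1 : R) (@ln R)).
    exact: continuous_ln.
  by rewrite -[X in _ --> X]subr0; apply: cvgB => //; exact: cvg_cst.
rewrite /green; apply: cvgM; first exact: cvg_cst.
have -> : Num.max k (phdist2 z w) = k + Num.max 0 (phdist2 z w - k).
  by rewrite addr_maxr addr0 addrC subrK.
apply: (@continuous_cvg _ _ _ _ _ (fun n => k + ramp n.+2%:R^-1 (phdist2 z w - k)) (@ln R)).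
  by apply: continuous_ln; rewrite ltr_pwDl// le_max lexx.
apply: cvgD; first exact: cvg_cst.
by apply: cvg_ramp => //; exact: cvg_cst.
Qed.

(** Strictness is what lets the derivative of the outer ramp tend to 1 in [cvg_dgreen_approx]. *)
Lemma green_gt0 (R : realType) (k : R) (z w : R * R) : 0 < k -> k < 1 ->
  disk z -> disk w -> 0 < green k z w.
Proof.
move=> k0 k1 dz dw; have : ln (Num.max k (phdist2 z w)) < 0.
  by rewrite ln_lt0// lt_max k0/= gt_max k1 phdist2_lt1.
by rewrite /green; lra.
Qed.

Lemma cvg_green_approx (R : realType) (k : R) (z w : R * R) : 0 < k -> k < 1 ->
  disk z -> disk w -> green_approx n.+2%:R^-1 k z w @[n --> \oo] --> green k z w.
Proof.
move=> k0 k1 dz dw; rewrite -[X in _ --> X](_ : Num.max 0 (green k z w) = _).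
  by apply: cvg_ramp; [exact: eps_seq_gt0|exact: cvg_eps_seq|exact: cvg_green_core].
by rewrite max_r// ltW// green_gt0.
Qed.

Lemma cvg_dgreen_approx (R : realType) (e : R * R) (k : R) (z w : R * R) :
  0 < k -> k < 1 -> disk z -> disk w ->
  dgreen_approx n.+2%:R^-1 e k z w @[n --> \oo] --> dgreen e k z w.
Proof.
move=> k0 k1 dz dw; have ce := @cvg_eps_seq R; have e0 := @eps_seq_gt0 R.
have q0 := phdist2_ge0 dz dw.
rewrite (_ : dgreen e k z w = 1 * (- 2^-1 * ((if 0 < phdist2 z w - k then 1 else 0) *
    dphdist2 e z w / (k + Num.max 0 (phdist2 z w - k))))); last first.
  rewrite /dgreen subr_gt0; case: ifPn => kq; last by rewrite !mul0r !mulr0.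
  rewrite max_r ?subr_ge0 ?(ltW kq)// addrCA subrr addr0 !mul1r !mulrA//.
apply: cvgM.
  have H := cvg_dramp e0 ce (cvg_green_core k0) (green_gt0 k0 k1 dz dw).
  exact: H.
apply: cvgM; first exact: cvg_cst.
apply: cvgM.
  by apply: cvgM; [exact: cvg_dramp_cst|exact: cvg_cst].
apply: cvgV; first by rewrite gt_eqF// ltr_pwDl// le_max lexx.
apply: cvgD; first exact: cvg_cst.
by apply: cvg_ramp => //; exact: cvg_cst.
Qed.

Lemma derive_green_approx (R : realType) (eps : R) (e : R * R) (k : R) (z w : R * R) :
  0 < eps -> 0 < k -> disk z -> disk w ->
  'D_e (green_approx eps k z) w = dgreen_approx eps e k z w.
Proof. by move=> e0 k0 dz dw; case: (is_derive_green_approx e e0 k0 dz dw). Qed.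

Lemma green_sobolev (R : realType) (k : R) (z : R * R) : 0 < k -> k < 1 -> disk z ->
  weak_gradient (green k z) (dgreen dir_x k z) (dgreen dir_y k z) /\ sobolev_H10 (green k z).
Proof.
move=> k0 k1 dz; have e0 := @eps_seq_gt0 R; have e1 := @eps_seq_lt1 R.
apply: (@bounded_limit_sobolev_H10 _ (Num.max (- 2^-1 * ln k) (4 / den_min z / k))
  (fun n => green_approx n.+2%:R^-1 k z)).
- by move=> n; exact: test_green_approx.
- move=> n w dw; rewrite !derive_green_approx//.
  split; rewrite le_max ?green_approx_bound// dgreen_approx_bound ?orbT//; [by left|by right].
- move=> w dw; split; first exact: cvg_green_approx.
    by under eq_fun do rewrite derive_green_approx//; exact: cvg_dgreen_approx.
  by under eq_fun do rewrite derive_green_approx//; exact: cvg_dgreen_approx.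
Qed.

(** * Energy of the truncated Green function *)

Lemma integral_by_parts_Ck1 (R : realType) (f phi : R * R -> R) (e : R * R) :
  e = dir_x \/ e = dir_y -> test_function phi -> Ck 1 disk f ->
  \int[leb2]_(z in disk) (f z * 'D_e phi z) = - \int[leb2]_(z in disk) ('D_e f z * phi z).
Proof.
move=> ee tphi C1; have [df cdf] : (forall z, disk z -> differentiable f z) /\
   forall v, Ck 0 disk ('D_v f) by exact: C1.
apply: integral_by_parts_disk => //.
- by move=> z dz; apply: derivableP; exact/diff_derivable/df.
- by move=> z dz; exact/differentiable_continuous/df.
- by move=> z dz; exact: Ck_continuous (cdf e) dz.
Qed.

(* A smooth vector field which, away from z, is the gradient of the Green
   function -ln |Phi_z| of the disk. *)
Definition green_field (R : realType) (eps t : R) (e z w : R * R) : R :=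
  - 2^-1 * (dmobius_num e z w / (mobius_num z w + ramp eps (t - mobius_num z w))) +
  2^-1 * (dmobius_den e z w / mobius_den z w).

Lemma green_field_den (R : realType) (eps t : R) (z w : R * R) : 0 < eps ->
  Num.max (mobius_num z w) (t - eps) <= mobius_num z w + ramp eps (t - mobius_num z w).
Proof.
move=> e0; rewrite ge_max lerDl ramp_ge0/=.
by have := ramp_ge (t - mobius_num z w) e0; lra.
Qed.

Lemma green_field_den_gt0 (R : realType) (eps t : R) (z w : R * R) :
  0 < eps -> eps < t -> 0 < mobius_num z w + ramp eps (t - mobius_num z w).
Proof.
move=> e0 et; apply: lt_le_trans (green_field_den t z w e0).
by rewrite lt_max subr_gt0 et orbT.
Qed.

Lemma Ck_affine (R : realType) n (U : set (R * R)) (a b c : R) : open U ->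
  Ck n U (fun w : R * R => a * w.1 + b * w.2 + c).
Proof.
move=> oU; exact: (Ck_add oU (Ck_add oU (Ck_mul oU (@Ck_cst _ _ _ n U (a : R)) (@Ck_fst R n U))
   (Ck_mul oU (@Ck_cst _ _ _ n U (b : R)) (@Ck_snd R n U))) (@Ck_cst _ _ _ n U (c : R))).
Qed.

Lemma is_derive_affine (R : realType) (a b c : R) (w e : R * R) :
  is_derive w e (fun w : R * R => a * w.1 + b * w.2 + c) (a * e.1 + b * e.2).
Proof.
apply: (is_derive_eq (is_derive_addf (is_derive_addf (is_derive_scalef a (is_derive_fst w e))
  (is_derive_scalef b (is_derive_snd w e))) (is_derive_cstf c w e))).
by rewrite addr0.
Qed.

Lemma dmobius_numE (R : realType) (e z : R * R) : dmobius_num e z =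
  fun w => 2 * e.1 * w.1 + 2 * e.2 * w.2 + - 2 * (z.1 * e.1 + z.2 * e.2).
Proof. by apply/funext => w; rewrite /dmobius_num; ring. Qed.

Lemma dmobius_denE (R : realType) (e z : R * R) : dmobius_den e z =
  fun w => 2 * sqnorm z * e.1 * w.1 + 2 * sqnorm z * e.2 * w.2 + - 2 * (z.1 * e.1 + z.2 * e.2).
Proof. by apply/funext => w; rewrite /dmobius_den; ring. Qed.

Lemma is_derive_dmobius_num (R : realType) (e z w : R * R) :
  is_derive w e (dmobius_num e z) (2 * (e.1 * e.1 + e.2 * e.2)).
Proof.
rewrite dmobius_numE; apply: (is_derive_eq (is_derive_affine _ _ _ w e)).
by ring.
Qed.

Lemma is_derive_dmobius_den (R : realType) (e z w : R * R) :
  is_derive w e (dmobius_den e z) (2 * sqnorm z * (e.1 * e.1 + e.2 * e.2)).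
Proof.
rewrite dmobius_denE; apply: (is_derive_eq (is_derive_affine _ _ _ w e)).
by ring.
Qed.

Definition dgreen_field (R : realType) (eps t : R) (e z w : R * R) : R :=
  let K := mobius_num z w + ramp eps (t - mobius_num z w) in
  let s := e.1 * e.1 + e.2 * e.2 in
  - (s * K - 2^-1 * dmobius_num e z w ^+ 2 * (1 - dramp eps (t - mobius_num z w))) / K ^+ 2 +
  (sqnorm z * s * mobius_den z w - 2^-1 * dmobius_den e z w ^+ 2) / mobius_den z w ^+ 2.

Lemma green_field_Ck1 (R : realType) (eps t : R) (e z : R * R) :
  0 < eps -> eps < t -> disk z -> Ck 1 disk (green_field eps t e z).
Proof.
move=> e0 et dz; have oD := @open_disk R.
have CN := Ck_mobius_num 1 z oD; have CD := Ck_mobius_den 1 z oD.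
have C1 := Ck_add oD (@Ck_cst _ _ _ 1 disk (t : R)) (Ck_mul oD (@Ck_cst _ _ _ 1 disk (-1 : R)) CN).
have C2 := Ck_add oD CN (Ck_ramp e0 oD C1).
have E w : t + -1 * mobius_num z w = t - mobius_num z w by rewrite mulN1r.
have C3 := Ck_inv oD (fun w _ => eq_rect_r (fun x => mobius_num z w + ramp eps x != 0)
  (lt0r_neq0 (green_field_den_gt0 z w e0 et)) (E w)) C2.
have C4 := Ck_inv oD (fun w dw => lt0r_neq0 (mobius_den_gt0 dz dw)) CD.
have C5 := Ck_affine 1 (2 * e.1) (2 * e.2) (- 2 * (z.1 * e.1 + z.2 * e.2)) oD.
have C6 := Ck_affine 1 (2 * sqnorm z * e.1) (2 * sqnorm z * e.2) (- 2 * (z.1 * e.1 + z.2 * e.2)) oD.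
have := Ck_add oD (Ck_mul oD (@Ck_cst _ _ _ 1 disk (- 2^-1 : R)) (Ck_mul oD C5 C3))
  (Ck_mul oD (@Ck_cst _ _ _ 1 disk (2^-1 : R)) (Ck_mul oD C6 C4)).
apply: Ck_ext => // w _.
by rewrite E /green_field dmobius_numE dmobius_denE.
Qed.

Lemma derive_green_field (R : realType) (eps t : R) (e z w : R * R) :
  0 < eps -> eps < t -> disk z -> disk w ->
  'D_e (green_field eps t e z) w = dgreen_field eps t e z w.
Proof.
move=> e0 et dz dw; have K0 := lt0r_neq0 (green_field_den_gt0 z w e0 et).
have D0 := lt0r_neq0 (mobius_den_gt0 dz dw).
have DN := is_derive_mobius_num e z w; have DD := is_derive_mobius_den e z w.
have DK := is_derive_addf DN (is_derive_rampf e0 (is_derive_subf (is_derive_cstf t w e) DN)).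
have D1 := is_derive_mulf (is_derive_dmobius_num e z w)
  (is_derive_invf (f := fun w => mobius_num z w + ramp eps (t - mobius_num z w)) K0 DK).
have D2 := is_derive_mulf (is_derive_dmobius_den e z w) (is_derive_invf D0 DD).
have := is_derive_addf (is_derive_scalef (- 2^-1) D1) (is_derive_scalef 2^-1 D2).
move=> -[_ ->].
rewrite /dgreen_field.
move: (dmobius_num e z w) (dmobius_den e z w) K0 D0 => dN dD.
move: (ramp eps (t - mobius_num z w)) (dramp eps (t - mobius_num z w)) => r dr.
move: (mobius_num z w) (mobius_den z w) => N D K0 D0.
by field; rewrite ?D0 ?K0.
Qed.

Lemma dmobius_num_sqr (R : realType) (z w : R * R) :
  dmobius_num dir_x z w ^+ 2 + dmobius_num dir_y z w ^+ 2 = 4 * mobius_num z w.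
Proof. by rewrite /dmobius_num /mobius_num /=; ring. Qed.

Lemma dmobius_den_sqr (R : realType) (z w : R * R) :
  dmobius_den dir_x z w ^+ 2 + dmobius_den dir_y z w ^+ 2 = 4 * sqnorm z * mobius_den z w.
Proof. by rewrite /dmobius_den /mobius_den /sqnorm /=; ring. Qed.

(* ln (mobius_den z) is harmonic, so only the first term of the field contributes. *)
Lemma div_green_field (R : realType) (eps t : R) (z w : R * R) :
  0 < eps -> eps < t -> disk z -> disk w ->
  let K := mobius_num z w + ramp eps (t - mobius_num z w) in
  dgreen_field eps t dir_x z w + dgreen_field eps t dir_y z w =
  - 2 * (K - mobius_num z w * (1 - dramp eps (t - mobius_num z w))) / K ^+ 2.
Proof.
move=> e0 et dz dw K; have K0 : K != 0 by exact: lt0r_neq0 (green_field_den_gt0 z w e0 et).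
have D0 := lt0r_neq0 (mobius_den_gt0 dz dw).
rewrite /dgreen_field -/K.
have sx : (@dir_x R).1 * dir_x.1 + (@dir_x R).2 * dir_x.2 = 1 by rewrite /=; ring.
have sy : (@dir_y R).1 * dir_y.1 + (@dir_y R).2 * dir_y.2 = 1 by rewrite /=; ring.
rewrite sx sy.
have EN := dmobius_num_sqr z w; have ED := dmobius_den_sqr z w.
move: EN ED K0 D0.
move: (dmobius_num _ z w ^+ 2) (dmobius_num _ z w ^+ 2) (dmobius_den _ z w ^+ 2) (dmobius_den _ z w ^+ 2).
move: K (dramp eps (t - mobius_num z w)) (mobius_num z w) (mobius_den z w) (sqnorm z).
move=> K dr N D s nx ny dx dy EN ED K0 D0.
have -> : nx = 4 * N - ny by rewrite -EN; ring.
have -> : dx = 4 * s * D - dy by rewrite -ED; ring.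
by field; rewrite ?D0 ?K0.
Qed.

Lemma dmobius_bounds (R : realType) (e z w : R * R) :
  e = dir_x \/ e = dir_y -> disk z -> disk w ->
  `|dmobius_num e z w| <= 4 /\ `|dmobius_den e z w| <= 4.
Proof.
move=> ee dz dw.
have [z1 z2] := disk_coord dz; have [w1 w2] := disk_coord dw.
have s1 : sqnorm z < 1 by apply/disk_sqnorm.
have s0 := sqnorm_ge0 z.
have b (s x y : R) : 0 <= s <= 1 -> `|x| < 1 -> `|y| < 1 -> `|2 * (s * x - y)| <= 4.
  rewrite !ltr_norml ler_norml => /andP[? ?] /andP[? ?] /andP[? ?]; nra.
split.
  rewrite /dmobius_num; case: ee => -> /=; rewrite ?mulr0 ?addr0 ?add0r mulr1.
    by rewrite -[w.1]mul1r b// ler01 lexx.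
  by rewrite -[w.2]mul1r b// ler01 lexx.
by rewrite /dmobius_den; case: ee => -> /=; rewrite ?mulr0 ?addr0 ?add0r mulr1 b// s0 ltW.
Qed.

(* The limit of green_field as eps -> 0. *)
Definition green_field0 (R : realType) (t : R) (e z w : R * R) : R :=
  - 2^-1 * (dmobius_num e z w / Num.max (mobius_num z w) t) +
  2^-1 * (dmobius_den e z w / mobius_den z w).

Lemma green_field_bound (R : realType) (eps t : R) (e z w : R * R) :
  0 < eps -> eps <= t / 2 -> e = dir_x \/ e = dir_y -> disk z -> disk w ->
  `|green_field eps t e z w| <= 4 / t + 2 / den_min z.
Proof.
move=> e0 et ee dz dw; have [bN bD] := dmobius_bounds ee dz dw.
have t0 : 0 < t by lra.
have D0 := mobius_den_gt0 dz dw; have K0 : 0 < mobius_num z w + ramp eps (t - mobius_num z w).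
  by apply: green_field_den_gt0 => //; lra.
have Kt : t / 2 <= mobius_num z w + ramp eps (t - mobius_num z w).
  by apply: le_trans (green_field_den t z w e0); rewrite le_max; apply/orP; right; lra.
have Ki : (mobius_num z w + ramp eps (t - mobius_num z w))^-1 <= 2 / t.
  by rewrite -[2 / t]invf_div lef_pV2 ?posrE// divr_gt0.
have Di : (mobius_den z w)^-1 <= (den_min z)^-1.
  by rewrite lef_pV2 ?posrE ?den_min_gt0// mobius_den_ge.
rewrite /green_field.
move: (dmobius_num e z w) (dmobius_den e z w) bN bD => dN dD bN bD.
move: (mobius_num z w + _) (mobius_den z w) K0 D0 Kt Ki Di => K D K0 D0 Kt Ki Di.
apply: le_trans (ler_normD _ _) _; rewrite !normrM normrN !normfV (gtr0_norm K0) (gtr0_norm D0) (@ger0_norm _ 2)//.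
have -> : 4 / t + 2 / den_min z = 2^-1 * (4 * (2 / t)) + 2^-1 * (4 * (den_min z)^-1).
  by field; rewrite !gt_eqF// den_min_gt0.
by rewrite lerD// ler_wpM2l ?invr_ge0// ler_pM ?invr_ge0// ltW.
Qed.

Lemma div_green_field_bound (R : realType) (eps t : R) (z w : R * R) :
  0 < eps -> eps <= t / 2 -> disk z -> disk w ->
  `|dgreen_field eps t dir_x z w + dgreen_field eps t dir_y z w| <= 4 / t.
Proof.
move=> e0 et dz dw; have t0 : 0 < t by lra.
rewrite div_green_field//; last by lra.
have K0 : 0 < mobius_num z w + ramp eps (t - mobius_num z w).
  by apply: green_field_den_gt0 => //; lra.
have Kt : t / 2 <= mobius_num z w + ramp eps (t - mobius_num z w).
  by apply: le_trans (green_field_den t z w e0); rewrite le_max; apply/orP; right; lra.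
have KN : mobius_num z w <= mobius_num z w + ramp eps (t - mobius_num z w).
  by rewrite lerDl ramp_ge0.
have d0 := dramp_ge0 (t - mobius_num z w) e0; have d1 := dramp_le1 (t - mobius_num z w) e0.
have N0 := mobius_num_ge0 z w.
move: (mobius_num z w + _) (dramp eps _) d0 d1 K0 Kt KN => K d d0 d1 K0 Kt KN.
move: (mobius_num z w) KN N0 => N KN N0.
have h : 0 <= K - N * (1 - d) <= K by apply/andP; split; nra.
rewrite normrM normfV normrX (gtr0_norm K0) normrM normrN (@ger0_norm _ 2)//.
rewrite ger0_norm; last by case/andP: h.
rewrite ler_pdivrMr ?exprn_gt0//; apply: (@le_trans _ _ (2 * K)).
  by rewrite ler_wpM2l//; case/andP: h.
rewrite expr2 mulrA ler_wpM2r ?(ltW K0)// -ler_pdivrMl ?divr_gt0//.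
by rewrite invf_div; lra.
Qed.

(** Dividing by n + 2 ensures eps <= t / 2, which keeps the regularized denominator above t / 2
    uniformly in n. *)
Definition field_eps (R : realType) (t : R) (n : nat) : R := t / n.+2%:R.

Lemma field_eps_gt0 (R : realType) (t : R) n : 0 < t -> 0 < field_eps t n.
Proof. by move=> t0; rewrite divr_gt0. Qed.

Lemma field_eps_le (R : realType) (t : R) n : 0 < t -> field_eps t n <= t / 2.
Proof. by move=> t0; rewrite ler_wpM2l ?(ltW t0)// lef_pV2 ?posrE// ler_nat. Qed.

Lemma cvg_field_eps (R : realType) (t : R) : field_eps t n @[n --> \oo] --> (0 : R).
Proof. by rewrite -(mulr0 t); apply: cvgM; [exact: cvg_cst|exact: cvg_eps_seq]. Qed.

Lemma cvg_field_den (R : realType) (t : R) (z w : R * R) : 0 < t ->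
  mobius_num z w + ramp (field_eps t n) (t - mobius_num z w) @[n --> \oo] -->
  Num.max (mobius_num z w) t.
Proof.
move=> t0; have -> : Num.max (mobius_num z w) t = mobius_num z w + Num.max 0 (t - mobius_num z w).
  by rewrite addr_maxr addr0 addrC subrK.
apply: cvgD; first exact: cvg_cst.
have e0 n := field_eps_gt0 n t0.
by apply: (cvg_ramp e0 (@cvg_field_eps R t) (x := fun=> t - mobius_num z w)); exact: cvg_cst.
Qed.

Lemma cvg_green_field (R : realType) (t : R) (e z w : R * R) : 0 < t ->
  green_field (field_eps t n) t e z w @[n --> \oo] --> green_field0 t e z w.
Proof.
move=> t0; apply: cvgD; last exact: cvg_cst.
apply: cvgM; first exact: cvg_cst.
apply: cvgM; first exact: cvg_cst.
by apply: cvgV; [rewrite gt_eqF// lt_max t0 orbT|exact: cvg_field_den].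
Qed.

(** The limit is a mollified Dirac mass: it equals -2/t on a Euclidean disk of area pi t, for a
    total of -2 pi, as expected from the Laplacian of -ln |w - z|. *)
Lemma cvg_div_green_field (R : realType) (t : R) (z w : R * R) : 0 < t ->
  disk z -> disk w ->
  dgreen_field (field_eps t n) t dir_x z w + dgreen_field (field_eps t n) t dir_y z w
    @[n --> \oo] --> (if mobius_num z w < t then - (2 / t) else 0 : R).
Proof.
move=> t0 dz dw; have e0 n := field_eps_gt0 n t0.
have et n : field_eps t n < t by apply: le_lt_trans (field_eps_le n t0) _; lra.
under eq_fun do rewrite div_green_field//.
have -> : (if mobius_num z w < t then - (2 / t) else 0) = - 2 * (Num.max (mobius_num z w) t -
    mobius_num z w * (1 - (if 0 < t - mobius_num z w then 1 else 0))) / Num.max (mobius_num z w) t ^+ 2.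
  rewrite subr_gt0; case: ifPn => [Nt|]; first by rewrite max_r ?(ltW Nt)//; field; rewrite gt_eqF.
  by rewrite -leNgt => Nt; rewrite max_l// subr0 mulr1 subrr mulr0 mul0r.
have m0 : Num.max (mobius_num z w) t != 0 by rewrite gt_eqF// lt_max t0 orbT.
have cK := @cvg_field_den R t z w t0.
apply: cvgM; last by apply: cvgV; [rewrite expf_neq0|rewrite expr2; apply: cvgM].
apply: cvgM; first exact: cvg_cst.
apply: cvgB => //; apply: cvgM; first exact: cvg_cst.
apply: cvgB; first exact: cvg_cst.
exact: cvg_dramp_cst e0 (@cvg_field_eps R t).
Qed.

(** With h = (1 - |z|^2) / 2 and |w - z| < h, the inequality 2 z.(w - z) <= h |z|^2 + |w - z|^2 / h
    yields |w|^2 < (1 + h) (1 - 2 h) + h^2 + h = 1 - h^2. *)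
Lemma mobius_num_small (R : realType) (z w : R * R) : disk z ->
  mobius_num z w < den_min z -> disk w.
Proof.
move=> /disk_sqnorm z1 Nw; apply/disk_sqnorm.
have [h [h0 hE dmE]] : exists h : R, [/\ 0 < h, sqnorm z = 1 - 2 * h & den_min z = h ^+ 2].
  exists ((1 - sqnorm z) / 2); split; [lra|lra|].
  by rewrite /den_min expr_div_n; congr (_ / _); ring.
rewrite dmE in Nw.
have wE : sqnorm w = sqnorm z + 2 * (z.1 * (w.1 - z.1) + z.2 * (w.2 - z.2)) + mobius_num z w.
  by rewrite /sqnorm /mobius_num; ring.
have cs : 2 * (z.1 * (w.1 - z.1) + z.2 * (w.2 - z.2)) <= h * sqnorm z + mobius_num z w / h.
  rewrite -subr_ge0 (_ : _ - _ = ((h * z.1 - (w.1 - z.1)) ^+ 2 +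
      (h * z.2 - (w.2 - z.2)) ^+ 2) / h).
    by rewrite divr_ge0 ?addr_ge0 ?sqr_ge0// ltW.
  by rewrite /sqnorm /mobius_num; field; rewrite gt_eqF.
have Nh : mobius_num z w / h < h by rewrite ltr_pdivrMr// -expr2.
by rewrite wE hE in cs *; nra.
Qed.

Lemma measurable_green_field (R : realType) (eps t : R) (e z : R * R) :
  0 < eps -> eps < t -> disk z ->
  measurable_fun (disk : set (plane R)) (green_field eps t e z).
Proof.
move=> e0 et dz; apply: continuous_measurable_plane; first exact: open_disk.
by move=> w dw; exact: Ck_continuous (green_field_Ck1 e e0 et dz) dw.
Qed.

Lemma measurable_derive_green_field (R : realType) (eps t : R) (e z : R * R) :
  0 < eps -> eps < t -> disk z ->
  measurable_fun (disk : set (plane R)) ('D_e (green_field eps t e z)).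
Proof.
move=> e0 et dz; apply: continuous_measurable_plane; first exact: open_disk.
have [_ C] : (forall w, disk w -> differentiable (green_field eps t e z) w) /\
   forall v, Ck 0 disk ('D_v (green_field eps t e z)) by exact: (green_field_Ck1 e e0 et dz).
by move=> w dw; exact: Ck_continuous (C e) dw.
Qed.

Lemma bounded_integrable_mul (R : realType) (f g : plane R -> R) (A B : R) :
  measurable_fun (disk : set (plane R)) f -> measurable_fun (disk : set (plane R)) g ->
  (forall z, disk z -> `|f z| <= A) -> (forall z, disk z -> `|g z| <= B) ->
  leb2.-integrable disk (EFin \o (fun z => f z * g z)).
Proof.
move=> mf mg fA gB; apply: (@bounded_integrable_disk _ _ (A * B)).
  exact: measurable_funM.
by move=> z dz; rewrite normrM ler_pM ?fA ?gB.
Qed.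

Lemma green_field_weak (R : realType) (eps t : R) (z : R * R) (phi : R * R -> R) :
  0 < eps -> eps <= t / 2 -> disk z -> test_function phi ->
  \int[leb2]_(w in disk) (green_field eps t dir_x z w * 'D_dir_x phi w +
     green_field eps t dir_y z w * 'D_dir_y phi w) =
  - \int[leb2]_(w in disk)
     ((dgreen_field eps t dir_x z w + dgreen_field eps t dir_y z w) * phi w).
Proof.
move=> e0 et dz tphi; have et' : eps < t by lra.
have mD := @measurable_disk R.
have [Mx Hx] := test_function_bounded dir_x tphi.
have [My Hy] := test_function_bounded dir_y tphi.
have mphi := measurable_test_function tphi.
have int e : e = dir_x \/ e = dir_y ->
    leb2.-integrable disk (EFin \o (fun w => green_field eps t e z w * 'D_e phi w)).
  move=> ee; have [M H] := test_function_bounded e tphi.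
  apply: (@bounded_integrable_mul _ _ _ (4 / t + 2 / den_min z) M).
  - exact: measurable_green_field.
  - exact: measurable_derive_test_function.
  - by move=> w dw; exact: green_field_bound.
  - by move=> w /H[].
rewrite RintegralD//; [|by apply: int; left|by apply: int; right].
rewrite (integral_by_parts_Ck1 (or_introl erefl) tphi (green_field_Ck1 dir_x e0 et' dz)).
rewrite (integral_by_parts_Ck1 (or_intror erefl) tphi (green_field_Ck1 dir_y e0 et' dz)).
have cint e : e = dir_x \/ e = dir_y ->
    leb2.-integrable disk (EFin \o (fun w => 'D_e (green_field eps t e z) w * phi w)).
  move=> ee; have [K [cK Kd [cphi _ _ phi0 _]]] := test_function_derive e tphi.
  have [_ C] : (forall w, disk w -> differentiable (green_field eps t e z) w) /\
     forall v, Ck 0 disk ('D_v (green_field eps t e z)) by exact: (green_field_Ck1 e e0 et' dz).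
  have c w : disk w -> {for w, continuous (fun w => 'D_e (green_field eps t e z) w * phi w)}.
    by move=> dw; apply: cvgM; [exact: Ck_continuous (C e) dw|exact: cphi].
  have c0 w : disk w -> ~ K w -> 'D_e (green_field eps t e z) w * phi w = 0.
    by move=> dw nK; rewrite phi0// mulr0.
  have [M HM] := compact_support_bounded cK Kd c c0.
  by apply: bounded_integrable_disk HM; exact: continuous_measurable_plane (@open_disk R) c.
rewrite -opprD -RintegralD//; [|by apply: cint; left|by apply: cint; right].
congr (- _); apply: eq_Rintegral => w /set_mem dw.
by rewrite -mulrDl !derive_green_field.
Qed.

(** Outside the small disk and above the truncation level, both sides are the gradient of -1/2 ln
    q. *)
Lemma dgreenE (R : realType) (e : R * R) (k t : R) (z w : R * R) : 0 < k ->
  t <= mobius_num z w -> disk z -> disk w -> k < phdist2 z w ->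
  green_field0 t e z w = dgreen e k z w.
Proof.
move=> k0 tN dz dw kq; rewrite /green_field0 /dgreen kq max_l//.
have D0 := lt0r_neq0 (mobius_den_gt0 dz dw).
have q0 : phdist2 z w != 0 by rewrite gt_eqF// (lt_trans k0).
have N0 : mobius_num z w != 0.
  by apply: contra_neq q0; rewrite /phdist2 => ->; rewrite mul0r.
by rewrite /dphdist2 /phdist2; field; rewrite N0 D0.
Qed.

Lemma phdist2_le_num (R : realType) (k : R) (z w : R * R) : disk z -> disk w ->
  0 < k -> mobius_num z w < k * den_min z -> phdist2 z w < k.
Proof.
move=> dz dw k0 Nt; rewrite ltr_pdivrMr ?mobius_den_gt0//.
by apply: lt_le_trans Nt _; rewrite ler_wpM2l ?(ltW k0)// mobius_den_ge.
Qed.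

Lemma green_const (R : realType) (k : R) (z w : R * R) : phdist2 z w <= k ->
  green k z w = - 2^-1 * ln k.
Proof. by move=> qk; rewrite /green max_l. Qed.

Lemma measurable_mobius_num_lt (R : realType) (t : R) (z : R * R) :
  measurable ([set w | mobius_num z w < t] : set (plane R)).
Proof.
apply: open_measurable_plane.
apply: (@open_comp _ _ (mobius_num z) [set x | x < t]); last exact: open_lt.
by move=> w _; exact: (Ck_continuous (Ck_mobius_num 0 z openT) (z := w) I).
Qed.

Lemma leb2_mobius_num (R : realType) (t : R) (z : R * R) : 0 < t ->
  leb2 ([set w | mobius_num z w < t] : set (plane R)) = (pi * t)%:E.
Proof.
move=> t0; have -> : [set w | mobius_num z w < t] =
    [set w | (w.1 - z.1) ^+ 2 + (w.2 - z.2) ^+ 2 < Num.sqrt t ^+ 2].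
  by rewrite sqr_sqrtr ?ltW// /mobius_num; apply/seteqP; split => w /=; rewrite !expr2.
by rewrite leb2_ball ?sqrtr_gt0// sqr_sqrtr ?ltW.
Qed.

Lemma ler_norm_mul2 (R : realType) (a b c d A B : R) :
  `|a| <= A -> `|b| <= B -> `|c| <= A -> `|d| <= B -> `|a * b + c * d| <= A * B + A * B.
Proof.
move=> aA bB cA dB; apply: le_trans (ler_normD _ _) _.
by rewrite !normrM lerD// ler_pM.
Qed.

(* Integrating green_field by parts against the truncated Green function leaves the
   mean of the latter over a small disk around z, where it is constant. *)
Lemma green_energy (R : realType) (k : R) (z : R * R) : 0 < k -> k < 1 -> disk z ->
  \int[leb2]_(w in disk) (dgreen dir_x k z w ^+ 2 + dgreen dir_y k z w ^+ 2) = - pi * ln k.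
Proof.
move=> k0 k1 dz; have dm0 := den_min_gt0 dz.
(* This t places the disk |w - z|^2 < t inside the unit disk and inside the region q <= k, where the
   truncated function is the constant -1/2 ln k. *)
pose t := k * den_min z; have t0 : 0 < t by rewrite mulr_gt0.
have mD := @measurable_disk R.
have e0 n := field_eps_gt0 n t0; have e2 n := field_eps_le n t0.
have et n : field_eps t n < t by apply: le_lt_trans (e2 n) _; lra.
have f0 := @eps_seq_gt0 R; have f1 := @eps_seq_lt1 R.
pose phi n := green_approx n.+2%:R^-1 k z.
have tphi n : test_function (phi n) by exact: test_green_approx.
pose A := 4 / t + 2 / den_min z; pose B := 4 / den_min z / k; pose C := - 2^-1 * ln k.
have bphi n e w : e = dir_x \/ e = dir_y -> disk w -> `|'D_e (phi n) w| <= B.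
  by move=> ee dw; rewrite derive_green_approx// dgreen_approx_bound.
(* The field and the test function are both regularized along the same n, and each side of the
   integration by parts passes to the limit at once. *)
have [|||_ _ H1] := @Rintegral_dct_disk R
  (fun n w => green_field (field_eps t n) t dir_x z w * 'D_dir_x (phi n) w +
     green_field (field_eps t n) t dir_y z w * 'D_dir_y (phi n) w)
  (fun w => green_field0 t dir_x z w * dgreen dir_x k z w +
     green_field0 t dir_y z w * dgreen dir_y k z w) (A * B + A * B).
- move=> n; apply: measurable_funD; apply: measurable_funM;
    [exact: measurable_green_field|exact: measurable_derive_test_function|
     exact: measurable_green_field|exact: measurable_derive_test_function].
- move=> n w dw; apply: ler_norm_mul2.
  + by apply: green_field_bound => //; left.
  + by apply: bphi => //; left.
  + by apply: green_field_bound => //; right.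
  + by apply: bphi => //; right.
- move=> w dw; apply: cvgD; apply: cvgM; try exact: cvg_green_field.
    by under eq_fun do rewrite derive_green_approx//; exact: cvg_dgreen_approx.
  by under eq_fun do rewrite derive_green_approx//; exact: cvg_dgreen_approx.
have [|||_ _ H2] := @Rintegral_dct_disk R
  (fun n w => (dgreen_field (field_eps t n) t dir_x z w + dgreen_field (field_eps t n) t dir_y z w) * phi n w)
  (fun w => (if mobius_num z w < t then - (2 / t) else 0) * green k z w) (4 / t * C).
- move=> n; apply: measurable_funM; last exact: measurable_test_function.
  apply: (eq_measurable_fun (fun w => 'D_dir_x (green_field (field_eps t n) t dir_x z) w +
     'D_dir_y (green_field (field_eps t n) t dir_y z) w)).
    by move=> w /set_mem dw; rewrite !derive_green_field.
  by apply: measurable_funD; exact: measurable_derive_green_field.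
- move=> n w dw; rewrite normrM ler_pM//; first exact: div_green_field_bound.
  exact: green_approx_bound.
- by move=> w dw; apply: cvgM; [exact: cvg_div_green_field|exact: cvg_green_approx].
have E : \int[leb2]_(w in disk) (green_field0 t dir_x z w * dgreen dir_x k z w +
     green_field0 t dir_y z w * dgreen dir_y k z w) =
    - \int[leb2]_(w in disk) ((if mobius_num z w < t then - (2 / t) else 0) * green k z w).
  rewrite -(cvg_lim _ H1)//; apply: cvg_lim => //.
  under eq_fun do rewrite green_field_weak//.
  exact: cvgN.
transitivity (\int[leb2]_(w in disk) (green_field0 t dir_x z w * dgreen dir_x k z w +
     green_field0 t dir_y z w * dgreen dir_y k z w)).
  apply: eq_Rintegral => w /set_mem dw; rewrite !expr2.
  have [kq|qk] := ltP k (phdist2 z w); last first.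
    by rewrite /dgreen ltNge qk/= !mulr0.
  have tN : t <= mobius_num z w.
    rewrite leNgt; apply/negP => Nt; have := phdist2_le_num dz dw k0 Nt.
    by move=> /(lt_trans kq); rewrite ltxx.
  by rewrite !(dgreenE _ k0 tN dz dw kq).
rewrite E.
transitivity (- \int[leb2]_(w in disk) ((ln k / t) * \1_[set w | mobius_num z w < t] w)).
  congr (- _); apply: eq_Rintegral => w /set_mem dw; rewrite indicE.
  case: ifPn => Nt; last by rewrite memNset ?mul0r ?mulr0//; exact/negP.
  rewrite mem_set// green_const; first by rewrite /= mulr1; field; rewrite gt_eqF.
  exact/ltW/(phdist2_le_num dz dw k0 Nt).
have mN := measurable_mobius_num_lt t z.
have i1 : leb2.-integrable disk (EFin \o (fun w : plane R => \1_[set w | mobius_num z w < t] w : R)).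
  apply: (@bounded_integrable_disk _ _ 1); first exact: measurable_indic.
  by move=> w _; exact: indicR01.
rewrite RintegralZl//.
have -> : \int[leb2]_(w in disk) (\1_[set w | mobius_num z w < t] w) = pi * t.
  rewrite /Rintegral integral_indic// setIidl ?leb2_mobius_num//.
  move=> w /= Nt; apply: (mobius_num_small dz); apply: lt_le_trans Nt _.
  by rewrite /t ler_piMl// ltW.
by field; rewrite gt_eqF.
Qed.

Definition green_density (R : realType) (k : R) (z w : R * R) : R :=
  dgreen dir_x k z w ^+ 2 + dgreen dir_y k z w ^+ 2.

Lemma green_density_ge0 (R : realType) (k : R) (z w : R * R) : 0 <= green_density k z w.
Proof. by rewrite addr_ge0 ?sqr_ge0. Qed.

Lemma green_density_large (R : realType) (k m : R) (z w : R * R) :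
  k < phdist2 z w -> m < phdist2 z w -> green_density k z w = green_density m z w.
Proof. by move=> kq mq; rewrite /green_density /dgreen kq mq. Qed.

Lemma green_density0 (R : realType) (k : R) (z w : R * R) :
  phdist2 z w <= k -> green_density k z w = 0.
Proof. by move=> qk; rewrite /green_density /dgreen ltNge qk/= expr0n/= addr0. Qed.

Lemma green_density_mono (R : realType) (k m : R) (z w : R * R) :
  k <= m -> green_density m z w <= green_density k z w.
Proof.
move=> km; have [mq|qm] := ltP m (phdist2 z w).
  by rewrite (@green_density_large _ k m)// (le_lt_trans km).
by rewrite (green_density0 qm) green_density_ge0.
Qed.

(** Where neither function is truncated the gradients coincide, and elsewhere one of them is 0: the
    product is the energy density at level max k m. *)
Lemma dirichlet_green (R : realType) (k m : R) (z : R * R) :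
  0 < k -> k < 1 -> 0 < m -> m < 1 -> disk z ->
  dirichlet (green k z) (green m z) = - 2^-1 * ln (Num.max k m).
Proof.
move=> k0 k1 m0 m1 dz; have [gk _] := green_sobolev k0 k1 dz.
have [gm _] := green_sobolev m0 m1 dz.
rewrite (dirichletE gk gm).
have M0 : 0 < Num.max k m by rewrite lt_max k0.
have M1 : Num.max k m < 1 by rewrite gt_max k1.
transitivity ((2 * pi)^-1 * (- pi * ln (Num.max k m))); last first.
  by move: (@pi R) (lt0r_neq0 (pi_gt0 R)) => p p0; field.
rewrite -(green_energy M0 M1 dz); congr (_ * _).
apply: eq_Rintegral => w _; rewrite /dgreen gt_max.
by case: ifPn => kq; case: ifPn => mq; rewrite ?mul0r ?mulr0 ?expr0n//= !expr2.
Qed.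

Lemma integrable_green_density (R : realType) (k : R) (z : R * R) :
  0 < k -> k < 1 -> disk z ->
  leb2.-integrable disk (EFin \o (green_density k z : plane R -> R)).
Proof.
move=> k0 k1 dz; have [[_ [gx _] [gy _]] _] := green_sobolev k0 k1 dz.
move/square_integrableP : gx => [_ ix]; move/square_integrableP : gy => [_ iy].
have mD := @measurable_disk R.
exact: (integrableD mD ix iy).
Qed.

Lemma green_density_ge1 (R : realType) (m : R) (z w : R * R) : 1 <= m ->
  disk z -> disk w -> green_density m z w = 0.
Proof. by move=> m1 dz dw; rewrite green_density0// (le_trans _ m1)// ltW// phdist2_lt1. Qed.

(** The energy carried by the annulus k < q <= m is pi (ln m - ln k) for m < 1, and ln (1 + x) <= x
    concludes. The case m >= 1 must be allowed since m will be a level enlarged by an error term;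
    the density at level m is then 0 on the disk. *)
Lemma integral_green_density_diff (R : realType) (k m : R) (z : R * R) :
  0 < k -> k < 1 -> k <= m -> disk z ->
  leb2.-integrable disk (EFin \o (fun w : plane R => green_density k z w - green_density m z w)) /\
  \int[leb2]_(w in disk) (green_density k z w - green_density m z w) <= pi * ((m - k) / k).
Proof.
move=> k0 k1 km dz; have mD := @measurable_disk R.
have ik := integrable_green_density k0 k1 dz.
have m0 : 0 < m by apply: lt_le_trans km.
have lmk : ln m - ln k <= (m - k) / k.
  rewrite -ln_div ?posrE//; have -> : m / k = 1 + (m - k) / k by field; rewrite gt_eqF.
  apply: le_ln1Dx; apply: (@lt_le_trans _ _ 0) => //.
  by rewrite divr_ge0 ?subr_ge0// ltW.
have [m1|m1] := ltP m 1.
  have im := integrable_green_density m0 m1 dz.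
  split; first exact: (integrableB mD ik im).
  rewrite RintegralB// (green_energy k0 k1 dz) (green_energy m0 m1 dz).
  rewrite (_ : _ - _ = pi * (ln m - ln k)); last by move: (@pi R) => p; ring.
  by rewrite ler_wpM2l ?pi_ge0.
have E w : disk w -> green_density k z w - green_density m z w = green_density k z w.
  by move=> dw; rewrite (green_density_ge1 m1 dz dw) subr0.
split.
  by apply: eq_integrable ik => // w /set_mem dw /=; rewrite E.
have -> : \int[leb2]_(w in disk) (green_density k z w - green_density m z w) =
    \int[leb2]_(w in disk) green_density k z w.
  by apply: eq_Rintegral => w /set_mem /E.
rewrite (green_energy k0 k1 dz) mulNr -mulrN ler_wpM2l ?pi_ge0//.
apply: le_trans lmk; rewrite lerBrDr addNr.
by rewrite ln_ge0.
Qed.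

(** * Dependence of the Green function on its pole and level *)

Lemma dgreen_log (R : realType) (e : R * R) (k : R) (z w : R * R) : 0 < k ->
  disk z -> disk w -> k < phdist2 z w ->
  dgreen e k z w = - (2^-1 * dmobius_num e z w / mobius_num z w) +
    2^-1 * dmobius_den e z w / mobius_den z w.
Proof.
move=> k0 dz dw kq; rewrite /dgreen kq.
have D0 := lt0r_neq0 (mobius_den_gt0 dz dw).
have q0 : phdist2 z w != 0 by rewrite gt_eqF// (lt_trans k0).
have N0 : mobius_num z w != 0.
  by apply: contra_neq q0; rewrite /phdist2 => ->; rewrite mul0r.
by rewrite /dphdist2 /phdist2; field; rewrite N0 D0.
Qed.

(** In complex notation, with gradients taken up to conjugation: |1/(w - z) - 1/(w - z')|^2 = |z -
    z'|^2 / (|w - z|^2 |w - z'|^2). *)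
Lemma grad_log_num_dist (R : realType) (z z' w : R * R) :
  mobius_num z w != 0 -> mobius_num z' w != 0 ->
  (2^-1 * dmobius_num dir_x z w / mobius_num z w -
   2^-1 * dmobius_num dir_x z' w / mobius_num z' w) ^+ 2 +
  (2^-1 * dmobius_num dir_y z w / mobius_num z w -
   2^-1 * dmobius_num dir_y z' w / mobius_num z' w) ^+ 2 =
  mobius_num z z' / (mobius_num z w * mobius_num z' w).
Proof.
rewrite /dmobius_num /mobius_num /= => N0 N0'.
by field; rewrite N0 N0'.
Qed.

(** The same computation for the logarithmic derivative - conj(z) / (1 - conj(z) w); the difference
    again has numerator of modulus |z - z'|. *)
Lemma grad_log_den_dist (R : realType) (z z' w : R * R) :
  mobius_den z w != 0 -> mobius_den z' w != 0 ->
  (2^-1 * dmobius_den dir_x z w / mobius_den z w -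
   2^-1 * dmobius_den dir_x z' w / mobius_den z' w) ^+ 2 +
  (2^-1 * dmobius_den dir_y z w / mobius_den z w -
   2^-1 * dmobius_den dir_y z' w / mobius_den z' w) ^+ 2 =
  mobius_num z z' / (mobius_den z w * mobius_den z' w).
Proof.
rewrite /dmobius_den /mobius_den /mobius_num /sqnorm /= => N0 N0'.
by field; rewrite N0 N0'.
Qed.

Definition dist1 (R : realType) (z z' : R * R) : R := `|z.1 - z'.1| + `|z.2 - z'.2|.

Lemma mobius_num_dist1 (R : realType) (z z' : R * R) : disk z -> disk z' ->
  mobius_num z z' <= 4 * dist1 z z'.
Proof.
move=> /disk_coord[z1 z2] /disk_coord[z1' z2'].
have h (x y : R) : `|x| < 1 -> `|y| < 1 -> (y - x) * (y - x) <= 4 * `|x - y|.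
  move=> hx hy; have -> : (y - x) * (y - x) = `|x - y| ^+ 2.
    by rewrite real_normK ?num_real//; ring.
  have h2 : `|x - y| <= 2 by apply: le_trans (ler_normB _ _) _; lra.
  by have := normr_ge0 (x - y); nra.
by have := h _ _ z1 z1'; have := h _ _ z2 z2'; rewrite /mobius_num /dist1; lra.
Qed.

Lemma mobius_num_lip (R : realType) (z z' w : R * R) : disk z -> disk z' -> disk w ->
  `|mobius_num z w - mobius_num z' w| <= 4 * dist1 z z'.
Proof.
move=> /disk_coord[z1 z2] /disk_coord[z1' z2'] /disk_coord[w1 w2].
have h (x y t : R) : `|x| < 1 -> `|y| < 1 -> `|t| < 1 ->
    `|(t - x) * (t - x) - (t - y) * (t - y)| <= 4 * `|x - y|.
  move=> hx hy ht; have -> : (t - x) * (t - x) - (t - y) * (t - y) = (x + y - 2 * t) * (x - y) by ring.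
  rewrite normrM ler_wpM2r//; move: hx hy ht.
  by rewrite !ltr_norml ler_norml => /andP[? ?] /andP[? ?] /andP[? ?]; lra.
have -> : mobius_num z w - mobius_num z' w =
    ((w.1 - z.1) * (w.1 - z.1) - (w.1 - z'.1) * (w.1 - z'.1)) +
    ((w.2 - z.2) * (w.2 - z.2) - (w.2 - z'.2) * (w.2 - z'.2)) by rewrite /mobius_num; ring.
apply: le_trans (ler_normD _ _) _.
by have := h _ _ _ z1 z1' w1; have := h _ _ _ z2 z2' w2; rewrite /dist1; lra.
Qed.

Lemma mobius_den_lip (R : realType) (z z' w : R * R) : disk z -> disk z' -> disk w ->
  `|mobius_den z w - mobius_den z' w| <= 4 * dist1 z z'.
Proof.
move=> /disk_coord[z1 z2] /disk_coord[z1' z2'] dw; have [w1 w2] := disk_coord dw.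
have s1 : sqnorm w < 1 by apply/disk_sqnorm.
have s0 := sqnorm_ge0 w.
have h (x y t s : R) : `|x| < 1 -> `|y| < 1 -> `|t| < 1 -> 0 <= s -> s < 1 ->
    `|(x - y) * (s * (x + y) - 2 * t)| <= 4 * `|x - y|.
  move=> hx hy ht hs hs1; rewrite normrM mulrC ler_wpM2r//; move: hx hy ht.
  by rewrite !ltr_norml ler_norml => /andP[? ?] /andP[? ?] /andP[? ?]; nra.
have -> : mobius_den z w - mobius_den z' w =
    (z.1 - z'.1) * (sqnorm w * (z.1 + z'.1) - 2 * w.1) +
    (z.2 - z'.2) * (sqnorm w * (z.2 + z'.2) - 2 * w.2).
  by rewrite /mobius_den {1 3}/sqnorm; ring.
apply: le_trans (ler_normD _ _) _.
by have := h _ _ _ _ z1 z1' w1 s0 s1; have := h _ _ _ _ z2 z2' w2 s0 s1; rewrite /dist1; lra.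
Qed.

(** From N' = q' D' follows q - q' = ((N - N') - q' (D - D')) / D; as 0 <= q' < 1, the Lipschitz
    constants 4 of N and D add up to 8. *)
Lemma phdist2_lip (R : realType) (c : R) (z z' w : R * R) : disk z -> disk z' -> disk w ->
  0 < c -> c <= mobius_den z w -> c <= mobius_den z' w ->
  `|phdist2 z w - phdist2 z' w| <= 8 / c * dist1 z z'.
Proof.
move=> dz dz' dw c0 cD cD'.
have D0 : 0 < mobius_den z w := mobius_den_gt0 dz dw.
have D0' : 0 < mobius_den z' w := mobius_den_gt0 dz' dw.
have q1 := phdist2_lt1 dz' dw; have q0 := phdist2_ge0 dz' dw.
have -> : phdist2 z w - phdist2 z' w = ((mobius_num z w - mobius_num z' w) -
    phdist2 z' w * (mobius_den z w - mobius_den z' w)) / mobius_den z w.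
  by rewrite /phdist2; field; rewrite !gt_eqF.
rewrite normrM normfV (gtr0_norm D0) ler_pdivrMr//.
apply: (@le_trans _ _ (8 * dist1 z z')).
  apply: le_trans (ler_normB _ _) _; rewrite normrM (ger0_norm q0).
  have := mobius_num_lip dz dz' dw; have := mobius_den_lip dz dz' dw.
  have := normr_ge0 (mobius_den z w - mobius_den z' w); nra.
have -> : 8 * dist1 z z' = 8 / c * dist1 z z' * c by field; rewrite gt_eqF.
by rewrite ler_wpM2l// !mulr_ge0 ?invr_ge0 ?(ltW c0)// addr_ge0.
Qed.

(** Absence of truncation means N > k D >= k0 c, which bounds the denominators in
    [grad_log_num_dist]. In 8 = 2 * 4, the 2 comes from separating the contributions of N and D, the
    4 from [mobius_num_dist1]. *)
Lemma dgreen_dist (R : realType) (c k0 k k' : R) (z z' w : R * R) :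
  disk z -> disk z' -> disk w -> 0 < c -> c <= mobius_den z w -> c <= mobius_den z' w ->
  0 < k0 -> k0 <= k -> k0 <= k' -> k < phdist2 z w -> k' < phdist2 z' w ->
  (dgreen dir_x k z w - dgreen dir_x k' z' w) ^+ 2 +
  (dgreen dir_y k z w - dgreen dir_y k' z' w) ^+ 2 <=
  8 * ((k0 * c) ^- 2 + c ^- 2) * dist1 z z'.
Proof.
move=> dz dz' dw c0 cD cD' k00 kk kk' kq kq'.
have D0 := mobius_den_gt0 dz dw; have D0' := mobius_den_gt0 dz' dw.
have kc0 : 0 < k0 * c by rewrite mulr_gt0.
have kN (kk1 : R) (x : R * R) : disk x -> k0 <= kk1 -> c <= mobius_den x w ->
    kk1 < phdist2 x w -> k0 * c <= mobius_num x w.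
  move=> dx kk2 cx; rewrite ltr_pdivlMr ?mobius_den_gt0// => /ltW; apply: le_trans.
  by apply: ler_pM => //; exact: ltW.
have N0 := lt_le_trans kc0 (kN _ _ dz kk cD kq).
have N0' := lt_le_trans kc0 (kN _ _ dz' kk' cD' kq').
rewrite !(dgreen_log _ _ dz dw kq) ?(lt_le_trans k00)//.
rewrite !(dgreen_log _ _ dz' dw kq') ?(lt_le_trans k00)//.
have EN := grad_log_num_dist (lt0r_neq0 N0) (lt0r_neq0 N0').
have ED := grad_log_den_dist (lt0r_neq0 D0) (lt0r_neq0 D0').
have s (x x' y y' : R) : (- x + y - (- x' + y')) ^+ 2 <= 2 * (x - x') ^+ 2 + 2 * (y - y') ^+ 2.
  by have := sqr_ge0 ((x - x') + (y - y')); nra.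
apply: le_trans (lerD (s _ _ _ _) (s _ _ _ _)) _.
have m4 := mobius_num_dist1 dz dz'; have m0 := mobius_num_ge0 z z'.
have b (n m e x y : R) : 0 <= n -> n <= m -> 0 < e -> e <= x -> e <= y ->
    n / (x * y) <= m * e ^- 2.
  move=> n0 nm e0 ex ey; apply: ler_pM => //.
    by rewrite invr_ge0 mulr_ge0// (le_trans (ltW e0)).
  rewrite lef_pV2 ?posrE ?exprn_gt0 ?mulr_gt0 ?(lt_le_trans e0)// expr2.
  by apply: ler_pM => //; exact: ltW.
have bN := b _ _ _ _ _ m0 m4 kc0 (kN _ _ dz kk cD kq) (kN _ _ dz' kk' cD' kq').
have bD := b _ _ _ _ _ m0 m4 c0 cD cD'.
by move: EN ED bN bD; lra.
Qed.

(* eta bounds |phdist2 z w - phdist2 z' w|, so a point where exactly one of the two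
   functions is truncated lies in one of the annuli of the right-hand side. *)
Lemma green_gradient_dist (R : realType) (c k0 k k' eta : R) (z z' w : R * R) :
  disk z -> disk z' -> disk w -> 0 < c -> c <= mobius_den z w -> c <= mobius_den z' w ->
  0 < k0 -> k0 <= k -> k0 <= k' ->
  eta = 8 / c * dist1 z z' ->
  (dgreen dir_x k z w - dgreen dir_x k' z' w) ^+ 2 +
  (dgreen dir_y k z w - dgreen dir_y k' z' w) ^+ 2 <=
  8 * ((k0 * c) ^- 2 + c ^- 2) * dist1 z z' +
  ((green_density k z w - green_density (Num.max k (k' + eta)) z w) +
   (green_density k' z' w - green_density (Num.max k' (k + eta)) z' w)).
Proof.
move=> dz dz' dw c0 cD cD' k00 kk kk' etaE.
have C0 : 0 <= 8 * ((k0 * c) ^- 2 + c ^- 2) * dist1 z z'.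
  by rewrite !mulr_ge0 ?addr_ge0// invr_ge0 exprn_ge0 ?mulr_ge0 ?(ltW c0) ?(ltW k00).
have A0 : 0 <= green_density k z w - green_density (Num.max k (k' + eta)) z w.
  by rewrite subr_ge0 green_density_mono// le_max lexx.
have B0 : 0 <= green_density k' z' w - green_density (Num.max k' (k + eta)) z' w.
  by rewrite subr_ge0 green_density_mono// le_max lexx.
have /ler_normlP[lip1 lip2] : `|phdist2 z w - phdist2 z' w| <= eta.
  by rewrite etaE; exact: phdist2_lip dz dz' dw c0 cD cD'.
have dg0 e k1 x : phdist2 x w <= k1 -> dgreen e k1 x w = 0 by rewrite /dgreen ltNge => ->.
have [kq|qk] := ltP k (phdist2 z w); have [kq'|qk'] := ltP k' (phdist2 z' w).
- by have := dgreen_dist dz dz' dw c0 cD cD' k00 kk kk' kq kq'; lra.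
- rewrite !(dg0 _ _ _ qk') !subr0 -/(green_density k z w) (@green_density0 _ (Num.max _ _) z); first lra.
  by rewrite le_max; apply/orP; right; lra.
- rewrite !(dg0 _ _ _ qk) !sub0r !sqrrN -/(green_density k' z' w) (@green_density0 _ (Num.max k' _) z').
    lra.
  by rewrite le_max; apply/orP; right; lra.
- by rewrite !(dg0 _ _ _ qk) !(dg0 _ _ _ qk') subrr expr0n/= addr0; lra.
Qed.

Lemma leb2_disk (R : realType) : leb2 (disk : set (plane R)) = (@pi R)%:E.
Proof.
rewrite -[pi]mulr1 -(leb2_mobius_num (0, 0) (@ltr01 R)); congr (leb2 _).
by apply/seteqP; split => w /=; rewrite disk_sqnorm /mobius_num /sqnorm /= !subr0.
Qed.

(** Integrates [green_gradient_dist]: the Lipschitz part over the disk, of area pi, and two annuli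
    of energy at most pi (|k - k'| + eta) / k0 each. The bounds |z|^2 <= rho and k >= k0 make the
    constants c and C1 uniform. *)
Lemma green_modulus (R : realType) (rho k0 : R) : rho < 1 -> 0 < k0 ->
  exists C : R, forall (z z' : R * R) (k k' : R), sqnorm z <= rho -> sqnorm z' <= rho ->
    k0 <= k -> k < 1 -> k0 <= k' -> k' < 1 ->
    dirichlet (green k z \- green k' z') (green k z \- green k' z') <= C * (dist1 z z' + `|k - k'|).
Proof.
move=> r1 k00; have [c cE] : exists c : R, c = ((1 - rho) / 2) ^+ 2 by eexists.
have c0 : 0 < c by rewrite cE exprn_gt0// divr_gt0// subr_gt0.
pose C1 := 8 * ((k0 * c) ^- 2 + c ^- 2).
have C10 : 0 <= C1 by rewrite !mulr_ge0 ?addr_ge0// invr_ge0 exprn_ge0 ?mulr_ge0 ?(ltW c0) ?(ltW k00).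
exists (C1 + (1 + 8 / c) / k0) => z z' k k' zr zr' kk k1 kk' k1'.
have dz : disk z by apply/disk_sqnorm; exact: le_lt_trans r1.
have dz' : disk z' by apply/disk_sqnorm; exact: le_lt_trans r1.
have k0' := lt_le_trans k00 kk; have k0'' := lt_le_trans k00 kk'.
have [gz _] := green_sobolev k0' k1 dz; have [gz' _] := green_sobolev k0'' k1' dz'.
have cD x w : sqnorm x <= rho -> disk x -> disk w -> c <= mobius_den x w.
  move=> xr dx dw; apply: le_trans (mobius_den_ge dx dw).
  rewrite cE /den_min expr_div_n (_ : 2 ^+ 2 = 4); last by ring.
  by rewrite ler_pM2r// ler_pXn2r// ?nnegrE; lra.
have mD := @measurable_disk R.
have gd := weak_gradient_sub gz gz'; rewrite (dirichletE gd gd).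
set eta := 8 / c * dist1 z z'.
have d0 : 0 <= dist1 z z' by rewrite addr_ge0.
have eta0 : 0 <= eta by rewrite !mulr_ge0// invr_ge0 ltW.
have [i1 b1] := @integral_green_density_diff R k (Num.max k (k' + eta)) z k0' k1
   (ltac:(by rewrite le_max lexx)) dz.
have [i2 b2] := @integral_green_density_diff R k' (Num.max k' (k + eta)) z' k0'' k1'
   (ltac:(by rewrite le_max lexx)) dz'.
have ic : leb2.-integrable disk (EFin \o (fun=> C1 * dist1 z z') : plane R -> \bar R).
  apply: (@bounded_integrable_disk _ _ `|C1 * dist1 z z'|) => //; exact: measurable_cst.
have i12 := integrableD mD i1 i2; have ic12 := integrableD mD ic i12.
have iL : leb2.-integrable disk (EFin \o (fun w : plane R =>
    (dgreen dir_x k z w - dgreen dir_x k' z' w) * (dgreen dir_x k z w - dgreen dir_x k' z' w) +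
    (dgreen dir_y k z w - dgreen dir_y k' z' w) * (dgreen dir_y k z w - dgreen dir_y k' z' w))).
  have [_ [sx _] [sy _]] := gd.
  move/square_integrableP : sx => [_ ix]; move/square_integrableP : sy => [_ iy].
  have := integrableD mD ix iy; apply: eq_integrable => // w _ /=; rewrite !expr2.
have hb (a b : R) : k0 <= a -> (Num.max a (b + eta) - a) / a <= (`|a - b| + eta) / k0.
  move=> a0; rewrite ler_pM ?invr_ge0 ?subr_ge0 ?le_max ?lexx//.
  - by apply: ltW; apply: lt_le_trans a0.
  - rewrite lerBlDr ge_max; apply/andP; split; first by have := normr_ge0 (a - b); lra.
    by have := ler_norm (b - a); rewrite distrC; lra.
  - by rewrite lef_pV2 ?posrE// (lt_le_trans k00).
have pi0 := pi_gt0 R.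
have B : \int[leb2]_(w in disk)
    ((dgreen dir_x k z w - dgreen dir_x k' z' w) * (dgreen dir_x k z w - dgreen dir_x k' z' w) +
    (dgreen dir_y k z w - dgreen dir_y k' z' w) * (dgreen dir_y k z w - dgreen dir_y k' z' w)) <=
    pi * (C1 * dist1 z z' + 2 * ((`|k - k'| + eta) / k0)).
  apply: (@le_trans _ _ (\int[leb2]_(w in disk) (C1 * dist1 z z' +
    ((green_density k z w - green_density (Num.max k (k' + eta)) z w) +
   (green_density k' z' w - green_density (Num.max k' (k + eta)) z' w))))).
    apply: le_Rintegral => // w dw; rewrite -!expr2.
    exact: green_gradient_dist dz dz' dw c0 (cD _ _ zr dz dw) (cD _ _ zr' dz' dw) k00 kk kk' erefl.
  rewrite RintegralD// RintegralD// Rintegral_cst// leb2_disk/=.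
  rewrite (mulrDr pi) (mulrC pi (C1 * _)); apply: lerD => //.
  apply: le_trans (lerD b1 b2) _; rewrite -mulrDr ler_wpM2l ?(ltW pi0)//.
  rewrite mulr_natl mulr2n; apply: lerD; first exact: hb.
  by rewrite distrC; exact: hb.
apply: (@le_trans _ _ ((2 * pi)^-1 * (pi * (C1 * dist1 z z' + 2 * ((`|k - k'| + eta) / k0))))).
  by rewrite ler_wpM2l// invr_ge0 mulr_ge0// ltW.
have -> : (2 * pi)^-1 * (pi * (C1 * dist1 z z' + 2 * ((`|k - k'| + eta) / k0))) =
   2^-1 * C1 * dist1 z z' + (`|k - k'| + eta) / k0.
  by move: (@pi R) (lt0r_neq0 pi0) (lt0r_neq0 k00) => p p0 kn0; field; apply/andP.
have -> : (C1 + (1 + 8 / c) / k0) * (dist1 z z' + `|k - k'|) = C1 * dist1 z z' +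
   (`|k - k'| + eta) / k0 + (C1 * `|k - k'| + (dist1 z z' + 8 / c * `|k - k'|) / k0).
  by rewrite /eta; move: (lt0r_neq0 c0) (lt0r_neq0 k00) => cn0 kn0; field; apply/andP.
rewrite -[leLHS]addr0; apply: lerD.
  rewrite lerD2r -mulrA; have := mulr_ge0 C10 d0; lra.
apply: addr_ge0; first by rewrite mulr_ge0.
by rewrite mulr_ge0 ?invr_ge0 ?(ltW k00)// addr_ge0// !mulr_ge0// invr_ge0 ltW.
Qed.

(** * Isometries of the Poincare disk *)

Lemma derive_compose (R : realType) (U V W : normedModType R) (F : V -> W) (G : U -> V) (w v : U) :
  differentiable G w -> differentiable F (G w) ->
  'D_v (F \o G) w = 'D_('D_v G w) F (G w).
Proof.
move=> dG dF; rewrite (deriveE v (differentiable_comp dG dF)) (deriveE v dG) (deriveE _ dF).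
by rewrite (diff_comp dG dF).
Qed.

(** The differential does not increase hyperbolic lengths, with denominators cleared. Isometries,
    their inverses and [mobius] share this property, which is stable under composition, so a single
    Schwarz-Pick lemma serves for all. *)
Definition hyperbolic_contraction (R : realType) (F : R * R -> R * R) : Prop :=
  forall w, disk w -> [/\ disk (F w), differentiable F w &
    forall v, sqnorm ('D_v F w) * (1 - sqnorm w) ^+ 2 <= sqnorm v * (1 - sqnorm (F w)) ^+ 2].

Lemma hyperbolic_contraction_comp (R : realType) (F G : R * R -> R * R) :
  hyperbolic_contraction F -> hyperbolic_contraction G -> hyperbolic_contraction (F \o G).
Proof.
move=> cF cG w dw; have [dG diffG hG] := cG _ dw; have [dF diffF hF] := cF _ dG.
split; [exact: dF|exact: differentiable_comp diffG diffF|move=> v].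
rewrite (derive_compose v diffG diffF).
have /disk_sqnorm w1 := dw; have /disk_sqnorm G1 := dG.
have := hG v; have := hF ('D_v G w); move: ('D_v G w) => x /=; move: ('D_x F (G w)) => y h1 h2.
have p2 : 0 < (1 - sqnorm (G w)) ^+ 2 by rewrite exprn_gt0// subr_gt0.
rewrite -(ler_pM2r p2).
apply: (@le_trans _ _ (sqnorm x * (1 - sqnorm (F (G w))) ^+ 2 * (1 - sqnorm w) ^+ 2)).
  by rewrite mulrAC ler_wpM2r// sqr_ge0.
by rewrite mulrAC [leRHS]mulrAC ler_wpM2r// sqr_ge0.
Qed.

Lemma cauchy_schwarz2 (R : realType) (a b : R * R) :
  (a.1 * b.1 + a.2 * b.2) ^+ 2 <= sqnorm a * sqnorm b.
Proof.
rewrite -subr_ge0; have -> : sqnorm a * sqnorm b - (a.1 * b.1 + a.2 * b.2) ^+ 2 =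
  (a.1 * b.2 - a.2 * b.1) ^+ 2 by rewrite /sqnorm; ring.
exact: sqr_ge0.
Qed.

Lemma sqnormZ (R : realType) (t : R) (w : R * R) : sqnorm (t *: w) = t ^+ 2 * sqnorm w.
Proof. by rewrite /sqnorm /=/GRing.scale/=; ring. Qed.

Lemma ler_sqr_norm (R : realType) (x y : R) : 0 <= y -> x ^+ 2 <= y ^+ 2 -> x <= y.
Proof.
move=> y0 xy; apply: le_trans (ler_norm x) _.
by rewrite -(@ler_pXn2r _ 2)// ?nnegrE// real_normK ?num_real.
Qed.

Lemma is_derive_inner (R : realType) (V : normedModType R) (F : V -> R * R) (b : R * R) (z v : V) :
  differentiable F z ->
  is_derive z v (fun w => (F w).1 * b.1 + (F w).2 * b.2) (('D_v F z).1 * b.1 + ('D_v F z).2 * b.2).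
Proof.
move=> dF.
have dfst : differentiable (fst : R * R -> R) (F z) by apply: linear_differentiable => w; exact: cvg_fst.
have dsnd : differentiable (snd : R * R -> R) (F z) by apply: linear_differentiable => w; exact: cvg_snd.
have D1 : is_derive z v (fst \o F) ('D_v F z).1.
  split; first exact: diff_derivable (differentiable_comp dF dfst).
  by rewrite (derive_compose v dF dfst); have [_ ->] := is_derive_fst (F z) ('D_v F z).
have D2 : is_derive z v (snd \o F) ('D_v F z).2.
  split; first exact: diff_derivable (differentiable_comp dF dsnd).
  by rewrite (derive_compose v dF dsnd); have [_ ->] := is_derive_snd (F z) ('D_v F z).
apply: (is_derive_eq (is_derive_addf (is_derive_mulf D1 (is_derive_cstf b.1 z v))
  (is_derive_mulf D2 (is_derive_cstf b.2 z v)))).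
by rewrite !mulr0 !addr0.
Qed.

Lemma is_derive_along (R : realType) (F : R * R -> R * R) (w b : R * R) (t : R) :
  differentiable F (t *: w) ->
  is_derive t 1 (fun s : R => (F (s *: w)).1 * b.1 + (F (s *: w)).2 * b.2)
    (('D_w F (t *: w)).1 * b.1 + ('D_w F (t *: w)).2 * b.2).
Proof.
move=> dF.
have dl : differentiable (fun s : R => s *: w) t by exact: ex_diff.
have dc : differentiable (F \o (fun s : R => s *: w)) t := differentiable_comp dl dF.
have E : 'D_(1 : R) (fun s : R => s *: w) t = w.
  by rewrite (deriveE _ dl) diff_val/= scale1r.
have := is_derive_inner b (1 : R) dc.
by rewrite (derive_compose (1 : R) dl dF) E.
Qed.

(* Along the ray t |-> t w the function artanh <H (t w), e> grows at most as
   fast as artanh (t |w|). *)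
Lemma schwarz_pick (R : realType) (H : R * R -> R * R) (w : R * R) :
  hyperbolic_contraction H -> H (0, 0) = (0, 0) -> disk w -> sqnorm (H w) <= sqnorm w.
Proof.
move=> cH H0 dw; have /disk_sqnorm w1 := dw.
have [b0|bn0] := eqVneq (sqnorm (H w)) 0; first by rewrite b0 sqnorm_ge0.
have [b bE] : exists b, b = H w by eexists.
rewrite -bE in bn0 *.
have [beta [beta0 beta2]] : exists beta : R, 0 < beta /\ beta ^+ 2 = sqnorm b.
  exists (Num.sqrt (sqnorm b)); split; last by rewrite sqr_sqrtr// sqnorm_ge0.
  by rewrite sqrtr_gt0 lt_neqAle eq_sym bn0 sqnorm_ge0.
have [a [a0 a2]] : exists a : R, 0 <= a /\ a ^+ 2 = sqnorm w.
  by exists (Num.sqrt (sqnorm w)); rewrite sqrtr_ge0 sqr_sqrtr// sqnorm_ge0.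
have a1 : a < 1 by rewrite -(@expr_lt1 _ 2)// a2.
have dtw (t : R) : 0 <= t -> t <= 1 -> disk (t *: w).
  move=> t0 t1; apply/disk_sqnorm; rewrite sqnormZ; apply: le_lt_trans w1.
  by rewrite ler_piMl ?sqnorm_ge0// exprn_ile1.
(* The component of H (t w) along the unit vector b / |b|; it equals |b| = |H w| at t = 1. *)
pose h (t : R) : R := beta^-1 * ((H (t *: w)).1 * b.1 + (H (t *: w)).2 * b.2).
pose dh (t : R) : R := beta^-1 * (('D_w H (t *: w)).1 * b.1 + ('D_w H (t *: w)).2 * b.2).
have cs (c : R * R) : (beta^-1 * (c.1 * b.1 + c.2 * b.2)) ^+ 2 <= sqnorm c.
  rewrite exprMn mulrC exprVn ler_pdivrMr ?exprn_gt0// beta2; exact: cauchy_schwarz2.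
have Dh (t : R) : 0 <= t -> t <= 1 -> is_derive t 1 h (dh t).
  move=> t0 t1; have [_ dH _] := cH _ (dtw _ t0 t1).
  exact: is_derive_scalef (is_derive_along b dH).
have hb (t : R) : 0 <= t -> t <= 1 -> [/\ 0 < 1 + h t, 0 < 1 - h t, 0 < 1 + a * t, 0 < 1 - a * t &
    dh t * (1 - (a * t) ^+ 2) <= a * (1 - h t ^+ 2)].
  move=> t0 t1; have [/disk_sqnorm dHt dH hH] := cH _ (dtw _ t0 t1).
  have h2 : h t ^+ 2 <= sqnorm (H (t *: w)) := cs _.
  have dh2 : dh t ^+ 2 <= sqnorm ('D_w H (t *: w)) := cs _.
  have : `|h t| < 1 by rewrite -(@expr_lt1 _ 2)// real_normK ?num_real// (le_lt_trans h2).
  rewrite ltr_norml => /andP[? ?].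
  have at0 : 0 <= a * t by rewrite mulr_ge0.
  have at1 : a * t < 1 by apply: le_lt_trans a1; rewrite ler_piMr.
  split; [lra|lra|lra|lra|].
  apply: (@le_trans _ _ (a * (1 - sqnorm (H (t *: w))))); last by rewrite ler_wpM2l// lerB.
  (* Squares are compared because [dh t] may be negative and the contraction property, applied in
     the direction w, bounds squared lengths. *)
  apply: ler_sqr_norm; first by rewrite mulr_ge0// subr_ge0 ltW.
  rewrite [leLHS]exprMn [leRHS]exprMn a2; apply: le_trans (hH w).
  rewrite (_ : 1 - (a * t) ^+ 2 = 1 - sqnorm (t *: w)); first by rewrite ler_wpM2r ?sqr_ge0.
  by rewrite sqnormZ -a2 exprMn mulrC.
have Dat (t : R) : is_derive t 1 (fun s => a * s : R) a.
  by apply: (is_derive_eq (is_derive_scalef a (is_derive_id t (1 : R)))); rewrite mulr1.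
(* This is 2 (artanh (h t) - artanh (a t)); it is 0 at t = 0 and nonincreasing, so that h 1 <= a. *)
pose psi (t : R) := (ln (1 + h t) - ln (1 - h t)) - (ln (1 + a * t) - ln (1 - a * t)).
pose dpsi (t : R) := ((0 + dh t) / (1 + h t) - (0 - dh t) / (1 - h t)) -
   ((0 + a) / (1 + a * t) - (0 - a) / (1 - a * t)).
have Dpsi (t : R) : 0 <= t -> t <= 1 -> is_derive t 1 psi (dpsi t).
  move=> t0 t1; have [h1 h2 a3 a4 _] := hb t t0 t1; have D := Dh t t0 t1.
  have c1 := is_derive_cstf (1 : R) t (1 : R).
  have l1 := is_derive_lnf (f := fun s => 1 + h s) h1 (is_derive_addf c1 D).
  have l2 := is_derive_lnf (f := fun s => 1 - h s) h2 (is_derive_subf c1 D).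
  have l3 := is_derive_lnf (f := fun s => 1 + a * s) a3 (is_derive_addf c1 (Dat t)).
  have l4 := is_derive_lnf (f := fun s => 1 - a * s) a4 (is_derive_subf c1 (Dat t)).
  exact: (is_derive_subf (is_derive_subf l1 l2) (is_derive_subf l3 l4)).
have dpsi_le (t : R) : 0 <= t -> t <= 1 -> dpsi t <= 0.
  move=> t0 t1; have [h1 h2 a3 a4 h5] := hb t t0 t1.
  rewrite /dpsi; move: h1 h2 a3 a4 h5; move: (h t) (dh t) (a * t) => x y u h1 h2 a3 a4 h5.
  have -> : ((0 + y) / (1 + x) - (0 - y) / (1 - x)) - ((0 + a) / (1 + u) - (0 - a) / (1 - u)) =
    2 * (y * (1 - u ^+ 2) - a * (1 - x ^+ 2)) / ((1 + x) * (1 - x) * (1 + u) * (1 - u)).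
    by field; rewrite !gt_eqF.
  rewrite ler_pdivrMr ?mul0r; last by rewrite !mulr_gt0.
  by rewrite pmulr_rle0// subr_le0.
have psi01 : psi 1 <= psi 0.
  apply: (@ler0_derive1_nincr _ psi 0 1) => //.
  - by move=> t; rewrite in_itv/= => /andP[/ltW t0 /ltW t1]; have [] := Dpsi t t0 t1.
  - move=> t; rewrite in_itv/= => /andP[/ltW t0 /ltW t1]; rewrite derive1E.
    by have [_ ->] := Dpsi t t0 t1; exact: dpsi_le.
  - apply: derivable_within_continuous => t; rewrite in_itv/= => /andP[t0 t1].
    by have [] := Dpsi t t0 t1.
have h0 : h 0 = 0 by rewrite /h scale0r H0/= !mul0r addr0 mulr0.
have h1 : h 1 = beta.
  rewrite /h scale1r -bE (_ : b.1 * b.1 + b.2 * b.2 = sqnorm b); last by rewrite /sqnorm.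
  by rewrite -beta2 expr2 mulKf ?gt_eqF.
have [p1 p2 p3 p4 _] := hb 1 ler01 (lexx 1).
move: psi01; rewrite /psi h0 mulr0 !subr0 addr0 !subrr subr_le0 h1 mulr1.
rewrite h1 mulr1 in p1 p2 p3 p4.
rewrite -!ln_div ?posrE// ler_ln ?posrE ?divr_gt0// ler_pdivrMr// mulrAC ler_pdivlMr// => le.
have ba : beta <= a by lra.
by rewrite -beta2 -a2 ler_pXn2r// ?nnegrE// ltW.
Qed.

(* The disk automorphism w |-> (w - z) / (1 - conj(z) w). *)
Definition mobius (R : realType) (z w : R * R) : R * R :=
  let c := 1 - (z.1 * w.1 + z.2 * w.2) in
  let s := z.2 * w.1 - z.1 * w.2 in
  (((w.1 - z.1) * c + (w.2 - z.2) * s) / mobius_den z w,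
   ((w.2 - z.2) * c - (w.1 - z.1) * s) / mobius_den z w).

Lemma sqnorm_mobius (R : realType) (z w : R * R) : disk z -> disk w ->
  sqnorm (mobius z w) = phdist2 z w.
Proof.
move=> dz dw; have := lt0r_neq0 (mobius_den_gt0 dz dw).
rewrite /phdist2 /mobius /sqnorm /mobius_num /= => D0.
rewrite [mobius_den z w]mobius_denE in D0 *.
by field.
Qed.

Lemma mobius_self (R : realType) (z : R * R) : mobius z z = (0, 0).
Proof. by rewrite /mobius !subrr !mul0r subr0 addr0 mul0r. Qed.

Lemma disk_mobius (R : realType) (z w : R * R) : disk z -> disk w -> disk (mobius z w).
Proof. by move=> dz dw; apply/disk_sqnorm; rewrite sqnorm_mobius// phdist2_lt1. Qed.

Lemma disk_opp (R : realType) (z : R * R) : disk z -> disk (- z).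
Proof. by rewrite !disk_sqnorm /sqnorm /= !mulrNN. Qed.

Lemma mobiusK (R : realType) (z w : R * R) : disk z -> disk w ->
  mobius (- z) (mobius z w) = w.
Proof.
move=> dz dw; have D0 := lt0r_neq0 (mobius_den_gt0 dz dw).
have D1 := lt0r_neq0 (mobius_den_gt0 (disk_opp dz) (disk_mobius dz dw)).
have z0 : 1 - sqnorm z != 0 by rewrite gt_eqF// subr_gt0; apply/disk_sqnorm.
have E : mobius_den (- z) (mobius z w) = (1 - sqnorm z) ^+ 2 / mobius_den z w.
  move: D0; rewrite [mobius_den (- z) _]mobius_denE /mobius /=.
  rewrite ![mobius_den z w]mobius_denE /sqnorm => D0.
  by field.
rewrite {1}/mobius E; case: w D0 {dw D1 E} => x y D0; congr pair; move: D0 z0;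
  rewrite /mobius /= ![mobius_den z _]mobius_denE /sqnorm /= => D0 z0; field; exact/andP.
Qed.

Lemma derive_pair (R : realType) (U V W : normedModType R) (f : U -> V) (g : U -> W) (z v : U) :
  differentiable f z -> differentiable g z ->
  'D_v (fun u => (f u, g u)) z = ('D_v f z, 'D_v g z).
Proof.
move=> df dg; rewrite (deriveE v (differentiable_pair df dg)) (deriveE v df) (deriveE v dg).
by rewrite (diff_pair df dg).
Qed.

(** Equality in fact holds: once 1 - q is rewritten with [mobius_denB], it is a rational
    identity. *)
Lemma hyperbolic_contraction_mobius (R : realType) (z : R * R) : disk z ->
  hyperbolic_contraction (mobius z).
Proof.
move=> dz w dw; have D0 := lt0r_neq0 (mobius_den_gt0 dz dw).
have dfst : differentiable (fst : R * R -> R) w by apply: linear_differentiable => u; exact: cvg_fst.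
have dsnd : differentiable (snd : R * R -> R) w by apply: linear_differentiable => u; exact: cvg_snd.
have C (c : R) : differentiable (fun _ : R * R => c) w := differentiable_cst c w.
pose c (u : R * R) := 1 - (z.1 * u.1 + z.2 * u.2).
pose s (u : R * R) := z.2 * u.1 - z.1 * u.2.
have dc : differentiable c w := differentiableB (C 1)
  (differentiableD (differentiableM (C z.1) dfst) (differentiableM (C z.2) dsnd)).
have ds : differentiable s w :=
  differentiableB (differentiableM (C z.2) dfst) (differentiableM (C z.1) dsnd).
have [dD _] : Ck 1 setT (mobius_den z) by exact: Ck_mobius_den openT.
have dDV := differentiableV (dD w I) D0.
have dx := differentiableB dfst (C z.1); have dy := differentiableB dsnd (C z.2).
have d1 := differentiableM (differentiableD (differentiableM dx dc) (differentiableM dy ds)) dDV.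
have d2 := differentiableM (differentiableB (differentiableM dy dc) (differentiableM dx ds)) dDV.
have dM : differentiable (mobius z) w := differentiable_pair d1 d2.
split; [exact: disk_mobius|exact: dM|move=> v].
have Dx := is_derive_subf (is_derive_fst w v) (is_derive_cstf z.1 w v).
have Dy := is_derive_subf (is_derive_snd w v) (is_derive_cstf z.2 w v).
have Dax := is_derive_scalef z.1 (is_derive_fst w v).
have Dby := is_derive_scalef z.2 (is_derive_snd w v).
have Dbx := is_derive_scalef z.2 (is_derive_fst w v).
have Day := is_derive_scalef z.1 (is_derive_snd w v).
have Dc : is_derive w v c _ := is_derive_subf (is_derive_cstf 1 w v) (is_derive_addf Dax Dby).
have Ds : is_derive w v s _ := is_derive_subf Dbx Day.
have DD := is_derive_invf D0 (is_derive_mobius_den v z w).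
have [_ E1] := is_derive_mulf (is_derive_addf (is_derive_mulf Dx Dc) (is_derive_mulf Dy Ds)) DD.
have [_ E2] := is_derive_mulf (is_derive_subf (is_derive_mulf Dy Dc) (is_derive_mulf Dx Ds)) DD.
have -> : 'D_v (mobius z) w = ('D_v (fun u => (mobius z u).1) w, 'D_v (fun u => (mobius z u).2) w).
  exact: (derive_pair v d1 d2).
rewrite sqnorm_mobius// {1}/sqnorm /= E1 E2.
have /disk_sqnorm z1 := dz; rewrite !subr0 /c /s /dmobius_den /phdist2.
have -> : 1 - mobius_num z w / mobius_den z w = (1 - sqnorm z) * (1 - sqnorm w) / mobius_den z w.
  by rewrite -mobius_denB; field.
rewrite le_eqVlt; apply/orP; left; apply/eqP; move: D0; rewrite ![mobius_den z w]mobius_denE /sqnorm => D0.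
by field.
Qed.

Lemma isometry_sqnorm (R : realType) (F : R * R -> R * R) (w v : R * R) :
  poincare_isometry F -> disk w ->
  sqnorm ('D_v F w) * (1 - sqnorm w) ^+ 2 = sqnorm v * (1 - sqnorm (F w)) ^+ 2.
Proof.
move=> [[G [[sF _] [FD _] _ _]] iso] dw.
have [dF _] : Ck 1 disk F := sF 1.
have := iso w v v dw; rewrite -(deriveE v (dF w dw)) /hyperbolic_metric /euclidean_metric.
rewrite !modulus_sqr -/(sqnorm ('D_v F w)) -/(sqnorm v) => h.
have /disk_sqnorm w1 := dw; have /disk_sqnorm F1 := FD _ dw.
rewrite (_ : (F w).1 ^+ 2 + (F w).2 ^+ 2 = sqnorm (F w)) in h; last by rewrite /sqnorm !expr2.
rewrite (_ : w.1 ^+ 2 + w.2 ^+ 2 = sqnorm w) in h; last by rewrite /sqnorm !expr2.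
have n1 : (1 - sqnorm w) ^+ 2 != 0 by rewrite expf_neq0// gt_eqF// subr_gt0.
have n2 : (1 - sqnorm (F w)) ^+ 2 != 0 by rewrite expf_neq0// gt_eqF// subr_gt0.
move: h n1 n2; move: (sqnorm ('D_v F w)) (sqnorm v) ((1 - sqnorm w) ^+ 2) ((1 - sqnorm (F w)) ^+ 2).
move=> x y s t h n1 n2; apply: (mulfI (invr_neq0 n1)); apply: (mulfI (invr_neq0 n2)).
rewrite [LHS](_ : _ = t^-1 * x); last by field; apply/andP.
by rewrite h; field; apply/andP.
Qed.

Lemma isometry_contraction (R : realType) (F : R * R -> R * R) :
  poincare_isometry F -> hyperbolic_contraction F.
Proof.
move=> iF w dw; have [[G [[sF _] [FD _] _ _]] _] := iF.
have [dF _] : Ck 1 disk F := sF 1.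
by split; [exact: FD|exact: dF|move=> v; rewrite isometry_sqnorm].
Qed.

(** Differentiating F o G = id gives DF (DG v) = v, so the isometry identity for F in the direction
    DG v is the one wanted for G. *)
Lemma isometry_inverse (R : realType) (F : R * R -> R * R) : poincare_isometry F ->
  exists G, [/\ hyperbolic_contraction G, forall z, disk z -> G (F z) = z &
    forall z, disk z -> F (G z) = z].
Proof.
move=> iF; have [[G [[sF sG] [FD GD] GF FG]] _] := iF; exists G; split => // w dw.
have [dF _] : Ck 1 disk F := sF 1; have [dG _] : Ck 1 disk G := sG 1.
have dGw := GD _ dw; split; [exact: dGw|exact: dG|move=> v].
have E : 'D_('D_v G w) F (G w) = v.
  rewrite -(derive_compose v (dG _ dw) (dF _ dGw)).
  have -> : 'D_v (F \o G) w = 'D_v (id : R * R -> R * R) w.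
    apply: near_eq_derive; near=> u; apply: FG; near: u.
    by apply: open_nbhs_nbhs; split; [exact: open_disk|exact: dw].
  by rewrite derive_id.
by have := isometry_sqnorm ('D_v G w) iF dGw; rewrite E FG// => ->.
Unshelve. all: by end_near. Qed.

(** Both F o [mobius (- z)] and [mobius z] o G fix the origin. Schwarz-Pick for the first, at
    [mobius z w], gives one inequality; for the second, at F w, the other. *)
Theorem isometry_phdist2 (R : realType) (F : R * R -> R * R) (z w : R * R) :
  poincare_isometry F -> disk z -> F z = (0, 0) -> disk w ->
  sqnorm (F w) = phdist2 z w.
Proof.
move=> iF dz Fz dw; have cF := isometry_contraction iF.
have [G [cG GF FG]] := isometry_inverse iF.
have d0 : disk ((0, 0) : R * R) by apply/disk_sqnorm; rewrite /sqnorm /= mul0r addr0.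
have dF : disk (F w) by have [] := cF w dw.
apply/eqP; rewrite eq_le; apply/andP; split.
  have h := hyperbolic_contraction_comp cF (hyperbolic_contraction_mobius (disk_opp dz)).
  have M0 : mobius (- z) (0, 0) = z by rewrite -(mobius_self z) mobiusK.
  have := schwarz_pick h _ (disk_mobius dz dw); rewrite /= M0 Fz mobiusK// sqnorm_mobius//.
  by apply.
have h := hyperbolic_contraction_comp (hyperbolic_contraction_mobius dz) cG.
have := schwarz_pick h _ dF; rewrite /= GF// -[G (0, 0)](_ : z = _); last by rewrite -Fz GF.
by rewrite mobius_self sqnorm_mobius//; apply.
Qed.

Lemma tanh_bounds (R : realType) (x : R) : 0 < x -> 0 < tanh x /\ tanh x < 1.
Proof.
move=> x0; have e1 := expR_gt0 (- x).
have e2 : expR (- x) < expR x by rewrite ltr_expR; lra.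
by split; [rewrite divr_gt0//|rewrite ltr_pdivrMr ?mul1r]; lra.
Qed.

Lemma G0_isometry (R : realType) (F : R * R -> R * R) (z w : R * R) (r : R) :
  poincare_isometry F -> disk z -> F z = (0, 0) -> disk w -> 0 < r ->
  G0 r (F w) = green (r ^+ 2) z w.
Proof.
move=> iF dz Fz dw r0; rewrite /G0 /green -(isometry_phdist2 iF dz Fz dw).
have -> : Num.max (r ^+ 2) (sqnorm (F w)) = Num.max r (modulus (F w)) ^+ 2.
  rewrite (_ : sqnorm (F w) = modulus (F w) ^+ 2); last by rewrite modulus_sqr /sqnorm !expr2.
  have [rm|rm] := leP r (modulus (F w)).
    by rewrite max_r// ler_pXn2r// nnegrE ?modulus_ge0// ltW.
  by rewrite max_l// ler_pXn2r// ?nnegrE ?modulus_ge0// ltW.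
by rewrite lnXn ?lt_max ?r0// mulr2n -mulr_natr; field.
Qed.

(** * Continuous versions of Gaussian processes *)

(* normal_pdf is by convention a uniform density when s = 0. *)
Lemma normal_pdfN (R : realType) (s x : R) : normal_pdf 0 s (- x) = normal_pdf 0 s x \/ s = 0.
Proof.
have [->|s0] := eqVneq s 0; [by right|left].
by rewrite !normal_pdfE// /normal_fun !subr0 sqrrN.
Qed.

Lemma normal_probN (R : realType) (s : R) (A : set (measurableTypeR R)) : s != 0 -> measurable A ->
  normal_prob 0 s (-%R @^-1` A) = normal_prob 0 s A.
Proof.
move=> s0 mA; rewrite /normal_prob.
have mf : measurable_fun A (fun x : measurableTypeR R => (normal_pdf 0 s x)%:E).
  by apply: measurable_funTS; apply/measurable_EFinP; exact: measurable_normal_pdf.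
transitivity (\int[pushforward (@lebesgue_measure R) (-%R : _ -> measurableTypeR R)]_(x in A)
    (normal_pdf 0 s x)%:E)%E; last first.
  by apply: eq_measure_integral => B mB _; exact: lebesgue_measureN.
have mo : measurable_fun setT (-%R : measurableTypeR R -> measurableTypeR R).
  exact: oppr_measurable.
rewrite (ge0_integral_pushforward mo _ mA mf).
  apply: eq_integral => x _ /=.
  by have [->|/eqP] := normal_pdfN s x; rewrite ?(negbTE s0).
by move=> x _; rewrite lee_fin normal_pdf_ge0.
Qed.

Lemma centred_gaussianN (R : realType) (d : measure_display) (Omega : measurableType d)
    (P : probability Omega R) (X : Omega -> R) (A : set (measurableTypeR R)) : centred_gaussian P X -> measurable A ->
  P (X @^-1` (-%R @^-1` A)) = P (X @^-1` A).
Proof.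
move=> [mX [s [s0 law]]] mA.
have mA' : measurable (-%R @^-1` A : set (measurableTypeR R)).
  have mo : measurable_fun setT (-%R : measurableTypeR R -> measurableTypeR R).
    exact: oppr_measurable.
  by rewrite -[X in measurable X]setTI; exact: mo.
rewrite !law//; have [_|sn0] := eqVneq s 0; last exact: normal_probN.
have E : (-%R @^-1` A) 0 = A 0 by rewrite /= /preimage /= oppr0.
by rewrite !diracE !in_setE !E || rewrite !diracE /in_mem /= /in_set !E.
Qed.

(** X and -X have the same law, so the positive and negative parts of X have the same integral,
    finite by integrability. *)
Lemma centred_gaussian_expectation (R : realType) (d : measure_display) (Omega : measurableType d)
    (P : probability Omega R) (X : Omega -> R) : centred_gaussian P X ->
  P.-integrable setT (EFin \o X) -> (\int[P]_w (X w)%:E = 0)%E.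
Proof.
move=> gX iX; have [mX _] := gX.
have mp : measurable_fun [set: measurableTypeR R] (fun x : measurableTypeR R => (Num.max x 0)%:E).
  by apply/measurable_EFinP; apply: measurable_maxr => //; exact: measurable_cst.
have p0 : {in [set: measurableTypeR R], forall y : measurableTypeR R, (0 <= (Num.max y 0)%:E)%E}.
  by move=> x _; rewrite lee_fin le_max lexx orbT.
have mN : measurable_fun setT (fun w => - X w : measurableTypeR R) by exact: measurable_funN.
have E : (\int[P]_w (Num.max (X w) 0)%:E = \int[P]_w (Num.max (- X w) 0)%:E)%E.
  have := ge0_integral_pushforward (mX : measurable_fun setT (X : _ -> measurableTypeR R)) P
    measurableT mp p0.
  rewrite preimage_setT => <-.
  have := ge0_integral_pushforward mN P measurableT mp p0; rewrite preimage_setT => <-.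
  apply: eq_measure_integral => A mA _ /=; rewrite /pushforward.
  by rewrite -(centred_gaussianN gX mA).
have ip := integrable_pos_fin_num measurableT iX.
rewrite integralE; move: ip; rewrite (_ : (fun w => (X w)%:E)^\+ = fun w => (Num.max (X w) 0)%:E)%E; last first.
  by apply/funext => w; rewrite funeposE EFin_max.
rewrite (_ : (fun w => (X w)%:E)^\- = fun w => (Num.max (- X w) 0)%:E)%E; last first.
  by apply/funext => w; rewrite funenegE EFin_max.
by move=> ip; rewrite -E subee.
Qed.

(** Half of the exponent is spent on the bound: for |x| > l, exp (- x^2 / (2 s^2)) <= c exp (- x^2 /
    (4 s^2)), and the last factor belongs to the normal density with parameter sqrt 2 s, of total
    mass 1. The ratio sqrt 2 of the peaks is rounded up to 2. *)
Lemma normal_prob_tail (R : realType) (s l : R) : 0 < s -> 0 <= l ->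
  (normal_prob 0 s [set x : measurableTypeR R | (l < `|x|)%R] <= (2 * expR (- (l ^+ 2 / (4 * s ^+ 2))))%:E)%E.
Proof.
move=> s0 l0; pose t := Num.sqrt 2 * s.
have q2 : 0 < Num.sqrt 2 :> R by rewrite sqrtr_gt0.
have t0 : 0 < t by rewrite mulr_gt0.
have t2 : t ^+ 2 = 2 * s ^+ 2 by rewrite exprMn sqr_sqrtr.
have q22 : Num.sqrt 2 <= 2 :> R by rewrite -[leRHS]ger0_norm// -sqrtr_sqr ler_wsqrtr// expr2; lra.
set A := [set x | _]; set c := expR _.
have mA : measurable (A : set (measurableTypeR R)).
  rewrite (_ : A = ~` `[- l, l]); first by apply: measurableC; exact: measurable_itv.
  by apply/seteqP; split => x; rewrite /A/= in_itv/= -ler_norml ltNge => /negP.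
have mf := measurable_normal_pdf (0 : R).
have bound x : A x -> normal_pdf 0 s x <= 2 * c * normal_pdf 0 t x.
  move=> /= Ax; rewrite !normal_pdfE ?gt_eqF// /normal_fun /normal_peak subr0 t2.
  have -> : Num.sqrt (2 * s ^+ 2 * pi *+ 2) = Num.sqrt 2 * Num.sqrt (s ^+ 2 * pi *+ 2).
    by rewrite -(mulrA 2) -mulrnAr sqrtrM.
  set K := Num.sqrt (s ^+ 2 * pi *+ 2).
  have K0 : 0 < K by rewrite sqrtr_gt0 mulrn_wgt0// mulr_gt0 ?pi_gt0// exprn_gt0.
  have E : expR (- x ^+ 2 / (s ^+ 2 *+ 2)) <= c * expR (- x ^+ 2 / (2 * s ^+ 2 *+ 2)).
    rewrite -expRD ler_expR.
    have lx : l ^+ 2 <= x ^+ 2.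
      by rewrite -(real_normK (num_real x)) ler_pXn2r// ?nnegrE// ltW.
    have -> : - x ^+ 2 / (s ^+ 2 *+ 2) = - (x ^+ 2 / (4 * s ^+ 2)) + - x ^+ 2 / (2 * s ^+ 2 *+ 2).
      have E (y v : R) : v != 0 -> - y / (v *+ 2) = - (y / (4 * v)) + - y / (2 * v *+ 2).
        by move=> v0; rewrite -(mulr_natl v) -(mulr_natl (2 * v)); field.
      by apply: E; rewrite gt_eqF// exprn_gt0.
    by rewrite lerD2r lerN2 ler_pM2r// invr_gt0 mulr_gt0// exprn_gt0.
  rewrite invfM.
  apply: (@le_trans _ _ (K^-1 * (c * expR (- x ^+ 2 / (2 * s ^+ 2 *+ 2))))).
    by rewrite ler_wpM2l// invr_ge0 ltW.
  have -> : 2 * c * ((Num.sqrt 2)^-1 / K * expR (- x ^+ 2 / (2 * s ^+ 2 *+ 2))) =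
     2 / Num.sqrt 2 * (K^-1 * (c * expR (- x ^+ 2 / (2 * s ^+ 2 *+ 2)))).
    by move: (expR _) => y; field; rewrite !gt_eqF.
  rewrite ler_peMl//; last by rewrite ler_pdivlMr// mul1r.
  by rewrite !mulr_ge0 ?expR_ge0// invr_ge0 ltW.
have c0 : 0 <= 2 * c by rewrite mulr_ge0 ?expR_ge0.
apply: (@le_trans _ _ (\int[lebesgue_measure]_(x in A) ((2 * c)%:E * (normal_pdf 0 t x)%:E))%E).
  apply: ge0_le_integral => //.
  - by move=> x _; rewrite lee_fin normal_pdf_ge0.
  - by apply: measurable_funTS; apply/measurable_EFinP; exact: mf.
  - by apply: measurable_funTS; apply: measurable_funeM; apply/measurable_EFinP; exact: mf.
rewrite ge0_integralZl//.
- rewrite -[leRHS]mule1; apply: lee_wpmul2l; first by rewrite lee_fin.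
  exact: (@probability_le1 _ _ _ (normal_prob 0 t)).
- by apply: measurable_funTS; apply/measurable_EFinP; exact: mf.
- by move=> x _; rewrite lee_fin normal_pdf_ge0.
Qed.

(** The interval ]-s/2, s/2[ has length s and the density is at most 1 / (s sqrt (2 pi)), so its
    mass is at most 1/2. This serves to bound s by a second moment. *)
Lemma normal_prob_large (R : realType) (s : R) : 0 < s ->
  (2^-1%:E <= normal_prob 0 s [set x : measurableTypeR R | (s / 2 <= `|x|)%R])%E.
Proof.
move=> s0; have mf := measurable_normal_pdf (0 : R) s.
set A := [set x | _].
have AE : ~` A = `](- (s / 2)), (s / 2)[%classic.
  apply/seteqP; split => x /=; rewrite in_itv/= -ltr_norml => h; rewrite ?ltNge; apply/negP => //.
  by rewrite -ltNge.
have mA' : measurable (~` A : set (measurableTypeR R)) by rewrite AE; exact: measurable_itv.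
have mA : measurable (A : set (measurableTypeR R)) by rewrite -[A]setCK; exact: measurableC.
have h : (normal_prob 0 s (~` A) <= 2^-1%:E)%E.
  apply: (@le_trans _ _ (\int[lebesgue_measure]_(x in ~` A) (normal_peak s)%:E)%E).
    apply: ge0_le_integral => //.
    - by move=> x _; rewrite lee_fin normal_pdf_ge0.
    - by apply: measurable_funTS; apply/measurable_EFinP; exact: mf.
    - by move=> x _; rewrite lee_fin normal_pdf_ub// gt_eqF.
  rewrite integral_cst// [X in (_ * X)%E](_ : _ = s%:E); last first.
    rewrite AE; apply: etrans (lebesgue_measure_itv `]- (s / 2), s / 2[%R) _.
    rewrite /= lte_fin ifT; last by lra.
    by rewrite -EFinB; congr (_%:E); lra.
  rewrite -EFinM lee_fin /normal_peak ler_pdivrMl; last first.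
    by rewrite sqrtr_gt0 mulrn_wgt0// mulr_gt0 ?pi_gt0// exprn_gt0.
  rewrite ler_pdivlMr//; rewrite -[leLHS]ger0_norm ?mulr_ge0 ?(ltW s0)// -sqrtr_sqr ler_wsqrtr//.
  rewrite exprMn -mulr_natr; have := pi_ge2 R; have : 0 < s ^+ 2 by rewrite exprn_gt0.
  by move: (s ^+ 2) => u; nra.
have : (normal_prob 0 s (~` A) = 1 - normal_prob 0 s A)%E.
  exact: (@probability_setC _ _ _ (normal_prob 0 s) _ mA).
have : normal_prob 0 s A \is a fin_num by exact: (@fin_num_measure _ _ _ (normal_prob 0 s) _ mA).
move: h.
move: (normal_prob 0 s A) (normal_prob 0 s (~` A)) => a b; case: a => [a h _ bE|//|//].
by move: h; rewrite bE -EFinB !lee_fin; lra.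
Qed.

(** Markov's inequality for X^2 at level (s/2)^2, with [normal_prob_large], gives s^2 / 8 <= v;
    hence 32 = 4 * 8 in place of the 4 of [normal_prob_tail]. *)
Lemma centred_gaussian_tail (R : realType) (d : measure_display) (Omega : measurableType d)
    (P : probability Omega R) (X : Omega -> R) (v l : R) : centred_gaussian P X ->
  (\int[P]_w (X w ^+ 2)%:E <= v%:E)%E -> 0 < v -> 0 < l ->
  (P [set w | (l < `|X w|)%R] <= (2 * expR (- (l ^+ 2 / (32 * v))))%:E)%E.
Proof.
move=> [mX [s [s0 law]]] Xv v0 l0.
have mgt (t : R) : measurable ([set x | t < `|x|] : set (measurableTypeR R)).
  rewrite (_ : mkset _ = ~` `[- t, t]); first by apply: measurableC; exact: measurable_itv.
  by apply/seteqP; split => x; rewrite /= in_itv/= -ler_norml ltNge => /negP.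
have mge (t : R) : measurable ([set x | t <= `|x|] : set (measurableTypeR R)).
  rewrite (_ : mkset _ = ~` `]- t, t[); first by apply: measurableC; exact: measurable_itv.
  by apply/seteqP; split => x; rewrite /= in_itv/= -ltr_norml leNgt => /negP.
have := law _ (mgt l); rewrite /preimage /= => ->.
have [s00|sn0] := eqVneq s 0.
  rewrite diracE memNset/= ?lee_fin ?mulr_ge0 ?expR_ge0//.
  by rewrite /= normr0 => /(lt_trans l0); rewrite ltxx.
have s1 : 0 < s by rewrite lt_neqAle eq_sym sn0.
apply: le_trans (normal_prob_tail s1 (ltW l0)) _.
rewrite lee_fin ler_pM2l// ler_expR lerN2 ler_wpM2l ?sqr_ge0// lef_pV2 ?posrE ?mulr_gt0 ?exprn_gt0//.
suff : s ^+ 2 <= 8 * v by lra.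
have q0 : 0 < (s / 2) ^+ 2 by rewrite exprn_gt0// divr_gt0.
have mX2 : measurable_fun setT (fun w => (X w ^+ 2)%:E).
  by apply/measurable_EFinP; exact: measurable_funX.
have := @le_integral_abse _ _ _ P setT measurableT _ ((s / 2) ^+ 2) mX2 q0.
have -> : (\int[P]_w `|(X w ^+ 2)%:E| = \int[P]_w (X w ^+ 2)%:E)%E.
  by apply: eq_integral => w _; rewrite abse_EFin ger0_norm ?sqr_ge0.
have -> : setT `&` [set w | ((s / 2) ^+ 2)%:E <= `|(X w ^+ 2)%:E|]%E = [set w | s / 2 <= `|X w|].
  by rewrite setTI; apply/seteqP; split => w /=;
    rewrite lee_fin normrX ler_pXn2r// nnegrE// ltW// divr_gt0.
have := law _ (mge (s / 2)); rewrite /preimage /= (negbTE sn0) => -> h.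
have h2 := normal_prob_large s1.
have := le_trans h Xv.
have : (((s / 2) ^+ 2)%:E * 2^-1%:E <= ((s / 2) ^+ 2)%:E * normal_prob 0 s [set x | (s / 2 <= `|x|)%R])%E.
  by apply: lee_wpmul2l => //; rewrite lee_fin ltW.
move=> /le_trans /[apply]; rewrite -EFinM lee_fin expr_div_n => h3.
by move: h3; rewrite (_ : (2 : R) ^+ 2 = 4); [lra|ring].
Qed.

Lemma centred_gaussian_ae (R : realType) (d : measure_display) (Omega : measurableType d)
    (P : probability Omega R) (X Y : Omega -> R) : centred_gaussian P X -> measurable_fun setT Y ->
  {ae P, forall w, Y w = X w} -> centred_gaussian P Y.
Proof.
move=> [mX [s [s0 law]]] mY YX; split => //; exists s; split => // A mA; rewrite -law//.
have mXA : measurable (X @^-1` A) by rewrite -[X in measurable X]setTI; exact: mX.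
have mYA : measurable (Y @^-1` A) by rewrite -[X in measurable X]setTI; exact: mY.
have mi (B : set Omega) : measurable B -> measurable_fun setT (fun w => (\1_B w : R)%:E).
  by move=> mB; apply/measurable_EFinP; exact: measurable_indic.
have pI (B : set Omega) : measurable B -> P B = (\int[P]_w (\1_B w : R)%:E)%E.
  by move=> mB; rewrite integral_indic// setIT.
rewrite (pI _ mYA) (pI _ mXA).
apply: ae_eq_integral => //; [exact: mi|exact: mi|].
apply: filterS YX => w wE _; congr (_%:E); rewrite !indicE; congr (nat_of_bool _)%:R.
by apply/idP/idP; rewrite !inE /= wE.
Qed.

Lemma le_measure_union (R : realType) (d : measure_display) (Omega : measurableType d)
    (P : {measure set Omega -> \bar R}) (I : eqType) (s : seq I) (A : I -> set Omega) (b : R) :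
  (forall i, measurable (A i)) -> (forall i, P (A i) <= b%:E)%E ->
  measurable [set w | exists2 i, i \in s & A i w] /\
  (P [set w | exists2 i, i \in s & A i w] <= ((size s)%:R * b)%:E)%E.
Proof.
move=> mA bA; elim: s => [|i s [IHm IH]].
  by rewrite (_ : mkset _ = set0) ?measure0 ?mul0r//; apply/seteqP; split => w [].
rewrite (_ : mkset _ = A i `|` [set w | exists2 i, i \in s & A i w]).
  split; first exact: measurableU.
  apply: le_trans (measureU2 _ _ _) _ => //.
  by rewrite /= -natr1 mulrDl mul1r addrC EFinD leeD.
apply/seteqP; split => w /=.
  by move=> [j]; rewrite in_cons => /orP[/eqP ->|js] Aj; [left|right; exists j].
by move=> [Ai|[j js Aj]]; [exists i; rewrite ?mem_head|exists j; rewrite // in_cons js orbT].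
Qed.

Lemma borel_cantelli_geometric (R : realType) (d : measure_display) (Omega : measurableType d)
    (P : probability Omega R) (A : nat -> set Omega) (c : R) :
  (forall n, measurable (A n)) -> (forall n, P (A n) <= (c * 2^-1 ^+ n)%:E)%E ->
  P (lim_sup_set A) = 0%E.
Proof.
move=> mA PA; apply: lim_sup_set_cvg0 => //.
apply: (@le_lt_trans _ _ (2 * c)%:E); last exact: ltry.
apply: lime_le; first by apply: is_cvg_nneseries.
apply: nearW => n; apply: (@le_trans _ _ (2 * c * (1 - 2^-1 ^+ n))%:E).
  elim: n => [|n IH]; first by rewrite big_geq// expr0 subrr mulr0.
  rewrite big_nat_recr//=; apply: le_trans (leeD IH (PA n)) _.
  by rewrite -EFinD lee_fin exprS; lra.
have c0 : 0 <= c by have := le_trans (measure_ge0 P (A 0%N)) (PA 0%N); rewrite expr0 mulr1 lee_fin.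
by rewrite lee_fin ler_piMr ?mulr_ge0// lerBlDr lerDl exprn_ge0.
Qed.

Lemma eventually_not_lim_sup (T : Type) (A : nat -> set T) (w : T) :
  ~ lim_sup_set A w -> exists n0, forall n, (n0 <= n)%N -> ~ A n w.
Proof.
move=> h; apply: contrapT => h2; apply: h => n _; apply: contrapT => h3.
by apply: h2; exists n => m nm Am; apply: h3; exists m.
Qed.

Lemma measurable_lim_sup_set (d : measure_display) (T : measurableType d) (A : nat -> set T) :
  (forall n, measurable (A n)) -> measurable (lim_sup_set A).
Proof. by move=> mA; apply: bigcapT_measurable => n; apply: bigcup_measurable. Qed.

(** Already (9/8)^6 >= 2, and 42 = 6 * 7 with 128 = 2^7. The exponent 42 is chosen so that the tail
    beats the 64^n growth of the number of pairs of grid points with a factor 2^-n to spare. *)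
Lemma pow_98_42 (R : realType) : 128 <= (9 / 8 : R) ^+ 42.
Proof.
have h : 2 <= (9 / 8 : R) ^+ 6.
  have h3 : 71 / 50 <= (9 / 8 : R) ^+ 3 by rewrite (_ : _ ^+ 3 = 729 / 512); [lra|field].
  by rewrite (_ : 6 = 3 * 2)%N// exprM expr2; move: h3; move: (_ ^+ 3) => x; nra.
rewrite (_ : 42 = 6 * 7)%N// exprM (_ : 128 = 2 ^+ 7); last by ring.
by apply: lerXn2r; rewrite ?nnegrE//; lra.
Qed.

(** The squared threshold over the variance is (9/16)^n / (v 2^-n) = (9/8)^n / v. The exponential
    tail is then weakened to a power of exponent 42 by [expRN_le]; 1344 = 42 * 32. *)
Lemma gaussian_level_tail (R : realType) (d : measure_display) (Omega : measurableType d)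
    (P : probability Omega R) (Y : Omega -> R) (v : R) n :
  centred_gaussian P Y -> 0 < v -> (\int[P]_w (Y w ^+ 2)%:E <= (v * 2^-1 ^+ n)%:E)%E ->
  (P [set w | ((3 / 4) ^+ n < `|Y w|)%R] <= (2 * (1344 * v) ^+ 42 * 128^-1 ^+ n)%:E)%E.
Proof.
move=> gY v0 Yv; have vn0 : 0 < v * 2^-1 ^+ n by rewrite mulr_gt0// exprn_gt0.
apply: le_trans (centred_gaussian_tail gY Yv vn0 _) _; first by rewrite exprn_gt0.
rewrite lee_fin -mulrA ler_pM2l//.
have -> : ((3 / 4) ^+ n) ^+ 2 / (32 * (v * 2^-1 ^+ n)) = (9 / 8) ^+ n / (32 * v) :> R.
  rewrite -exprM mulnC exprM -[(9 / 8 : R)](_ : (3 / 4) ^+ 2 / 2^-1 = _); last by field.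
  move: ((3 / 4) ^+ 2) => a; rewrite expr_div_n; have : (2^-1 : R) ^+ n != 0 by rewrite expf_neq0.
  by move: (2^-1 ^+ n) (a ^+ n) => x y x0; field; rewrite x0 gt_eqF.
apply: le_trans (expRN_le 41 _) _; first by rewrite divr_gt0 ?exprn_gt0// mulr_gt0.
have -> : 42%:R / ((9 / 8) ^+ n / (32 * v)) = 1344 * v * ((9 / 8) ^+ n)^-1 :> R.
  have : (9 / 8 : R) ^+ n != 0 by rewrite gt_eqF// exprn_gt0.
  by move: ((9 / 8) ^+ n) => x x0; field; rewrite x0 gt_eqF.
have : 0 <= 1344 * v by apply: mulr_ge0; [exact: ler0n|exact: ltW].
move: (1344 * v) (pow_98_42 R) (@exprn_gt0 _ n (9 / 8 : R)) => a h98 h0 a0.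
have x0 : 0 < (9 / 8 : R) ^+ n by apply: h0.
rewrite [leLHS](exprMn 42 a) ler_wpM2l ?exprn_ge0//.
rewrite [leLHS]exprVn [leRHS]exprVn lef_pV2 ?posrE ?(exprn_gt0 _ x0) ?exprn_gt0//.
by rewrite -exprM mulnC exprM; apply: lerXn2r; rewrite ?nnegrE ?exprn_ge0.
Qed.

(** 7 = 3 + 1 + 3: two limit errors of [geometric_cauchy] and one grid increment, to be added in
    [dyadic_limit_continuous]. *)
Lemma small_pow34 (R : realType) (e : R) n0 : 0 < e ->
  exists n, (n0 <= n)%N /\ 7 * (3 / 4) ^+ n < e.
Proof.
move=> e0; have h : (fun n => (3 / 4 : R) ^+ n) @ \oo --> (0 : R).
  by apply: cvg_expr; rewrite ger0_norm//; lra.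
have e7 : 0 < e / 7 by rewrite divr_gt0.
have [n1 _ hn1] := cvgr0_norm_lt _ h _ e7.
exists (maxn n0 n1); split; first exact: leq_maxl.
have := hn1 (maxn n0 n1) (leq_maxr _ _).
by rewrite /= ger0_norm ?exprn_ge0// ltr_pdivlMr// mulrC.
Qed.

(** The sum of (3/4)^j over j > n is 3 (3/4)^n; [hk] is the corresponding finite telescoping sum. *)
Lemma geometric_cauchy (R : realType) (u : nat -> R) n0 :
  (forall n, (n0 <= n)%N -> `|u n - u n.+1| <= (3 / 4) ^+ n.+1) ->
  cvgn u /\ forall n, (n0 <= n)%N -> `|limn u - u n| <= 3 * (3 / 4) ^+ n.
Proof.
move=> hu.
have hk n k : (n0 <= n)%N -> `|u n - u (n + k)%N| <= 3 * ((3 / 4) ^+ n - (3 / 4) ^+ (n + k)).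
  move=> n0n; elim: k => [|k IH]; first by rewrite addn0 !subrr normr0 mulr0.
  have -> : u n - u (n + k.+1)%N = (u n - u (n + k)%N) + (u (n + k)%N - u (n + k).+1).
    by rewrite addnS; ring.
  apply: le_trans (ler_normD _ _) _; have := hu (n + k)%N (leq_trans n0n (leq_addr _ _)).
  by rewrite addnS exprS; move: IH; lra.
have hm n m : (n0 <= n)%N -> (n <= m)%N -> `|u n - u m| <= 3 * (3 / 4) ^+ n.
  move=> n0n nm; have := hk n (m - n)%N n0n; rewrite subnKC// => /le_trans; apply.
  by rewrite ler_pM2l// lerBlDr lerDl exprn_ge0.
have cu : cvgn u.
  apply: cauchy_cvg; apply: cauchy_exP => e e0.
  have [n [n0n ne]] := small_pow34 n0 e0; exists (u n); exists n => // m /= nm.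
  by rewrite /ball /=; apply: le_lt_trans (hm n m n0n nm) _; have := exprn_ge0 n (_ : 0 <= 3 / 4 :> R); lra.
split => // n n0n; apply/ler_addgt0Pr => e e0.
have [n1 _ hn1] := cvgr_dist_lt _ _ cu _ e0.
have m1 := hn1 (maxn n n1) (leq_maxr _ _).
have m2 := hm n (maxn n n1) n0n (leq_maxl _ _).
have -> : limn u - u n = (limn u - u (maxn n n1)) + (u (maxn n n1) - u n) by ring.
apply: le_trans (ler_normD _ _) _; rewrite [leRHS]addrC.
by apply: lerD; [exact: ltW|rewrite distrC].
Qed.

(** * Dyadic approximation and Kolmogorov's continuity criterion *)

Definition dyadic (R : realType) n (t : R) : R := (Num.floor (t * 2 ^+ n))%:~R * 2^-1 ^+ n.

Lemma dyadic_dist (R : realType) n (t : R) : `|dyadic n t - t| <= 2^-1 ^+ n.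
Proof.
rewrite /dyadic exprVn; have p0 : 0 < 2 ^+ n :> R by rewrite exprn_gt0.
have -> : (Num.floor (t * 2 ^+ n))%:~R / 2 ^+ n - t = ((Num.floor (t * 2 ^+ n))%:~R - t * 2 ^+ n) / 2 ^+ n.
  by field; rewrite gt_eqF.
rewrite normrM (gtr0_norm (x := _^-1)) ?invr_gt0// ler_piMl ?invr_ge0 ?(ltW p0)//.
have /andP[] := floor_itv (t * 2 ^+ n); rewrite intrD => h1 h2.
by rewrite ler_norml; apply/andP; split; lra.
Qed.

Lemma norm3_le (R : realType) (p : R * R * R) (e : R) :
  (`|p| <= e) = [&& `|p.1.1| <= e, `|p.1.2| <= e & `|p.2| <= e].
Proof. by rewrite !prod_normE /= !ge_max -andbA. Qed.

Definition dyadic3 (R : realType) n (p : R * R * R) : R * R * R :=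
  (dyadic n p.1.1, dyadic n p.1.2, dyadic n p.2).

Lemma dyadic3_dist (R : realType) n (p : R * R * R) : `|dyadic3 n p - p| <= 2^-1 ^+ n.
Proof. by rewrite norm3_le /= !dyadic_dist. Qed.

(** A finite enumeration, for the union bound, of the dyadic numbers of level n in [-b, b]: the
    ordinal i stands for the numerator i - b 2^n. *)
Definition node (R : realType) b n (i : 'I_(2 * b * 2 ^ n).+1) : R :=
  (i%:R - (b * 2 ^ n)%:R) * 2^-1 ^+ n.

Lemma nodeP (R : realType) b n (m : int) : `|m%:~R * 2^-1 ^+ n| <= b%:R :> R ->
  exists i : 'I_(2 * b * 2 ^ n).+1, m%:~R * 2^-1 ^+ n = node R i.
Proof.
rewrite normrM [X in _ * X]ger0_norm ?exprn_ge0// exprVn ler_pdivrMr ?exprn_gt0//.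
have -> : b%:R * 2 ^+ n = ((b * 2 ^ n)%N%:Z)%:~R :> R by rewrite -pmulrn natrM natrX.
rewrite -intr_norm ler_int ler_norml => /andP[m1 m2].
have m0 : 0 <= m + (b * 2 ^ n)%N%:Z by rewrite -lerBlDr sub0r.
have mI : (absz (m + (b * 2 ^ n)%N%:Z)%R < (2 * b * 2 ^ n).+1)%N.
  by rewrite ltnS -lez_nat gez0_abs// -mulnA mul2n -addnn PoszD lerD2r.
exists (Ordinal mI); rewrite /node /= exprVn; congr (_ * _).
by rewrite pmulrn gez0_abs// intrD -pmulrn addrK.
Qed.

Definition grid (R : realType) b n
    (i : 'I_(2 * b * 2 ^ n).+1 * 'I_(2 * b * 2 ^ n).+1 * 'I_(2 * b * 2 ^ n).+1) : R * R * R :=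
  (node R i.1.1, node R i.1.2, node R i.2).

Lemma dyadic3_grid (R : realType) b n (p : R * R * R) : `|dyadic3 n p| <= b%:R ->
  exists i, dyadic3 n p = @grid R b n i.
Proof.
rewrite norm3_le /= => /and3P[/nodeP[i iE] /nodeP[j jE] /nodeP[k kE]].
by exists (i, j, k); rewrite /grid /= -iE -jE -kE.
Qed.

(** Doubling the numerators turns a point of level n into one of level n + 1, so consecutive
    approximations are compared within one grid. *)
Lemma dyadic3_grid_next (R : realType) b n (p : R * R * R) : `|dyadic3 n p| <= b%:R ->
  exists i, dyadic3 n p = @grid R b n.+1 i.
Proof.
have E (t : R) : dyadic n t = (2 * Num.floor (t * 2 ^+ n))%:~R * 2^-1 ^+ n.+1.
  rewrite /dyadic intrM exprS mulrACA -[(2%:Z)%:~R]/(2 : R) mulfV ?mul1r//.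
rewrite norm3_le /= !E => /and3P[/nodeP[i iE] /nodeP[j jE] /nodeP[k kE]].
by exists (i, j, k); rewrite /grid /dyadic3 /= -iE -jE -kE -!E.
Qed.

(* An exhaustion of U by bounded sets such that the 2^-N-neighbourhood of the
   N-th set lies in the next one. *)
Definition inner (R : realType) (U : set (R * R * R)) N : set (R * R * R) :=
  [set p | `|p| <= N%:R /\ forall q, `|q - p| <= 2 * 2^-1 ^+ N -> U q].

Lemma inner_sub (R : realType) (U : set (R * R * R)) N : inner U N `<=` U.
Proof. by move=> p [_]; apply; rewrite subrr normr0 mulr_ge0// exprn_ge0. Qed.

Lemma inner_near (R : realType) (U : set (R * R * R)) N p q :
  inner U N p -> `|q - p| <= 2^-1 ^+ N -> inner U N.+1 q.
Proof.
move=> [pN pU] qp; have h1 : 2^-1 ^+ N <= 1 :> R by rewrite exprn_ile1//; lra.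
split.
  rewrite (_ : q = p + (q - p)); last by rewrite addrC subrK.
  by apply: le_trans (ler_normD _ _) _; rewrite -natr1 lerD// (le_trans qp).
move=> q'; rewrite exprS mulrA mulfV// mul1r => q'q; apply: pU.
have -> : q' - p = (q' - q) + (q - p) by rewrite addrA subrK.
by apply: le_trans (ler_normD _ _) _; rewrite mulr2n mulrDl !mul1r lerD.
Qed.

Lemma inner_mono (R : realType) (U : set (R * R * R)) N M :
  (N <= M)%N -> inner U N `<=` inner U M.
Proof.
move=> NM; rewrite -(subnKC NM); elim: (M - N)%N => [|k IH]; first by rewrite addn0.
move=> p /IH h; rewrite addnS; apply: inner_near h _.
by rewrite subrr normr0 exprn_ge0.
Qed.

Lemma inner_cover (R : realType) (U : set (R * R * R)) p : open U -> U p ->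
  exists N, inner U N p.
Proof.
move=> oU Up; have : nbhs p U by exact: open_nbhs_nbhs.
move=> /nbhs_normP[e /= e0 eU].
pose a := Num.truncn `|p|; pose b := Num.truncn (2 / e).
exists (a + b).+1; split.
  apply: ltW; apply: lt_le_trans (truncnS_gt _) _; rewrite ler_nat ltnS; exact: leq_addr.
move=> q qp; apply: eU; rewrite /ball_/= distrC; apply: le_lt_trans qp _.
have h : 2 / e < (2 ^ (a + b).+1)%:R.
  apply: lt_trans (truncnS_gt _) _; rewrite ltr_nat.
  by apply: leq_ltn_trans (ltn_expl (a + b).+1 (_ : 1 < 2)%N); rewrite ?ltnS// leq_addl.
rewrite exprVn ltr_pdivrMr ?exprn_gt0// -natrX mulrC -ltr_pdivrMr//.
Qed.

(** The factor 4 covers both uses: consecutive approximations of a point are within 3 * 2^-(n+1),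
    taken at level n + 1, and approximations of two points at distance below 2^-n are within 3 *
    2^-n. *)
Definition grid_bound (R : realType) (U : set (R * R * R)) N n (x : R * R * R -> R) : Prop :=
  forall i j, let g := @grid R N n i in let g' := @grid R N n j in
    inner U N g -> inner U N g' -> `|g - g'| <= 4 * 2^-1 ^+ n -> `|x g - x g'| <= (3 / 4) ^+ n.

Lemma half_pow_le (R : realType) N n : (N <= n)%N -> 2^-1 ^+ n <= 2^-1 ^+ N :> R.
Proof. by move=> Nn; apply: ler_wiXn2l => //; lra. Qed.

Lemma inner_dyadic3 (R : realType) (U : set (R * R * R)) N n p : (N <= n)%N ->
  inner U N p -> inner U N.+1 (dyadic3 n p).
Proof.
by move=> Nn Np; apply: inner_near Np _; apply: le_trans (dyadic3_dist _ _) (half_pow_le _ Nn).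
Qed.

Lemma dyadic_limit (R : realType) (U : set (R * R * R)) (x : R * R * R -> R) N n0 p :
  (forall n, (n0 <= n)%N -> grid_bound U N.+1 n x) -> (N <= n0)%N -> inner U N p ->
  cvgn (fun n => x (dyadic3 n p)) /\
  forall n, (n0 <= n)%N ->
    `|limn (fun n => x (dyadic3 n p)) - x (dyadic3 n p)| <= 3 * (3 / 4) ^+ n.
Proof.
move=> gb Nn0 Np; apply: geometric_cauchy => n n0n.
have Nn := leq_trans Nn0 n0n.
have i1 := inner_dyadic3 Nn Np; have i2 := inner_dyadic3 (leqW Nn) Np.
have [i iE] := dyadic3_grid_next (proj1 i1); have [j jE] := dyadic3_grid (proj1 i2).
have := gb n.+1 (leqW n0n) i j; rewrite /= -iE -jE; apply => //.
have -> : dyadic3 n p - dyadic3 n.+1 p = (dyadic3 n p - p) - (dyadic3 n.+1 p - p).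
  by rewrite opprB addrA subrK.
apply: le_trans (ler_normB _ _) _.
have := dyadic3_dist n p; have := dyadic3_dist n.+1 p; rewrite exprS.
have : 0 <= 2^-1 ^+ n :> R by rewrite exprn_ge0.
by move: `|_| `|_| => a b; lra.
Qed.

Lemma dyadic_limit_continuous (R : realType) (U : set (R * R * R)) (x : R * R * R -> R) p :
  open U -> U p -> (forall N, exists n0, forall n, (n0 <= n)%N -> grid_bound U N n x) ->
  {for p, continuous (fun q => limn (fun n => x (dyadic3 n q)))}.
Proof.
move=> oU Up gb; have [N Np] := inner_cover oU Up.
(* The index of the exhaustion grows twice: from p to its neighbours q, then from these to their
   dyadic approximations. *)
have [n0 hn0] := gb N.+2.
apply/cvgrPdist_lt => e e0; have [n [n0n ne]] := small_pow34 (maxn n0 N.+1) e0.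
have n0n' := leq_trans (leq_maxl _ _) n0n; have Nn := leq_trans (leq_maxr _ _) n0n.
suff h : nbhs p [set q | `|limn (fun n => x (dyadic3 n p)) - limn (fun n => x (dyadic3 n q))| < e].
  exact: h.
apply: (proj2 (@nbhs_normP R (R * R * R)%type p _)); exists (2^-1 ^+ n) => /=; first by rewrite exprn_gt0.
move=> q; rewrite /ball_/= => pq.
have Np1 : inner U N.+1 p by exact: inner_mono Np.
have Nq1 : inner U N.+1 q.
  apply: inner_near Np _; rewrite distrC; apply: le_trans (ltW pq) _.
  by apply: half_pow_le; exact: ltnW.
have hb m : (maxn n0 N.+1 <= m)%N -> grid_bound U N.+2 m x.
  by move=> h; apply: hn0; exact: leq_trans (leq_maxl _ _) h.
have [_ hp] := dyadic_limit hb (leq_maxr _ _) Np1.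
have [_ hq] := dyadic_limit hb (leq_maxr _ _) Nq1.
have ip := inner_dyadic3 Nn Np1; have iq := inner_dyadic3 Nn Nq1.
have [i iE] := dyadic3_grid (proj1 ip); have [j jE] := dyadic3_grid (proj1 iq).
have hpq : `|x (dyadic3 n p) - x (dyadic3 n q)| <= (3 / 4) ^+ n.
  have := hb n n0n i j; rewrite /= -iE -jE; apply => //.
  have -> : dyadic3 n p - dyadic3 n q = (dyadic3 n p - p) + (p - q) - (dyadic3 n q - q).
    by rewrite addrA subrK opprB addrA subrK.
  apply: le_trans (ler_normB _ _) _; have := ler_normD (dyadic3 n p - p) (p - q).
  have := dyadic3_dist n p; have := dyadic3_dist n q; have := exprn_ge0 n (_ : 0 <= 2^-1 :> R).
  by move: pq; move: `|_| `|_| `|_| `|_| => a1 a2 a3 a4; lra.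
have := hp n n0n; have := hq n n0n.
set lq := limn _; set lp := limn _ => h1 h2.
have -> : lp - lq = (lp - x (dyadic3 n p)) + (x (dyadic3 n p) - x (dyadic3 n q)) -
    (lq - x (dyadic3 n q)) by ring.
apply: le_lt_trans (ler_normB _ _) _.
have := ler_normD (lp - x (dyadic3 n p)) (x (dyadic3 n p) - x (dyadic3 n q)).
by lra.
Qed.

Lemma measurable_norm_gt (R : realType) (d : measure_display) (Omega : measurableType d)
    (f : Omega -> R) (c : R) : measurable_fun setT f -> measurable [set w | c < `|f w|].
Proof.
move=> mf; have mnf : measurable_fun setT (fun w => `|f w|) by exact: measurableT_comp.
rewrite (_ : mkset _ = (fun w => `|f w|) @^-1` `]c, +oo[).
  by rewrite -[X in measurable X]setTI; apply: mnf => //; exact: measurable_itv.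
by apply/seteqP; split => w; rewrite /preimage /= in_itv/= andbT.
Qed.

Definition controlled_increments (R : realType) (d : measure_display) (Omega : measurableType d)
    (P : probability Omega R) (K : set (R * R * R)) (X : R * R * R -> Omega -> R) : Prop :=
  exists C : R, 0 < C /\ forall p q, K p -> K q ->
    centred_gaussian P (fun w => X p w - X q w) /\
    (\int[P]_w ((X p w - X q w) ^+ 2)%:E <= (C * `|p - q|)%:E)%E.

Lemma grid_bound_ae (R : realType) (d : measure_display) (Omega : measurableType d)
    (P : probability Omega R) (U : set (R * R * R)) (X : R * R * R -> Omega -> R) N :
  (forall p, U p -> measurable_fun setT (X p)) ->
  controlled_increments P (inner U N) X ->
  exists B : set Omega, [/\ measurable B, P B = 0%E & forall w, ~ B w ->
    exists n0, forall n, (n0 <= n)%N -> grid_bound U N n (fun p => X p w)].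
Proof.
move=> mX [C [C0 hC]].
pose I n : finType := 'I_(2 * N * 2 ^ n).+1.
pose G n (ij : (I n * I n * I n) * (I n * I n * I n)) := (@grid R N n ij.1, @grid R N n ij.2).
pose ok n ij := `[< [/\ inner U N (G n ij).1, inner U N (G n ij).2 &
  `|(G n ij).1 - (G n ij).2| <= 4 * 2^-1 ^+ n] >].
(* Pairs that are not to be compared get the empty event, so the union runs over a whole finite
   type. *)
pose A n ij : set Omega := if ok n ij then
  [set w | (3 / 4) ^+ n < `|X (G n ij).1 w - X (G n ij).2 w|] else set0.
pose bad n : set Omega := [set w | exists2 ij, ij \in enum (fun _ : (I n * I n * I n) * (I n * I n * I n) => true) & A n ij w].
(* Compared points are within 4 * 2^-n, so the variance of the increment is at most 4 C 2^-n. *)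
pose K : R := 2 * (1344 * (4 * C)) ^+ 42.
have K0 : 0 <= K.
  apply: mulr_ge0; [exact: ler0n|apply: exprn_ge0; apply: mulr_ge0; first exact: ler0n].
  by rewrite mulr_ge0// ltW.
have mA n ij : measurable (A n ij).
  rewrite /A; case: ifPn => // /asboolP[g1 g2 _]; apply: measurable_norm_gt.
  by apply: measurable_funB; apply: mX; [exact: inner_sub g1|exact: inner_sub g2].
have bA n ij : (P (A n ij) <= (K * 128^-1 ^+ n)%:E)%E.
  rewrite /A; case: ifPn => [/asboolP[g1 g2 g12]|_]; last first.
    by rewrite measure0 lee_fin mulr_ge0// exprn_ge0// invr_ge0 ler0n.
  have [gX vX] := hC _ _ g1 g2.
  apply: (gaussian_level_tail gX); first by rewrite mulr_gt0.
  by apply: le_trans vX _; rewrite lee_fin mulrAC [leRHS]mulrC ler_pM2l.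
have hbad n := le_measure_union (enum (fun _ : (I n * I n * I n) * (I n * I n * I n) => true)) (mA n) (bA n).
have mbad n : measurable (bad n) by have [] := hbad n.
have sz n : size (enum (fun _ : (I n * I n * I n) * (I n * I n * I n) => true)) = ((2 * N * 2 ^ n).+1 ^ 6)%N.
  by rewrite -cardE card_prod !card_prod card_ord !expnS expn0 muln1 !mulnA.
have bbad n : (P (bad n) <= ((2 * N).+1%:R ^+ 6 * K * 2^-1 ^+ n)%:E)%E.
  have [_] := hbad n; rewrite sz => /le_trans; apply; rewrite lee_fin.
  (* A pair of points has six coordinates, hence at most (2 N + 1)^6 64^n pairs; against 128^-n
     there remains the summable 2^-n. *)
  have h : ((2 * N * 2 ^ n).+1 ^ 6)%:R <= (2 * N).+1%:R ^+ 6 * 64 ^+ n :> R.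
    rewrite natrX (_ : 64 = 2 ^+ 6); last by ring.
    rewrite -exprM (mulnC 6) exprM -exprMn; apply: lerXn2r; rewrite ?nnegrE ?mulr_ge0 ?exprn_ge0//.
    by rewrite -natrX -natrM ler_nat (mulSn (2 * N)) -add1n leq_add2r expn_gt0.
  have e : 2^-1 ^+ n = 64 ^+ n * 128^-1 ^+ n :> R by rewrite -exprMn; congr (_ ^+ n); field.
  rewrite e; have a0 : 0 <= K * 128^-1 ^+ n by rewrite mulr_ge0// exprn_ge0// invr_ge0 ler0n.
  apply: le_trans (ler_wpM2r a0 h) _.
  by rewrite [leLHS]mulrACA.
exists (lim_sup_set bad); split.
- exact: measurable_lim_sup_set.
- exact: borel_cantelli_geometric mbad bbad.
- move=> w hw; have [n0 hn0] := eventually_not_lim_sup hw; exists n0 => n n0n i j /= g1 g2 g12.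
  rewrite leNgt; apply/negP => h; apply: (hn0 n n0n); exists (i, j).
    by rewrite mem_enum.
  by rewrite /A /ok asboolT.
Qed.

(** For one fixed p a single increment per level is involved, so Borel-Cantelli applies without a
    union; this identifies the pathwise limit with X p. *)
Lemma controlled_dyadic_ae (R : realType) (d : measure_display) (Omega : measurableType d)
    (P : probability Omega R) (U : set (R * R * R)) (X : R * R * R -> Omega -> R) N p :
  (forall p, U p -> measurable_fun setT (X p)) ->
  controlled_increments P (inner U N.+1) X -> inner U N p ->
  {ae P, forall w, (fun n => X (dyadic3 n p) w) @ \oo --> X p w}.
Proof.
move=> mX [C [C0 hC]] Np; have Np1 := inner_mono (leqnSn N) Np.
(* Starting at level N keeps the approximations inside [inner U N.+1], where the increments are
   controlled. *)
pose A n : set Omega := [set w | (3 / 4) ^+ (n + N) < `|X (dyadic3 (n + N) p) w - X p w|].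
have ip n : inner U N.+1 (dyadic3 (n + N) p) by apply: inner_dyadic3 Np; exact: leq_addl.
have mA n : measurable (A n).
  by apply: measurable_norm_gt; apply: measurable_funB; apply: mX; [exact: inner_sub (ip n)|exact: inner_sub Np].
pose K : R := 2 * (1344 * C) ^+ 42.
have K0 : 0 <= K.
  apply: mulr_ge0; [exact: ler0n|apply: exprn_ge0; apply: mulr_ge0; first exact: ler0n].
  exact: ltW.
have bA n : (P (A n) <= (K * 2^-1 ^+ n)%:E)%E.
  have [gX vX] := hC _ _ (ip n) Np1.
  apply: le_trans (gaussian_level_tail gX C0 _) _.
    by apply: le_trans vX _; rewrite lee_fin ler_pM2l// dyadic3_dist.
  rewrite lee_fin ler_wpM2l// exprD.
  apply: (@le_trans _ _ (2^-1 ^+ n * 1)); last by rewrite mulr1.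
  apply: ler_pM; rewrite ?exprn_ge0 ?invr_ge0 ?ler0n//.
    by apply: lerXn2r; rewrite ?nnegrE ?invr_ge0 ?ler0n// lef_pV2 ?posrE ?ltr0n// ler_nat.
  by apply: exprn_ile1; rewrite ?invr_ge0 ?ler0n// invf_le1 ?ltr0n// ler1n.
exists (lim_sup_set A); split.
- exact: measurable_lim_sup_set.
- exact: borel_cantelli_geometric mA bA.
- move=> w /= h; apply: contrapT => hw; apply: h; have [n0 hn0] := eventually_not_lim_sup hw.
  apply/cvgrPdist_lt => e e0; have [n [n0n ne]] := small_pow34 (n0 + N) e0.
  exists n => // m /= nm; rewrite distrC.
  have Nm : (n0 + N <= m)%N := leq_trans n0n nm.
  have mE : (m = (m - N) + N)%N by rewrite subnK// (leq_trans (leq_addl _ _) Nm).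
  have n0m : (n0 <= m - N)%N by rewrite leq_subRL ?(leq_trans (leq_addl _ _) Nm)// addnC.
  have /negP := hn0 _ n0m; rewrite -leNgt -mE => /le_lt_trans; apply; apply: le_lt_trans ne.
  have : (3 / 4) ^+ m <= (3 / 4) ^+ n :> R by apply: ler_wiXn2l => //; lra.
  by have := exprn_ge0 n (_ : 0 <= 3 / 4 :> R); lra.
Qed.

Theorem kolmogorov_continuous_version (R : realType) (d : measure_display) (Omega : measurableType d)
    (P : probability Omega R) (U : set (R * R * R)) (X : R * R * R -> Omega -> R) :
  open U -> (forall p, U p -> measurable_fun setT (X p)) ->
  (forall N, controlled_increments P (inner U N) X) ->
  exists V : R * R * R -> Omega -> R,
    (forall w p, U p -> {for p, continuous (fun q => V q w)}) /\
    (forall p, U p -> measurable_fun setT (V p) /\ {ae P, forall w, V p w = X p w}).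
Proof.
move=> oU mX hX.
have hB N := grid_bound_ae mX (hX N).
pose B N := projT1 (cid (hB N)).
have [mB PB gB] : [/\ forall N, measurable (B N), forall N, P (B N) = 0%E & forall N w, ~ B N w ->
    exists n0, forall n, (n0 <= n)%N -> grid_bound U N n (fun p => X p w)].
  by split=> N; rewrite /B; case: (cid (hB N)) => /= ? [].
pose Bad := \bigcup_N B N.
have mBad : measurable Bad by exact: bigcup_measurable.
have PBad : P.-negligible Bad.
  by apply: negligible_bigcup => N; apply/negligibleP; [exact: mB|exact: PB].
(* The value 0 on the exceptional null event makes every path continuous on U, not merely almost
   every one. *)
pose V p w := if w \in Bad then 0 else limn (fun n => X (dyadic3 n p) w).
have Vgood w : ~ Bad w -> forall N, exists n0, forall n, (n0 <= n)%N -> grid_bound U N n (fun p => X p w).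
  by move=> hw N; apply: gB => BN; apply: hw; exists N.
have Vcvg w p : ~ Bad w -> U p -> cvgn (fun n => X (dyadic3 n p) w).
  move=> hw Up; have [N Np] := inner_cover oU Up; have [n0 hn0] := Vgood w hw N.+1.
  have [] // := dyadic_limit (n0 := maxn n0 N) _ (leq_maxr _ _) Np (x := fun p => X p w).
  by move=> n h; apply: hn0; exact: leq_trans (leq_maxl _ _) h.
exists V; split.
  move=> w p Up; have [hw|/negP hw] := boolP (w \in Bad).
    rewrite (_ : (fun q => V q w) = fun=> 0); first exact: cst_continuous.
    by apply/funext => q; rewrite /V hw.
  rewrite (_ : (fun q => V q w) = fun q => limn (fun n => X (dyadic3 n q) w)); last first.
    by apply/funext => q; rewrite /V; case: ifPn.
  apply: (dyadic_limit_continuous (x := fun p => X p w) oU Up); apply: Vgood.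
  by move=> h; apply: hw; exact: mem_set.
move=> p Up; split.
  have [N Np] := inner_cover oU Up.
  (* The shift by N ensures that the dyadic points lie in U, where X is known to be measurable. *)
  apply: (measurable_fun_cvg (h := fun n w => if w \in Bad then 0 else X (dyadic3 (n + N) p) w)).
    move=> n; apply: measurable_fun_ifT => //; last first.
      by apply: mX; apply: (@inner_sub _ _ N.+1); apply: inner_dyadic3 Np; exact: leq_addl.
    apply: (measurable_fun_bool true); rewrite setTI (_ : _ @^-1` _ = Bad)//.
    by apply/seteqP; split => w; rewrite /preimage /= ?inE; [move/set_mem|move/mem_set].
  move=> w _; rewrite /V; case: ifPn => [_|/negP hw]; first exact: cvg_cst.
  have hw' : ~ Bad w by move=> h; apply: hw; exact: mem_set.
  by have := Vcvg w p hw' Up; rewrite -(cvg_shiftn N).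
have [N Np] := inner_cover oU Up.
have h1 : {ae P, forall w, (fun n => X (dyadic3 n p) w) @ \oo --> X p w}.
  exact: controlled_dyadic_ae mX (hX N.+1) Np.
have h2 : {ae P, forall w, ~ Bad w} by apply: negligibleS PBad => w /=; exact: contrapT.
apply: filterS2 h1 h2 => w Xw Bw; rewrite /V ifF; last by apply/negP => /set_mem.
by apply/cvg_lim.
Qed.

(** * Hyperbolic averages of the free field *)

Lemma tanh_artanh (R : realType) (x : R) : 0 < x -> x < 1 -> 0 < artanh x /\ tanh (artanh x) = x.
Proof.
move=> x0 x1; have q1 : 1 < (1 + x) / (1 - x) by rewrite ltr_pdivlMr; lra.
have l0 : 0 < ln ((1 + x) / (1 - x)) by rewrite ln_gt0.
split; first by rewrite mulr_gt0// invr_gt0.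
rewrite /tanh /artanh; set y := 2^-1 * _.
have E2 : expR y ^+ 2 = (1 + x) / (1 - x).
  rewrite -expRM_natl mulr_natl /y -mulrnAl -mulr_natl mulfV// mul1r lnK// posrE.
  exact: lt_trans q1.
have e0 : expR y != 0 by rewrite gt_eqF// expR_gt0.
rewrite expRN.
have -> : (expR y - (expR y)^-1) / (expR y + (expR y)^-1) = (expR y ^+ 2 - 1) / (expR y ^+ 2 + 1).
  have : expR y ^+ 2 + 1 != 0 by rewrite gt_eqF// ltr_wpDl// sqr_ge0.
  move: e0; move: (expR y) => e e0 h; by field; rewrite h e0.
by rewrite E2; field; apply/andP; split; lra.
Qed.

Lemma tanhE (R : realType) (x : R) : tanh x = 1 - 2 / (1 + expR (2 * x)).
Proof.
rewrite /tanh expRN (_ : 2 * x = x + x); last by ring.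
rewrite expRD; have := expR_gt0 x; move: (expR x) => e e0.
have e2 := mulr_gt0 e0 e0.
by field; rewrite !gt_eqF ?addr_gt0.
Qed.

Lemma tanh_le (R : realType) (x y : R) : x <= y -> tanh x <= tanh y.
Proof.
move=> xy; rewrite !tanhE lerD2l lerN2 ler_pM2l// lef_pV2 ?posrE ?addr_gt0 ?expR_gt0//.
by rewrite lerD2l ler_expR ler_pM2l.
Qed.

(** Writing exp (2 y) = exp (2 x) exp (- 2 (x - y)) and using exp (- s) >= 1 - s bounds the
    numerator. *)
Lemma tanh_lipschitz (R : realType) (x y : R) : `|tanh x - tanh y| <= 4 * `|x - y|.
Proof.
wlog xy : x y / y <= x.
  by move=> h; have [/h//|/ltW/h] := leP y x; rewrite distrC (distrC x).
rewrite !ger0_norm ?subr_ge0 ?tanh_le// !tanhE.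
have -> : 1 - 2 / (1 + expR (2 * x)) - (1 - 2 / (1 + expR (2 * y))) =
  2 * (expR (2 * x) - expR (2 * y)) / ((1 + expR (2 * x)) * (1 + expR (2 * y))).
  have := expR_gt0 (2 * x); have := expR_gt0 (2 * y); move: (expR _) (expR _) => a b b0 a0.
  by field; rewrite !gt_eqF ?addr_gt0.
have -> : expR (2 * y) = expR (2 * x) * expR (- (2 * (x - y))) by rewrite -expRD; congr expR; ring.
have h := expR_ge1Dx (- (2 * (x - y))).
have e0 := expR_gt0 (2 * x); have f0 := expR_gt0 (- (2 * (x - y))).
move: h e0 f0; move: (expR _) (expR _) => e f h e0 f0.
rewrite ler_pdivrMr; last by rewrite mulr_gt0 ?addr_gt0 ?mulr_gt0.
have h2 : 2 * (e - e * f) <= 4 * (x - y) * e by nra.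
apply: le_trans h2 _; rewrite ler_wpM2l ?mulr_ge0 ?subr_ge0//.
have := mulr_gt0 e0 f0; nra.
Qed.

Lemma dirichlet_ge0 (R : realType) (u : R * R -> R) : 0 <= dirichlet u u.
Proof.
rewrite mulr_ge0 ?invr_ge0 ?mulr_ge0 ?pi_ge0//; apply: Rintegral_ge0 => z _.
by rewrite addr_ge0// -expr2 sqr_ge0.
Qed.

Lemma Lfun2P (R : realType) (d : measure_display) (Omega : measurableType d)
    (P : probability Omega R) (X : Omega -> R) : measurable_fun setT X ->
  (\int[P]_w (X w ^+ 2)%:E < +oo)%E -> X \in Lfun P 2%:E.
Proof.
move=> mX iX; rewrite inE; apply/andP; split; first by rewrite inE.
rewrite inE /= /finite_norm unlock /= poweR_lty//.
rewrite (_ : (\int[P]_x (`|(EFin \o X) x| `^ 2) = \int[P]_w (X w ^+ 2)%:E)%E)//.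
by apply: eq_integral => w _ /=; rewrite powR_mulrn// real_normK// num_real.
Qed.

Lemma Lnorm2_sqr (R : realType) (d : measure_display) (Omega : measurableType d)
    (P : probability Omega R) (X : Omega -> R) (x : R) : 0 <= x ->
  ('N[P]_(2%:E)[EFin \o X] = (Num.sqrt x)%:E -> \int[P]_w (X w ^+ 2)%:E = x%:E)%E.
Proof.
move=> x0 NX; have := @poweR_Lnorm _ _ _ P (EFin \o X) 2; rewrite NX /= powR_mulrn ?sqrtr_ge0//.
rewrite sqr_sqrtr// => ->//.
by apply: eq_integral => w _ /=; rewrite powR_mulrn// real_normK// num_real.
Qed.

(* Y is a version of the random variable W u. *)
Definition represents (R : realType) (d : measure_display) (Omega : measurableType d)
    (P : probability Omega R) (W : (R * R -> R) -> Omega -> R) (u : R * R -> R) (Y : Omega -> R) : Prop :=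
  [/\ sobolev_H10 u, measurable_fun setT Y & {ae P, forall w, Y w = W u w}].

Lemma represents_lin (R : realType) (d : measure_display) (Omega : measurableType d)
    (P : probability Omega R) (W : (R * R -> R) -> Omega -> R) (a : R) (u v : R * R -> R) (Y Z : Omega -> R) :
  gaussian_free_field P W -> represents P W u Y -> represents P W v Z ->
  represents P W (fun z => a * u z + v z) (fun w => a * Y w + Z w).
Proof.
move=> [_ lin _ _] [Hu mY Yu] [Hv mZ Zv]; split.
- exact: sobolev_H10_lin Hu Hv.
- by apply: measurable_funD => //; exact: measurable_funM.
- by apply: filterS3 Yu Zv (lin a u v Hu Hv) => w -> -> ->.
Qed.

Lemma represents_sub (R : realType) (d : measure_display) (Omega : measurableType d)
    (P : probability Omega R) (W : (R * R -> R) -> Omega -> R) (u v : R * R -> R) (Y Z : Omega -> R) :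
  gaussian_free_field P W -> represents P W u Y -> represents P W v Z ->
  represents P W (u \- v) (fun w => Y w - Z w).
Proof.
move=> gW rY rZ; have := represents_lin (-1) gW rZ rY.
rewrite (_ : (fun z => -1 * v z + u z) = u \- v); last by apply/funext => z; rewrite mulN1r addrC.
by rewrite (_ : (fun w => -1 * Z w + Y w) = fun w => Y w - Z w)//; apply/funext => w; rewrite mulN1r addrC.
Qed.

Lemma represents_sum (R : realType) (d : measure_display) (Omega : measurableType d)
    (P : probability Omega R) (W : (R * R -> R) -> Omega -> R) n
    (u : 'I_n -> R * R -> R) (Y : 'I_n -> Omega -> R) (c : 'I_n -> R) :
  gaussian_free_field P W -> (forall k, represents P W (u k) (Y k)) ->
  exists v, represents P W v (fun w => \sum_(k < n) c k * Y k w).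
Proof.
move=> gW; elim: n u Y c => [|n IH] u Y c rY.
  have d0 : disk ((0, 0) : R * R) by apply/disk_sqnorm; rewrite /sqnorm /= mul0r addr0.
  (* The empty sum is represented as W g - W g for some g known to lie in H^1_0, here a Green
     function. *)
  have [_ Hg] := @green_sobolev R 2^-1 (0, 0) (ltac:(by rewrite invr_gt0)) (ltac:(by rewrite invf_lt1 ?ltr1n)) d0.
  have [L2 _ _ _] := gW; pose g := green (2^-1 : R) (0, 0).
  have rg : represents P W g (W g).
    split; [exact: Hg| |exact: aeW].
    by have := L2 g Hg; rewrite inE => /andP[+ _]; rewrite inE.
  exists (g \- g); rewrite (_ : (fun w => _) = fun w => W g w - W g w).
    exact: (represents_sub gW rg rg).
  by apply/funext => w; rewrite big_ord0 subrr.
have [v rv] := IH _ _ (fun k => c (widen_ord (leqnSn n) k)) (fun k => rY (widen_ord (leqnSn n) k)).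
eexists; rewrite (_ : (fun w => _) = fun w => c ord_max * Y ord_max w +
    \sum_(k < n) c (widen_ord (leqnSn n) k) * Y (widen_ord (leqnSn n) k) w).
  exact: represents_lin gW (rY ord_max) rv.
by apply/funext => w; rewrite big_ord_recr /= addrC.
Qed.

Lemma represents_gaussian (R : realType) (d : measure_display) (Omega : measurableType d)
    (P : probability Omega R) (W : (R * R -> R) -> Omega -> R) (u : R * R -> R) (Y : Omega -> R) :
  gaussian_free_field P W -> represents P W u Y -> centred_gaussian P Y.
Proof. by move=> [_ _ _ gau] [Hu mY Yu]; exact: centred_gaussian_ae (gau u Hu) mY Yu. Qed.

Lemma represents_sqr (R : realType) (d : measure_display) (Omega : measurableType d)
    (P : probability Omega R) (W : (R * R -> R) -> Omega -> R) (u : R * R -> R) (Y : Omega -> R) :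
  gaussian_free_field P W -> represents P W u Y ->
  (\int[P]_w (Y w ^+ 2)%:E = (dirichlet u u)%:E)%E.
Proof.
move=> [L2 _ nrm _] [Hu mY Yu]; have mW : measurable_fun setT (W u).
  by have := L2 u Hu; rewrite inE => /andP[+ _]; rewrite inE.
rewrite -(Lnorm2_sqr (dirichlet_ge0 u) (nrm u Hu)).
apply: ae_eq_integral => //.
- by apply/measurable_EFinP; exact: measurable_funX.
- by apply/measurable_EFinP; exact: measurable_funX.
- by apply: filterS Yu => w -> _.
Qed.

(* Polarization, with the Dirichlet form of u - v in place of that of u + v. *)
Lemma represents_covariance (R : realType) (d : measure_display) (Omega : measurableType d)
    (P : probability Omega R) (W : (R * R -> R) -> Omega -> R) (u v : R * R -> R) (Y Z : Omega -> R) :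
  gaussian_free_field P W -> represents P W u Y -> represents P W v Z ->
  covariance P Y Z = (2^-1 * (dirichlet u u + dirichlet v v - dirichlet (u \- v) (u \- v)))%:E.
Proof.
move=> gW rY rZ; have rYZ := represents_sub gW rY rZ.
have L2 x X : represents P W x X -> X \in Lfun P 2%:E.
  by move=> rX; apply: Lfun2P; [case: rX|rewrite (represents_sqr gW rX) ltry].
have L1 x X : represents P W x X -> X \in Lfun P 1.
  by move=> rX; apply: Lfun_subset12; [exact: fin_num_measure|exact: L2 rX].
have E0 x X : represents P W x X -> expectation P X = 0%E.
  move=> rX; rewrite unlock; apply: centred_gaussian_expectation (represents_gaussian gW rX) _.
  exact/Lfun1_integrable/(L1 _ _ rX).
have LYZ : (Y * Z)%R \in Lfun P 1 := Lfun2_mul_Lfun1 (L2 _ _ rY) (L2 _ _ rZ).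
rewrite covarianceE ?(L1 _ _ rY) ?(L1 _ _ rZ)// (E0 _ _ rY) mul0e sube0 unlock.
have iY := Lfun2_integrable_sqr (L2 _ _ rY); have iZ := Lfun2_integrable_sqr (L2 _ _ rZ).
have iYZ := Lfun2_integrable_sqr (L2 _ _ rYZ).
have iS := integrableD measurableT iY iZ; have iD := integrableB measurableT iS iYZ.
transitivity (\int[P]_w ((2^-1)%:E * (((Y w ^+ 2)%:E + (Z w ^+ 2)%:E) - ((Y w - Z w) ^+ 2)%:E)))%E.
  apply: eq_integral => w _; rewrite -[RHS]/((2^-1 * (Y w ^+ 2 + Z w ^+ 2 - (Y w - Z w) ^+ 2))%:E).
  by congr (_%:E); rewrite -[LHS]/(Y w * Z w); field.
rewrite integralZl// integralB// integralD//.
by rewrite (represents_sqr gW rY) (represents_sqr gW rZ) (represents_sqr gW rYZ).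
Qed.

Lemma dirichlet_eq_disk (R : realType) (u v p q : R * R -> R) :
  (forall z, disk z -> u z = v z) -> weak_gradient u p q -> dirichlet u u = dirichlet v v.
Proof.
by move=> uv gu; rewrite (dirichletE gu gu) (dirichletE (weak_gradient_eq uv gu) (weak_gradient_eq uv gu)).
Qed.

(** The gradient of the difference lives on the annulus k < q <= m, so its energy is the difference
    of the two energies. *)
Lemma dirichlet_green_sub (R : realType) (k m : R) (z : R * R) :
  0 < k -> k <= m -> m < 1 -> disk z ->
  dirichlet (green k z \- green m z) (green k z \- green m z) = 2^-1 * (ln m - ln k).
Proof.
move=> k0 km m1 dz; have k1 := le_lt_trans km m1; have m0 := lt_le_trans k0 km.
have [gk _] := green_sobolev k0 k1 dz; have [gm _] := green_sobolev m0 m1 dz.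
have g := weak_gradient_sub gk gm; rewrite (dirichletE g g).
have mD := @measurable_disk R.
transitivity ((2 * pi)^-1 * \int[leb2]_(w in disk) (green_density k z w - green_density m z w)).
  congr (_ * _); apply: eq_Rintegral => w _; rewrite /green_density /dgreen /=.
  have [mq|qm] := ltP m (phdist2 z w); last by rewrite !subr0 expr0n/= !addr0 subr0 !expr2.
  by rewrite (le_lt_trans km mq) !subrr mul0r addr0.
rewrite (RintegralB mD (integrable_green_density k0 k1 dz) (integrable_green_density m0 m1 dz)).
rewrite (green_energy k0 k1 dz) (green_energy m0 m1 dz).
by move: (@pi R) (lt0r_neq0 (pi_gt0 R)) => p p0; field.
Qed.

Lemma sqr_tanh_bounds (R : realType) (x : R) : 0 < x -> 0 < tanh x ^+ 2 /\ tanh x ^+ 2 < 1.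
Proof.
move=> /tanh_bounds[t0 t1]; split; first by rewrite exprn_gt0.
by rewrite expr_lt1// ltW.
Qed.

Definition average_kernel (R : realType) (Phi : R * R -> R * R -> R * R) (p : R * R * R) : R * R -> R :=
  G0 (tanh p.2) \o Phi p.1.

Lemma average_kernel_green (R : realType) (Phi : R * R -> R * R -> R * R) (z w : R * R) (rho : R) :
  (forall z, disk z -> poincare_isometry (Phi z) /\ Phi z z = 0) -> disk z -> 0 < rho -> disk w ->
  green (tanh rho ^+ 2) z w = average_kernel Phi (z, rho) w.
Proof.
move=> hPhi dz r0 dw; have [iP P0] := hPhi z dz; have [t0 _] := tanh_bounds r0.
by rewrite /average_kernel /= (G0_isometry iP dz P0 dw t0).
Qed.

Lemma represents_average (R : realType) (d : measure_display) (Omega : measurableType d)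
    (P : probability Omega R) (W : (R * R -> R) -> Omega -> R) (Phi : R * R -> R * R -> R * R)
    (z : R * R) (rho : R) :
  gaussian_free_field P W ->
  (forall z, disk z -> poincare_isometry (Phi z) /\ Phi z z = 0) -> disk z -> 0 < rho ->
  represents P W (average_kernel Phi (z, rho)) (hyperbolic_average W Phi rho z).
Proof.
move=> [L2 _ _ _] hPhi dz r0; have [k0 k1] := sqr_tanh_bounds r0.
have [_ H] := green_sobolev k0 k1 dz.
have Hk : sobolev_H10 (average_kernel Phi (z, rho)).
  by apply: sobolev_H10_eq H => w dw; exact: average_kernel_green.
split; [exact: Hk| |exact: aeW].
suff : W (average_kernel Phi (z, rho)) \in Lfun P 2%:E by rewrite inE => /andP[+ _]; rewrite inE.
exact: L2.
Qed.

Lemma dirichlet_average_sub (R : realType) (Phi : R * R -> R * R -> R * R) (z z' : R * R)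
    (rho rho' k k' : R) :
  (forall z, disk z -> poincare_isometry (Phi z) /\ Phi z z = 0) ->
  disk z -> 0 < rho -> disk z' -> 0 < rho' -> tanh rho ^+ 2 = k -> tanh rho' ^+ 2 = k' ->
  dirichlet (average_kernel Phi (z, rho) \- average_kernel Phi (z', rho'))
    (average_kernel Phi (z, rho) \- average_kernel Phi (z', rho')) =
  dirichlet (green k z \- green k' z') (green k z \- green k' z').
Proof.
move=> hPhi dz r0 dz' r0' kE kE'; have [k0 k1] := sqr_tanh_bounds r0; have [k0' k1'] := sqr_tanh_bounds r0'.
have [g _] := green_sobolev k0 k1 dz; have [g' _] := green_sobolev k0' k1' dz'.
rewrite -kE -kE'; apply/esym/(dirichlet_eq_disk _ (weak_gradient_sub g g')) => w dw /=.
by rewrite (average_kernel_green hPhi dz r0 dw) (average_kernel_green hPhi dz' r0' dw).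
Qed.

Lemma inner_disk_bounds (R : realType) N (p : R * R * R) :
  inner ((@disk R `*` `]0, +oo[) : set (R * R * R)) N p ->
  sqnorm p.1 <= 1 - (2^-1 ^+ N) ^+ 2 /\ 2^-1 ^+ N <= p.2.
Proof.
case: p => [[a b] r] [_ h]; set e : R := 2^-1 ^+ N.
have e0 : 0 <= e by rewrite exprn_ge0.
have hx (s : R) : `|s| <= e -> disk (a + s, b).
  move=> se; have [] // := h ((a + s, b), r); rewrite norm3_le /= !subrr normr0 addrC addKr.
  have -> : 0 <= 2 * 2^-1 ^+ N :> R by rewrite -/e mulr_ge0.
  by rewrite andbT /= -/e; lra.
have hr : 0 < r - e.
  have [] // := h ((a, b), r - e); last by rewrite /= in_itv/= andbT.
  rewrite norm3_le /= !subrr normr0 addrC addKr normrN (ger0_norm e0) -/e.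
  by rewrite mulr_ge0//=; lra.
split => /=; last by lra.
have /disk_sqnorm h1 : disk (a + e, b) by apply: hx; rewrite ger0_norm.
have /disk_sqnorm h2 : disk (a + - e, b) by apply: hx; rewrite normrN ger0_norm.
by move: h1 h2; rewrite /sqnorm /=; nra.
Qed.

Lemma average_controlled_increments (R : realType) (d : measure_display) (Omega : measurableType d)
    (P : probability Omega R) (W : (R * R -> R) -> Omega -> R) (Phi : R * R -> R * R -> R * R) N :
  gaussian_free_field P W ->
  (forall z, disk z -> poincare_isometry (Phi z) /\ Phi z z = 0) ->
  controlled_increments P (inner ((@disk R `*` `]0, +oo[) : set (R * R * R)) N)
    (fun p => hyperbolic_average W Phi p.2 p.1).
Proof.
move=> gW hPhi; pose e : R := 2^-1 ^+ N; have e0 : 0 < e by rewrite exprn_gt0.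
have [k0 _] := sqr_tanh_bounds e0.
have r1 : 1 - e ^+ 2 < 1 by rewrite ltrBlDr ltrDl exprn_gt0.
have [C hC] := green_modulus r1 k0.
(* 10 = 2 + 8: [dist1] is at most twice the maximum norm, and tanh^2 varies by at most 2 * 4 times
   the distance. *)
exists (10 * (`|C| + 1)); split; first by rewrite mulr_gt0// ltr_wpDl.
move=> p q Kp Kq.
have [pz pr] := inner_disk_bounds Kp; have [qz qr] := inner_disk_bounds Kq.
have dp : disk p.1 by apply/disk_sqnorm; exact: le_lt_trans r1.
have dq : disk q.1 by apply/disk_sqnorm; exact: le_lt_trans r1.
have p0 : 0 < p.2 by exact: lt_le_trans pr.
have q0 : 0 < q.2 by exact: lt_le_trans qr.
have rep z rho := @represents_average _ _ _ P W Phi z rho gW hPhi.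
have rpq := represents_sub gW (rep _ _ dp p0) (rep _ _ dq q0).
split; first exact: represents_gaussian gW rpq.
rewrite (represents_sqr gW rpq) lee_fin (dirichlet_average_sub hPhi dp p0 dq q0 erefl erefl).
have kb x : e <= x -> tanh e ^+ 2 <= tanh x ^+ 2.
  move=> ex; have [t0 _] := tanh_bounds e0; have [t1 _] := tanh_bounds (lt_le_trans e0 ex).
  by rewrite ler_pXn2r ?nnegrE ?(ltW t0) ?(ltW t1)// tanh_le.
have [_ p1] := sqr_tanh_bounds p0; have [_ q1] := sqr_tanh_bounds q0.
apply: le_trans (hC _ _ _ _ pz qz (kb _ pr) p1 (kb _ qr) q1) _.
have /and3P[n1 n2 n3] : [&& `|p.1.1 - q.1.1| <= `|p - q|, `|p.1.2 - q.1.2| <= `|p - q| & `|p.2 - q.2| <= `|p - q|].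
  by have := norm3_le (p - q) `|p - q|; rewrite lexx.
have dk : `|tanh p.2 ^+ 2 - tanh q.2 ^+ 2| <= 8 * `|p - q|.
  rewrite subr_sqr normrM.
  have [t0 t1] := tanh_bounds p0; have [t2 t3] := tanh_bounds q0.
  have := tanh_lipschitz p.2 q.2; rewrite (ger0_norm (x := tanh p.2 + tanh q.2)); last by rewrite addr_ge0// ltW.
  have := normr_ge0 (tanh p.2 - tanh q.2); nra.
have d0 : 0 <= dist1 p.1 q.1 + `|tanh p.2 ^+ 2 - tanh q.2 ^+ 2| by rewrite !addr_ge0.
apply: (@le_trans _ _ ((`|C| + 1) * (dist1 p.1 q.1 + `|tanh p.2 ^+ 2 - tanh q.2 ^+ 2|))).
  by rewrite ler_wpM2r//; have := ler_norm C; lra.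
rewrite mulrAC mulrC ler_wpM2r ?addr_ge0//.
by rewrite /dist1; lra.
Qed.

Lemma represents_ae (R : realType) (d : measure_display) (Omega : measurableType d)
    (P : probability Omega R) (W : (R * R -> R) -> Omega -> R) (u : R * R -> R) (Y Z : Omega -> R) :
  represents P W u Y -> measurable_fun setT Z -> {ae P, forall w, Z w = Y w} -> represents P W u Z.
Proof. by move=> [Hu _ Yu] mZ ZY; split => //; apply: filterS2 Yu ZY => w <- ->. Qed.

Lemma represents_gaussian_process (R : realType) (d : measure_display) (Omega : measurableType d)
    (P : probability Omega R) (W : (R * R -> R) -> Omega -> R) (I : Type) (A : set I) (X : I -> Omega -> R) :
  gaussian_free_field P W -> (forall i, A i -> exists u, represents P W u (X i)) ->
  centred_gaussian_process P A X.
Proof.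
move=> gW rX n i c Ai; have [|v rv] := @represents_sum _ _ _ P W n
  (fun k => projT1 (cid (rX (i k) (Ai k)))) (fun k => X (i k)) c gW.
  by move=> k; case: (cid (rX (i k) (Ai k))).
exact: represents_gaussian gW rv.
Qed.

(** * The radial process is a Brownian motion *)

(* B is the radial process of the theorem, at the centre z. *)
Definition radial (R : realType) (d : measure_display) (Omega : measurableType d)
    (P : probability Omega R) (W : (R * R -> R) -> Omega -> R) (Phi : R * R -> R * R -> R * R)
    (z : R * R) (B : R -> Omega -> R) : Prop :=
  B 0 = (fun=> 0) /\ forall t, 0 < t -> represents P W (average_kernel Phi (z, artanh (expR (- t)))) (B t).

Lemma artanh_expRN (R : realType) (t : R) : 0 < t ->
  0 < artanh (expR (- t)) /\ tanh (artanh (expR (- t))) ^+ 2 = expR (- (2 * t)).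
Proof.
move=> t0; have [|a0 ->] := @tanh_artanh R (expR (- t)) (expR_gt0 _).
  by rewrite -expR0 ltr_expR oppr_lt0.
by split; rewrite // -expRM_natl; congr expR; ring.
Qed.

Lemma radial_represents (R : realType) (d : measure_display) (Omega : measurableType d)
    (P : probability Omega R) (W : (R * R -> R) -> Omega -> R) (Phi : R * R -> R * R -> R * R)
    (z : R * R) (B : R -> Omega -> R) (t : R) :
  gaussian_free_field P W -> radial P W Phi z B -> 0 <= t -> exists u, represents P W u (B t).
Proof.
move=> gW [B0 Bt]; rewrite le_eqVlt => /predU1P[<-|t0]; last by eexists; exact: Bt.
have [] // := @represents_sum _ _ _ P W 0 (fun=> fun=> 0) (fun=> fun=> 0) (fun=> 0) gW.
  by case.
move=> u ru; exists u; rewrite B0 (_ : (fun=> 0) = fun w : Omega => \sum_(k < 0) 0 * 0)//.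
by apply/funext => w; rewrite big_ord0.
Qed.

(** With levels k = exp (- 2 s) and m = exp (- 2 t), the energy 1/2 (ln m - ln k) is s - t. Time 0
    would correspond to the excluded level 1 and is treated apart, through B 0 = 0. *)
Lemma radial_increment (R : realType) (d : measure_display) (Omega : measurableType d)
    (P : probability Omega R) (W : (R * R -> R) -> Omega -> R) (Phi : R * R -> R * R -> R * R)
    (z : R * R) (B : R -> Omega -> R) (s t : R) :
  gaussian_free_field P W -> (forall z, disk z -> poincare_isometry (Phi z) /\ Phi z z = 0) ->
  disk z -> radial P W Phi z B -> 0 <= s -> 0 <= t ->
  (\int[P]_w ((B s w - B t w) ^+ 2)%:E = `|s - t|%:E)%E.
Proof.
move=> gW hPhi dz [B0 Bt]; wlog st : s t / t <= s.
  move=> h s0 t0; have [ts|/ltW st] := leP t s; first exact: h.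
  rewrite distrC -h//; apply: eq_integral => w _; congr (_%:E); ring.
move=> s0 t0; have [s00|sn0] := eqVneq s 0.
  have t00 : t = 0 by apply/eqP; rewrite eq_le t0 andbT -s00.
  rewrite s00 t00 subrr normr0; under eq_integral do rewrite subrr expr0n /=.
  by rewrite integral0.
have s1 : 0 < s by rewrite lt_neqAle eq_sym sn0.
have [as0 asE] := artanh_expRN s1.
have es1 : expR (- (2 * s)) < 1 by rewrite -[ltRHS]expR0 ltr_expR oppr_lt0 mulr_gt0.
rewrite ger0_norm ?subr_ge0//; have [t00|tn0] := eqVneq t 0.
  rewrite t00 B0 subr0 -(_ : (\int[P]_w (B s w ^+ 2)%:E = \int[P]_w ((B s w - 0) ^+ 2)%:E)%E); last first.
    by apply: eq_integral => w _; rewrite subr0.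
  rewrite (represents_sqr gW (Bt _ s1)); congr (_%:E).
  have [gs _] := green_sobolev (expR_gt0 (- (2 * s))) es1 dz.
  rewrite -(@dirichlet_eq_disk _ (green (expR (- (2 * s))) z) _ _ _ _ gs).
    by rewrite dirichlet_green ?expR_gt0// maxxx expRK; field.
  by move=> w dw; rewrite -asE; exact: average_kernel_green.
have t1 : 0 < t by rewrite lt_neqAle eq_sym tn0.
have [at0 atE] := artanh_expRN t1.
have et1 : expR (- (2 * t)) < 1 by rewrite -[ltRHS]expR0 ltr_expR oppr_lt0 mulr_gt0.
rewrite (represents_sqr gW (represents_sub gW (Bt _ s1) (Bt _ t1))); congr (_%:E).
rewrite (dirichlet_average_sub hPhi dz as0 dz at0 asE atE).
have est : expR (- (2 * s)) <= expR (- (2 * t)) by rewrite ler_expR lerN2 ler_pM2l.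
by rewrite (dirichlet_green_sub (expR_gt0 _) est et1 dz) !expRK; field.
Qed.

(** By polarization, as 1/2 (s + t - |s - t|) = min(s, t). *)
Lemma radial_covariance (R : realType) (d : measure_display) (Omega : measurableType d)
    (P : probability Omega R) (W : (R * R -> R) -> Omega -> R) (Phi : R * R -> R * R -> R * R)
    (z : R * R) (B : R -> Omega -> R) (s t : R) :
  gaussian_free_field P W -> (forall z, disk z -> poincare_isometry (Phi z) /\ Phi z z = 0) ->
  disk z -> radial P W Phi z B -> 0 <= s -> 0 <= t ->
  covariance P (B s) (B t) = (Num.min s t)%:E.
Proof.
move=> gW hPhi dz rB s0 t0.
have [u ru] := radial_represents gW rB s0; have [v rv] := radial_represents gW rB t0.
have D x r : 0 <= r -> represents P W x (B r) -> dirichlet x x = r.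
  move=> r0 rx; apply: EFin_inj; rewrite -(represents_sqr gW rx).
  have := radial_increment gW hPhi dz rB r0 (lexx 0); rewrite subr0 ger0_norm// => <-.
  by apply: eq_integral => w _; rewrite (proj1 rB) subr0.
have Duv : dirichlet (u \- v) (u \- v) = `|s - t|.
  by apply: EFin_inj; rewrite -(represents_sqr gW (represents_sub gW ru rv)) (radial_increment gW hPhi dz rB).
rewrite (represents_covariance gW ru rv) (D _ _ s0 ru) (D _ _ t0 rv) Duv; congr (_%:E).
have [st|ts] := leP s t; first by rewrite ler0_norm ?subr_le0//; field.
by rewrite gtr0_norm ?subr_gt0//; field.
Qed.

Lemma continuous_artanh (R : realType) (x : R) : 0 < x -> x < 1 -> {for x, continuous (@artanh R)}.
Proof.
move=> x0 x1; apply: (@cvgM _ _ _ _ (fun=> 2^-1) (fun x : R => ln ((1 + x) / (1 - x)))); first exact: cvg_cst.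
apply: (@continuous_comp _ _ _ (fun x : R => (1 + x) / (1 - x)) (@ln R)).
  apply: cvgM; first by apply: cvgD; [exact: cvg_cst|exact: cvg_id].
  apply: cvgV; first by rewrite gt_eqF// subr_gt0.
  by apply: cvgB; [exact: cvg_cst|exact: cvg_id].
by apply: continuous_ln; rewrite divr_gt0; lra.
Qed.

Lemma eq_continuous_rat (R : realType) (f g : R -> R) :
  (forall t, 0 < t -> {for t, continuous f}) -> (forall t, 0 < t -> {for t, continuous g}) ->
  (forall q : rat, 0 < (ratr q : R) -> f (ratr q) = g (ratr q)) ->
  forall t, 0 < t -> f t = g t.
Proof.
move=> cf cg fg t t0; apply: contrapT => /eqP ft.
have ch : (fun s => f s - g s) @ t --> f t - g t by apply: cvgB; [exact: cf|exact: cg].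
have h0 : 0 < `|f t - g t| by rewrite normr_gt0 subr_eq0.
move/cvgrPdist_lt : ch => /(_ _ h0) /nbhs_ballP[e /= e0 he].
have te : t < t + e by rewrite ltrDl.
have [q] := rat_in_itvoo te.
rewrite in_itv/= => /andP[tq qt].
have := he (ratr q); rewrite /ball /= fg ?(lt_trans t0 tq)// subrr subr0 ltxx => H.
suff : false by []; apply: H.
by rewrite distrC gtr0_norm ?subr_gt0// ltrBlDl.
Qed.

(** The criterion is applied on R^3 to a process depending on the last coordinate only. It yields a
    continuous process Z whose paths almost surely coincide with those of B on [0, +oo[, so that B
    itself, and not just a version of it, is continuous at 0. *)
Lemma radial_continuous (R : realType) (d : measure_display) (Omega : measurableType d)
    (P : probability Omega R) (W : (R * R -> R) -> Omega -> R) (Phi : R * R -> R * R -> R * R)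
    (z : R * R) (B : R -> Omega -> R) :
  gaussian_free_field P W -> (forall z, disk z -> poincare_isometry (Phi z) /\ Phi z z = 0) ->
  disk z -> radial P W Phi z B -> (forall t w, 0 < t -> {for t, continuous (fun s => B s w)}) ->
  {ae P, forall w, {within `[0, +oo[, continuous (fun t => B t w)}}.
Proof.
move=> gW hPhi dz rB cB; pose X (p : R * R * R) := B `|p.2|.
have [||N|V [cV VX]] := @kolmogorov_continuous_version R d Omega P setT X.
- exact: openT.
- by move=> p _; have [u []] := radial_represents gW rB (normr_ge0 p.2).
- exists 1; split=> // p q _ _.
  have [u ru] := radial_represents gW rB (normr_ge0 p.2).
  have [v rv] := radial_represents gW rB (normr_ge0 q.2).
  split; first exact: represents_gaussian gW (represents_sub gW ru rv).
  rewrite (radial_increment gW hPhi dz rB)// lee_fin mul1r.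
  apply: le_trans (ler_dist_dist _ _) _.
  by have := norm3_le (p - q) `|p - q|; rewrite lexx => /esym/and3P[].
pose Z (t : R) w := V ((0, 0), t) w.
have cZ w : continuous (fun t => Z t w).
  move=> t; apply: (@continuous_comp R (R * R * R)%type R (fun t => ((0, 0), t)) (fun p => V p w)); last exact: cV.
  apply: (@differentiable_continuous R R (R * R * R)%type).
  have hi : differentiable (fun s : R => s) t by exact: ex_diff.
  exact: (differentiable_pair (differentiable_cst ((0, 0) : R * R) t) hi).
(* The almost sure equalities at the nonnegative rationals, numbered by [pickle], are gathered into
   one event. *)
have aeZ : {ae P, forall w, forall n, if unpickle n is Some q then
    0 <= (ratr (q : rat) : R) -> Z (ratr q) w = B (ratr q) w else True}.
  apply/ae_foralln => n; case: (unpickle n) => [q|]; last exact: aeW.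
  have [_ h] := VX ((0, 0), ratr q) I.
  by apply: filterS h => w hw q0; rewrite /Z hw /X /= ger0_norm.
apply: filterS aeZ => w hw.
have hq (q : rat) : 0 <= (ratr q : R) -> Z (ratr q) w = B (ratr q) w.
  by move=> q0; have := hw (pickle q); rewrite pickleK; apply.
apply: (@subspace_eq_continuous _ _ _ (fun t => Z t w)); last exact: continuous_subspaceT.
(* At t = 0 agreement holds because 0 is rational; for t > 0 both paths are continuous and agree at
   positive rationals. *)
move=> t /set_mem; rewrite /= in_itv/= andbT le_eqVlt => /predU1P[<-|t0].
  by have := hq 0; rewrite rmorph0; apply.
apply: (@eq_continuous_rat _ (fun t => Z t w) (fun t => B t w) _ _ _ t t0) => [s s0|s s0|q q0].
- exact: cZ.
- exact: cB.
- exact/hq/ltW.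
Qed.

Theorem mainTheorem3 (R : realType) (d : measure_display)
    (Omega : measurableType d) (P : probability Omega R)
    (W : (R * R -> R) -> Omega -> R) (Phi : R * R -> R * R -> R * R) :
  gaussian_free_field P W ->
  (forall z, disk z -> poincare_isometry (Phi z) /\ Phi z z = 0) ->
  let Wh := fun p : (R * R) * R => hyperbolic_average W Phi p.2 p.1 in
  let idx := (@disk R `*` `]0, +oo[) : set ((R * R) * R) in
  [/\ centred_gaussian_process P idx Wh,
      exists V : (R * R) * R -> Omega -> R, continuous_version P idx Wh V &
      forall V : (R * R) * R -> Omega -> R, continuous_version P idx Wh V ->
      forall z0 : R * R, disk z0 ->
        standard_brownian_motion P
          (fun t w => if 0 < t then V (z0, artanh (expR (- t))) w else 0)].
Proof.
move=> gW hPhi Wh idx.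
have oidx : open idx.
  have -> : idx = (fst @^-1` (@disk R)) `&` (snd @^-1` [set x : R | 0 < x]).
    by apply/seteqP; split => p [dp r0]; split=> //; move: r0; rewrite /= in_itv/= andbT.
  apply: openI.
    by apply: (@open_comp (R * R * R)%type); [move=> p _; exact: cvg_fst|exact: open_disk].
  by apply: (@open_comp (R * R * R)%type); [move=> p _; exact: cvg_snd|exact: open_gt].
have idxP p : idx p -> disk p.1 /\ 0 < p.2 by case=> ? /=; rewrite in_itv/= andbT.
have rep p : idx p -> represents P W (average_kernel Phi p) (Wh p).
  by case: p => z rho /idxP[dz r0]; exact: represents_average.
split.
- by apply: (represents_gaussian_process gW) => p ip; eexists; exact: rep.
- have [||N|V [cV VWh]] := @kolmogorov_continuous_version R d Omega P idx Wh.
  + exact: oidx.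
  + by move=> p /rep[].
  + exact: average_controlled_increments.
  + exists V; split; first exact: VWh.
    by move=> w; apply: continuous_in_subspaceT => p /set_mem ip; exact: cV.
- move=> V [VWh cV] z0 dz0; set B := fun t w => _.
  have artanh_idx t : 0 < t -> idx (z0, artanh (expR (- t))).
    by move=> t0; have [a0 _] := artanh_expRN t0; split => //=; rewrite in_itv/= andbT.
  have rB : radial P W Phi z0 B.
    split; first by apply/funext => w; rewrite /B ltxx.
    move=> t t0; have it := artanh_idx t t0; have [mV Vae] := VWh _ it.
    by rewrite /B t0; exact: represents_ae (rep _ it) mV Vae.
  split.
  + apply: (represents_gaussian_process gW) => t; rewrite /= in_itv/= andbT => t0.
    exact: radial_represents gW rB t0.
  + by move=> s t s0 t0; exact: radial_covariance gW hPhi dz0 rB s0 t0.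
  (* At t > 0 every path of B is continuous, since V is continuous on the open set [idx]; the almost
     sure argument is needed at t = 0 only. *)
  + apply: (radial_continuous gW hPhi dz0 rB) => t w t0.
    have cVt : {for (z0, artanh (expR (- t))), continuous (fun p => V p w)}.
      have := cV w; rewrite continuous_open_subspace//; apply.
      by apply/mem_set; exact: artanh_idx.
    have ce : {for t, continuous (fun s : R => artanh (expR (- s)))}.
      apply: (@continuous_comp _ _ _ (fun s : R => expR (- s)) (@artanh R)).
        by apply: continuous_comp; [exact: oppr_continuous|exact: continuous_expR].
      by apply: continuous_artanh; rewrite ?expR_gt0// -[ltRHS]expR0 ltr_expR oppr_lt0.
    have cp : {for t, continuous (fun s : R => (z0, artanh (expR (- s))) : R * R * R)}.
      exact: (cvg_pair (@cvg_cst _ z0 _ (nbhs t) _) ce).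
    have cc := @continuous_comp _ _ _ (fun s : R => (z0, artanh (expR (- s)))) (fun p => V p w) t cp cVt.
    have tpos : \forall s \near t, 0 < s by apply: open_nbhs_nbhs; split; [exact: open_gt|exact: t0].
    have Bt : B t w = V (z0, artanh (expR (- t))) w by rewrite /B t0.
    suff : (fun s => B s w) @ t --> B t w by [].
    rewrite Bt; apply: cvg_trans cc; apply: near_eq_cvg.
    by apply: filterS tpos => s s0; rewrite /B s0.
Qed.
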